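(* Assume that $\|\alpha_0\|_\infty<+\infty$. Let $A(\Lambda)=\{\alpha_\lambda:\lambda\in\Lambda\}$ be a finite dictionary of $M=|\Lambda|$ functions and assume that there is $b>0$ such that $\|\alpha\|_\infty\le b$ for any $\alpha\in A(\Lambda)$. Let $T>0$ and let $\hat\alpha_n$ be the aggregate with exponential weights with temperature $T$, $$\hat\alpha_n=\sum_{\lambda\in\Lambda}\theta(\alpha_\lambda)\alpha_\lambda,\qquad\theta(\alpha)=\frac{\exp(-nP_n(\ell_\alpha)/T)}{\sum_{\lambda\in\Lambda}\exp(-nP_n(\ell_{\alpha_\lambda})/T)}.$$ Then, for any $\epsilon>0$, there is a constant $c$ depending only on $b,\|\alpha_0\|_\infty,T,\epsilon$ such that for any $n\ge1$, $$\mathbb E^n\|\hat\alpha_n-\alpha_0\|^2\le(1+\epsilon)\inf_{\lambda\in\Lambda}\|\alpha_\lambda-\alpha_0\|^2+\frac{c\log M}{n}.$$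
   Context: Model. On a probability space with a filtration $(\mathcal F_t)_{t\ge0}$ satisfying the usual conditions, $N$ is a counting process (unit jumps, $N(0)=0$) with compensator $\Lambda(t)=\int_0^t\alpha_0(u,X)Y(u)\,du$, so $M=N-\Lambda$ is a martingale (these uses of the letters $\Lambda$, $M$ are unrelated to the index set and cardinality in the claim); here $\alpha_0\ge0$ is an unknown deterministic measurable function (the intensity), $X\in\mathbb R^d$ is an $\mathcal F_0$-measurable random vector (covariates) with law $P_X$ having support $[0,1]^d$, and $Y$ is a predictable process with values in $[0,1]$. One observes $n$ i.i.d. copies $D_n=\{(X_i,N^i(t),Y^i(t)):t\in[0,1],1\le i\le n\}$ of $(X,N,Y)$. $\mathbb E^n$ is the expectation with respect to the law of $D_n$. The dictionary elements are fixed measurable functions $\alpha_\lambda:[0,1]^{d+1}\to\mathbb R$ not depending on $D_n$ (for instance, estimators computed from observations independent of $D_n$, regarded as frozen). Norms. $\|\alpha\|_\infty=\sup_{(t,x)\in[0,1]^{d+1}}|\alpha(t,x)|$; $\|\alpha\|^2=\int\int_0^1\alpha(t,x)^2\,\mathbb E[Y(t)|X=x]\,dt\,P_X(dx)$. Empirical risk. $P_n(\ell_\alpha)=\frac1n\sum_{i=1}^n\int_0^1\alpha(t,X_i)^2Y^i(t)dt-\frac2n\sum_{i=1}^n\int_0^1\alpha(t,X_i)dN^i(t)$. *)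

(* Defs.v *)
From HB Require Import structures.
From mathcomp Require Import all_boot all_order all_algebra.
From mathcomp Require Import all_classical all_reals all_analysis.

Set Implicit Arguments.
Unset Strict Implicit.
Unset Printing Implicit Defensive.
Import Order.TTheory GRing.Theory Num.Theory.
Import numFieldNormedType.Exports.
Local Open Scope classical_set_scope.
Local Open Scope ring_scope.

(* A trajectory of a counting process, extended by 0 to negative times so that
   it induces a Lebesgue-Stieltjes measure on the whole line. For nat-valued
   nondecreasing functions, right-continuity means being constant immediately
   to the right of each time, and f t - f(t-) <= 1 is [cp_unit_jump]. *)
Record counting_path (R : realType) := CountingPath {
  cp_fun :> R -> nat ;
  cp_start : forall t : R, t <= 0 -> cp_fun t = 0%N ;
  cp_nondecreasing : forall s t, s <= t -> (cp_fun s <= cp_fun t)%N ;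
  cp_right_continuous : forall t, \forall s \near t^'+, cp_fun s = cp_fun t ;
  cp_unit_jump : forall t, \forall s \near t^'-, (cp_fun t <= (cp_fun s).+1)%N
}.

Definition cp_real (R : realType) (f : counting_path R) : R -> R :=
  fun t => (f t)%:R.

Section cp_cumulative.
Context (R : realType) (f : counting_path R).

Let cp_real_nd : nondecreasing (cp_real f).
Proof. by move=> s t st; rewrite ler_nat; exact: cp_nondecreasing. Qed.

Let cp_real_rc : right_continuous (cp_real f).
Proof.
move=> t; apply: cvg_near_cst.
by apply: filterS (cp_right_continuous f t) => s; rewrite /cp_real => ->.
Qed.

HB.instance Definition _ :=
  isCumulative.Build R _ R (cp_real f) cp_real_nd cp_real_rc.
End cp_cumulative.

Section filtrations.
Context (R : realType) (disp : measure_display) (Omega : measurableType disp).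
Context (P : probability Omega R) (F : R -> set (set Omega)).

(* Only the times t >= 0 are relevant. *)
Definition filtration :=
  [/\ forall t : R, 0 <= t -> sigma_algebra setT (F t),
      forall t : R, 0 <= t -> F t `<=` measurable &
      forall s t : R, 0 <= s -> s <= t -> F s `<=` F t].

Definition usual_conditions :=
  P.-negligible `<=` F 0 /\
  forall t : R, 0 <= t -> \bigcap_(s in [set s | t < s]) F s `<=` F t.

Definition sub_measurable d' (T : measurableType d') (G : set (set Omega))
    (Z : Omega -> T) :=
  forall B, measurable B -> G (Z @^-1` B).

Definition predictable_rectangles : set (set (R * Omega)) :=
  [set [set 0] `*` A | A in F 0] `|`
  [set C | exists (s t : R) A, [/\ 0 <= s, s < t, F s A & C = `]s, t] `*` A]].

Definition predictable (Y : R -> Omega -> R) :=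
  let D := `[0, +oo[ `*` [set: Omega] in
  forall B, measurable B ->
    <<s D, predictable_rectangles>> (D `&` [set p | B (Y p.1 p.2)]).

Definition martingale (M : R -> Omega -> R) :=
  (forall t : R, 0 <= t -> sub_measurable (F t) (M t) /\
                       P.-integrable setT (EFin \o M t)) /\
  (forall (s t : R) A, 0 <= s -> s <= t -> F s A ->
    (\int[P]_(w in A) (M t w)%:E = \int[P]_(w in A) (M s w)%:E)%E).

End filtrations.

Section model.
Context (R : realType) (d : nat).

Definition cube : set (d.-tuple R) := [set x | forall i, 0 <= tnth x i <= 1].

Definition time_cube : set (R * d.-tuple R) := `[0, 1] `*` cube.

(* The balls of the sup distance are a neighbourhood basis in R^d. *)
Definition law_support (mu : set (d.-tuple R) -> \bar R) : set (d.-tuple R) :=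
  [set x | forall r : R, 0 < r ->
    (0 < mu [set y | forall i, `|tnth y i - tnth x i|%R < r]%R)%E].

(* Functions of (t, x) are total; those given on [0,1]^(d+1) are identified with
   an arbitrary measurable extension, whose values off the cube are irrelevant
   because the covariates lie in [0,1]^d almost surely. *)
Definition supnorm (alpha : R * d.-tuple R -> R) : \bar R :=
  ereal_sup [set `|alpha z|%:E | z in time_cube].

Context (disp : measure_display) (Omega : measurableType disp).
Context (P : probability Omega R).

Definition compensator (alpha0 : R * d.-tuple R -> R)
    (X : Omega -> d.-tuple R) (Y : R -> Omega -> R) (t : R) (w : Omega) : R :=
  \int[lebesgue_measure]_(u in `[0, t]) (alpha0 (u, X w) * Y u w).

Record counting_model (F : R -> set (set Omega))
    (alpha0 : R * d.-tuple R -> R) (X : {mfun Omega >-> d.-tuple R})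
    (N : Omega -> counting_path R) (Y : R -> Omega -> R) : Prop := {
  cm_filtration : filtration F ;
  cm_usual : usual_conditions P F ;
  cm_intensity_measurable : measurable_fun setT alpha0 ;
  cm_intensity_ge0 : forall z, 0 <= alpha0 z ;
  cm_covariates_F0 : sub_measurable (F 0) X ;
  cm_covariates_support : law_support (distribution P X) = cube ;
  cm_adapted : forall (t : R) n, 0 <= t -> F t [set w | N w t = n] ;
  cm_predictable : predictable F Y ;
  cm_exposure_itv : forall (t : R) w, 0 <= t -> 0 <= Y t w <= 1 ;
  (* makes the real-valued integral [compensator] meaningful *)
  cm_compensator_fin : forall t : R, 0 <= t -> {ae P, forall w,
    (\int[lebesgue_measure]_(u in `[0%R, t]) (alpha0 (u, X w) * Y u w)%:E
      < +oo)%E} ;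
  cm_martingale :
    martingale P F (fun t w => (N w t)%:R - compensator alpha0 X Y t w)
}.

(* g (t, x) = E[Y(t) | X = x]: a version of the conditional expectation for each
   t in [0,1], chosen jointly measurable in (t, x) so that it can be integrated
   in t. Two such versions agree P_X-a.e. for each t, so [sqnorm] does not
   depend on the choice. *)
Definition cond_mean (X : {mfun Omega >-> d.-tuple R}) (Y : R -> Omega -> R)
    (g : R * d.-tuple R -> R) :=
  measurable_fun [set z : R * d.-tuple R | 0 <= z.1 <= 1] g /\
  forall t : R, 0 <= t <= 1 ->
    (distribution P X).-integrable setT (fun x => (g (t, x))%:E) /\
    forall B, measurable B ->
      (\int[distribution P X]_(x in B) (g (t, x))%:E =
       \int[P]_(w in X @^-1` B) (Y t w)%:E)%E.

Definition sqnorm (X : {mfun Omega >-> d.-tuple R}) (g : R * d.-tuple R -> R)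
    (alpha : R * d.-tuple R -> R) : \bar R :=
  (\int[distribution P X]_x \int[lebesgue_measure]_(t in `[0%R, 1%R])
     (alpha (t, x) ^+ 2 * g (t, x))%:E)%E.

(* (X, N, Y) for one individual *)
Definition observation := (d.-tuple R * counting_path R * (R -> R))%type.

Definition observe (X : Omega -> d.-tuple R) (N : Omega -> counting_path R)
    (Y : R -> Omega -> R) : Omega -> observation :=
  fun w => (X w, N w, fun t => Y t w).

(* The law of D is C |-> P (D^-1 C), on the largest sigma-algebra making D
   measurable. Cylinder sets would not suffice: the time integrals of Y that
   enter the empirical risk need not be measurable for them. *)
Definition iid_copies disp' (Omega' : measurableType disp')
    (P' : probability Omega' R) (D : Omega -> observation)
    n (Dn : 'I_n -> Omega' -> observation) :=
  (forall i C, measurable (D @^-1` C) -> measurable (Dn i @^-1` C)) /\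
  (forall C : 'I_n -> set observation,
    (forall i, measurable (D @^-1` C i)) ->
    (P' (\bigcap_(i in setT) (Dn i @^-1` C i)) =
     \prod_(i < n) P (D @^-1` C i))%E).

End model.

Section aggregation.
Context (R : realType) (d n : nat).

Definition empirical_risk (D : 'I_n -> observation R d)
    (alpha : R * d.-tuple R -> R) : R :=
  n%:R^-1 * (\sum_(i < n) \int[lebesgue_measure]_(t in `[0, 1])
      (alpha (t, (D i).1.1) ^+ 2 * (D i).2 t))
  - 2 / n%:R * (\sum_(i < n)
      \int[lebesgue_stieltjes_measure (cp_real (D i).1.2)]_(t in `]0, 1])
      alpha (t, (D i).1.1)).

Context (L : finType) (alpha : L -> R * d.-tuple R -> R) (T : R).

Definition exp_weight (D : 'I_n -> observation R d) (l : L) : R :=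
  expR (- n%:R * empirical_risk D (alpha l) / T)
  / \sum_(k : L) expR (- n%:R * empirical_risk D (alpha k) / T).

Definition aggregate (D : 'I_n -> observation R d) (z : R * d.-tuple R) : R :=
  \sum_(l : L) exp_weight D l * alpha l z.

End aggregation.

(* Main.v *)
(* For a bounded function f of time and covariates, E exp(int f dN - int (e^f - 1)
   dLambda) <= 1: for f a step function in time this is the supermartingale
   property of the discretised stochastic exponential, and it passes to bounded
   limits by Fatou's lemma.

   Applied to multiples of alpha - alpha_0, this bounds the excess loss
   h = l_alpha - l_(alpha_0) of one individual in two ways: with
   R = ||alpha - alpha_0||^2 and a small constant kappa,
   E exp(kappa (R - (1 + eta) h)) <= 1 and E h <= (1 + eta) R.
   By independence the first bound tensorises over the n individuals. By
   convexity, the risk of the aggregate is at most the theta-average of the risks R;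
   the variational formula for the entropy bounds this average by (1 + eta) times
   the theta-average of the empirical excess risks plus a term whose mean is at most
   (log M) / (kappa n), and the definition of the Gibbs weights bounds the former by
   the empirical excess risk of any fixed element plus T (log M) / n. Taking means and
   using the second bound gives the factor (1 + eta)^2 <= 1 + epsilon.

   The risk of the aggregate is not known to be a measurable function of the
   sample; the argument only uses that the integral is monotone. *)
Require Import Defs.
From HB Require Import structures.
From mathcomp Require Import all_boot all_order all_algebra.
From mathcomp Require Import all_classical all_reals all_analysis.
From mathcomp Require Import measurable_realfun zify ring lra.

Set Implicit Arguments.
Unset Strict Implicit.
Unset Printing Implicit Defensive.
Import Order.TTheory GRing.Theory Num.Theory.
Import numFieldNormedType.Exports.
Local Open Scope classical_set_scope.
Local Open Scope ring_scope.
Import HBNNSimple.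

(** * Integration without measurability, and transfer between laws *)

(** The rate 1/n rests on a variance condition. The excess loss is the squared loss Q minus twice
    the martingale integral of psi = alpha - alpha_0, whose predictable variation integrates psi^2
    against an intensity bounded by B, so it is at most B * Q. Second-order terms are thus multiples
    of the risk itself, and a small kappa hides them in eta * R. The exponential moments must be at
    most 1 exactly: the -1 of the linearised entropy bound then cancels, and no constant survives
    next to log M (for M = 1 the remainder is 0). Three obstacles shape the rest. The martingale is
    known only through its increments, and its grid exponential must be bounded to be integrable: it
    is frozen after k jumps, several jumps within one tick count as one, and unit jumps together
    with compactness of [0,1] make the discarded jumps vanish as the mesh shrinks. The sup-norm
    bounds hold on the cube only, so functions are set to 0 outside, which changes nothing almost
    surely. Observations carry no sigma-algebra, so independence is used for events and carried to
    products of functions by simple approximation. *)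

Section integral_tools.
Context d (T : measurableType d) (R : realType) (mu : {measure set T -> \bar R}).

(** The integral of a nonnegative function is a supremum over the simple functions below it, and
    those below [f] are below [g]. *)
Lemma integral_le_nonmeasurable (f g : T -> \bar R) :
  (forall x, 0 <= f x)%E -> (forall x, f x <= g x)%E ->
  (\int[mu]_x f x <= \int[mu]_x g x)%E.
Proof.
move=> f0 fg; have g0 x : (0 <= g x)%E by exact: le_trans (f0 x) (fg x).
rewrite !ge0_integralTE//; apply: ereal_sup_le => _ [h hf <-].
exists h => // x /=.
exact: le_trans (hf x) (fg x).
Qed.

(** Raising [g] to +oo on a null set that contains the exceptions makes the inequality hold
    everywhere and keeps the integral of the measurable [g]. *)
Lemma ae_integral_le_nonmeasurable (f g : T -> \bar R) :
  (forall x, 0 <= f x)%E ->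
  measurable_fun setT g ->
  {ae mu, forall x, (f x <= g x)%E} ->
  (\int[mu]_x f x <= \int[mu]_x g x)%E.
Proof.
move=> f0 mg [A [mA A0 fgA]].
pose h x := if x \in A then +oo%E else g x.
apply: (@le_trans _ _ (\int[mu]_x h x)%E).
  apply: integral_le_nonmeasurable => // x; rewrite /h.
  case: (boolP (x \in A)) => [_|xA]; first exact: leey.
  by apply: contrapT => nfg; move/negP: xA; apply; apply/mem_set/fgA.
have mh : measurable_fun setT h.
  apply: measurable_fun_ifT => //.
  by apply: (measurable_fun_bool true); rewrite setTI preimage_mem_true.
rewrite (ae_eq_integral g) //.
exists A; split => // x /= xgh; apply: contrapT => xA; apply: xgh => _.
by rewrite /h memNset.
Qed.

Lemma bounded_integrable (A : set T) (K : R) (f : T -> R) :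
  measurable A -> (mu A < +oo)%E -> measurable_fun A f ->
  (forall x, A x -> `|f x| <= K) -> mu.-integrable A (EFin \o f).
Proof.
move=> mA muA mf fK; apply: measurable_bounded_integrable => //.
exists K; split; first exact: num_real.
by move=> M KM x Ax; exact: le_trans (fK _ Ax) (ltW KM).
Qed.

Lemma bounded_cvg_Rintegral (A : set T) (K : R) (f_ : nat -> T -> R) (f : T -> R) :
  measurable A -> (mu A < +oo)%E ->
  (forall n, measurable_fun A (f_ n)) ->
  (forall n x, A x -> `|f_ n x| <= K) ->
  (forall x, A x -> f_ n x @[n --> \oo] --> f x) ->
  \int[mu]_(x in A) f_ n x @[n --> \oo] --> \int[mu]_(x in A) f x.
Proof.
move=> mA muA mf_ f_K f_f.
have mf : measurable_fun A f by apply: measurable_fun_cvg mf_ f_f.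
have [] := @dominated_convergence _ _ _ mu A mA (fun n x => (f_ n x)%:E)
   (EFin \o f) (fun=> K%:E).
- by move=> n; apply/measurable_EFinP.
- exact/measurable_EFinP.
- by apply: aeW => x Ax; apply: cvg_EFin; [exact: nearW|exact: f_f].
- by apply: (@bounded_integrable _ `|K|).
- by apply: aeW => x n Ax; rewrite /= lee_fin f_K.
by move=> fi _ fcvg; apply/fine_cvg; rewrite fineK//; exact: integrable_fin_num.
Qed.

Lemma fatou_le (c : R) (f_ : nat -> T -> R) (f : T -> R) :
  (forall n, measurable_fun setT (f_ n)) -> (forall n x, 0 <= f_ n x) ->
  (forall x, f_ n x @[n --> \oo] --> f x) ->
  (\forall n \near \oo, (\int[mu]_x (f_ n x)%:E <= c%:E)%E) ->
  (\int[mu]_x (f x)%:E <= c%:E)%E.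
Proof.
move=> mf_ f_0 f_f [N _ fc].
have ff x : (f x)%:E = limn_einf (fun n => (f_ (n + N)%N x)%:E).
  rewrite (cvg_limn_einf_sup (l := (f x)%:E))//.
  apply: cvg_EFin; first exact: nearW.
  by rewrite (@cvg_shiftn _ _ (fun n => f_ n x)).
under eq_integral do rewrite ff.
apply: le_trans (fatou mu measurableT _ _) _.
- by move=> n; apply/measurable_EFinP.
- by move=> n x _; rewrite lee_fin.
rewrite limn_einf_lim; apply: lime_le; first exact: is_cvg_einfs.
apply: nearW => n; apply: ge_ereal_inf; exists (\int[mu]_x (f_ (n + N)%N x)%:E)%E.
  by exists n => /=.
by apply: fc => /=; rewrite leq_addl.
Qed.

End integral_tools.

(** Simple functions with explicit coefficients and sets, so that an identity between measures of
    sets can be applied term by term. *)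
Definition step_sum d (S : measurableType d) (R : realType) (k : nat)
  (c : nat -> R) (A : nat -> set S) (x : S) : R :=
  \sum_(i < k) c i * \1_(A i) x.

Lemma step_sum_approx d (S : measurableType d) (R : realType) (f : S -> R) :
  measurable_fun setT f -> (forall x, 0 <= f x) ->
  exists (k : nat -> nat) (c : nat -> nat -> R) (A : nat -> nat -> set S),
  [/\ forall n i, 0 <= c n i, forall n i, measurable (A n i),
      forall x, nondecreasing_seq (fun n => step_sum (k n) (c n) (A n) x) &
      forall x, step_sum (k n) (c n) (A n) x @[n --> \oo] --> f x].
Proof.
move=> mf f0; have mfE : measurable_fun setT (EFin \o f) by exact/measurable_EFinP.
pose h := nnsfun_approx measurableT mfE.
pose s n : seq R := finmap.enum_fset (fset_set (h n @` setT)).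
exists (fun n => size (s n)), (fun n i => (s n)`_i), (fun n i => h n @^-1` [set (s n)`_i]).
have hE n x : step_sum (size (s n)) (fun i => (s n)`_i)
    (fun i => h n @^-1` [set (s n)`_i]) x = h n x.
  by rewrite /step_sum [in RHS](fimfunEord (h n)).
split.
(* Past the end of the list of values [nth] returns its default 0, which is still nonnegative. *)
- move=> n i; have [is_|is_] := ltnP i (size (s n)); last by rewrite nth_default.
  have := mem_nth 0 is_; rewrite in_fset_set; last exact: fimfunP.
  by move=> /set_mem [x _ <-].
- by move=> n i; exact: measurable_sfunP.
- move=> x m n mn; rewrite !hE.
  by have /lefP := nd_nnsfun_approx measurableT mfE mn; exact.
- move=> x; under eq_fun do rewrite hE.
  have := @cvg_nnsfun_approx _ _ _ _ measurableT _ mfE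
     (fun y _ => f0 y : (0 <= (EFin \o f) y)%E) x I.
  move=> /fine_cvg; exact.
Qed.

Section integral_transfer.
Context d (S : measurableType d) (R : realType).
Context d1 (T1 : measurableType d1) (mu1 : {measure set T1 -> \bar R}).
Context d2 (T2 : measurableType d2) (mu2 : {measure set T2 -> \bar R}).
Variables (X1 : T1 -> S) (X2 : T2 -> S) (u1 : T1 -> R) (u2 : T2 -> R).

Lemma step_sum_integral d' (T : measurableType d') (mu : {measure set T -> \bar R})
  (X : T -> S) (u : T -> R) k (c : nat -> R) (A : nat -> set S) :
  measurable_fun setT X -> measurable_fun setT u -> (forall x, 0 <= u x) ->
  (forall i, 0 <= c i) -> (forall i, measurable (A i)) ->
  (\int[mu]_x (step_sum k c A (X x) * u x)%:E =
   \sum_(i < k) (c i)%:E * \int[mu]_(x in X @^-1` A i) (u x)%:E)%E.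
Proof.
move=> mX mu_ u0 c0 mA.
have mXA i : measurable (X @^-1` A i) by rewrite -[_ @^-1` _]setTI; exact: mX.
under eq_integral do rewrite /step_sum big_distrl/= -sumEFin.
have mi i : measurable_fun setT (fun x => (\1_(A i) (X x) * u x)%:E).
  apply/measurable_EFinP; apply: measurable_funM => //.
  by apply: (@measurableT_comp _ _ _ _ _ _ (\1_(A i) : S -> R)) => //; exact: measurable_indic.
rewrite ge0_integral_sum//; last 2 first.
- move=> i; under eq_fun do rewrite -mulrA EFinM.
  exact: measurable_funeM.
- by move=> i x _; rewrite lee_fin !mulr_ge0// indicE.
apply: eq_bigr => i _; under eq_integral do rewrite -mulrA EFinM.
rewrite ge0_integralZl_EFin//; last by move=> x _; rewrite lee_fin mulr_ge0// indicE.
congr (_ * _)%E; rewrite [RHS]integral_mkcond; apply: eq_integral => x _.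
rewrite patchE indicE (_ : (X x \in A i) = (x \in X @^-1` A i))//.
by case: ifPn => _; rewrite ?mul1r ?mul0r.
Qed.

(** The weighted measures [u1 * mu1] and [u2 * mu2] have the same image on [S]; equality on sets
    extends to [phi] by monotone convergence. With unit weights it compares laws, with [Y t] as a
    weight it is the defining property of a conditional expectation. *)
Lemma integral_transfer (phi : S -> R) :
  measurable_fun setT X1 -> measurable_fun setT X2 ->
  measurable_fun setT u1 -> measurable_fun setT u2 ->
  (forall x, 0 <= u1 x) -> (forall x, 0 <= u2 x) ->
  measurable_fun setT phi -> (forall x, 0 <= phi x) ->
  (forall B, measurable B -> (\int[mu1]_(x in X1 @^-1` B) (u1 x)%:E =
     \int[mu2]_(x in X2 @^-1` B) (u2 x)%:E)%E) ->
  (\int[mu1]_x (phi (X1 x) * u1 x)%:E = \int[mu2]_x (phi (X2 x) * u2 x)%:E)%E.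
Proof.
move=> mX1 mX2 mu1_ mu2_ u10 u20 mphi phi0 h12.
have [k [c [A [c0 mA ndA cvgA]]]] := step_sum_approx mphi phi0.
have ss0 n x : 0 <= step_sum (k n) (c n) (A n) x.
  by apply: sumr_ge0 => i _; rewrite mulr_ge0// indicE.
have mss n : measurable_fun setT (step_sum (k n) (c n) (A n)).
  apply: measurable_sum => i; exact: measurable_funM.
have key d' (T : measurableType d') (mu : {measure set T -> \bar R})
  (X : T -> S) (u : T -> R) : measurable_fun setT X -> measurable_fun setT u ->
  (forall x, 0 <= u x) ->
  (\int[mu]_x (step_sum (k n) (c n) (A n) (X x) * u x)%:E @[n --> \oo] -->
  \int[mu]_x (phi (X x) * u x)%:E)%E.
  move=> mX mu_ u0.
  have -> : (\int[mu]_x (phi (X x) * u x)%:E =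
      \int[mu]_x limn (fun n => (step_sum (k n) (c n) (A n) (X x) * u x)%:E))%E.
    apply: eq_integral => x _; apply/esym/cvg_lim => //.
    by apply: cvg_EFin; [exact: nearW|apply: cvgMl; exact: cvgA].
  apply: cvg_monotone_convergence => //.
  - move=> n; apply/measurable_EFinP; apply: measurable_funM => //.
    exact: measurableT_comp.
  - by move=> n x _; rewrite lee_fin mulr_ge0.
  - by move=> x _ m n mn; rewrite lee_fin ler_wpM2r//; exact: ndA.
have k1 := key _ _ mu1 X1 u1 mX1 mu1_ u10.
apply: (cvg_unique _ k1) => //.
have := key _ _ mu2 X2 u2 mX2 mu2_ u20.
under eq_fun do rewrite step_sum_integral//.
under [X in _ -> X @ _ --> _]eq_fun do rewrite step_sum_integral//.
move=> + ; apply: cvg_trans; apply: near_eq_cvg; apply: nearW => n.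
by apply: eq_bigr => i _; rewrite h12.
Qed.

End integral_transfer.

(** * Expectations over i.i.d. copies *)

Section iid.
Context (R : realType) (d : nat).
Context disp (Omega : measurableType disp) (P : probability Omega R).
Context disp' (Omega' : measurableType disp') (P' : probability Omega' R).
Context (D : Omega -> observation R d) (n : nat)
  (Dn : 'I_n -> Omega' -> observation R d).
Hypothesis iid : iid_copies P P' D Dn.
Context d1 (S : measurableType d1).

Lemma iid_measurable (f : observation R d -> S) i :
  measurable_fun setT (f \o D) -> measurable_fun setT (f \o Dn i).
Proof.
move=> mf _ B mB; rewrite setTI comp_preimage; apply: iid.1.
by rewrite -comp_preimage -[_ @^-1` _]setTI; exact: mf.
Qed.

(** In the product formula all other factors are taken to be the full space. *)
Lemma iid_law C i : measurable (D @^-1` C) -> P' (Dn i @^-1` C) = P (D @^-1` C).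
Proof.
move=> mC; pose C' j := if j == i then C else setT.
have := iid.2 C'; rewrite (bigD1 i)//= [X in (_ * X)%E]big1.
  rewrite mule1 {3}/C' eqxx => <-.
    congr (P' _); apply/seteqP; split => [w wC j _|w /(_ i I)]; rewrite /C'/=.
      by case: eqP => [->|].
    by rewrite eqxx.
  by move=> j; rewrite /C'; case: eqP => // _; rewrite preimage_setT.
by move=> j /negPf ji; rewrite /C' ji preimage_setT probability_setT.
Qed.

End iid.

Lemma cvg_prodr (R : realType) (I : Type) (r : seq I) (F : I -> nat -> R) (a : I -> R) :
  (forall i, F i m @[m --> \oo] --> a i) ->
  \prod_(i <- r) F i m @[m --> \oo] --> \prod_(i <- r) a i.
Proof.
move=> Fa; elim: r => [|i r IH].
  by rewrite big_nil; under eq_fun do rewrite big_nil; exact: cvg_cst.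
by rewrite big_cons; under eq_fun do rewrite big_cons; exact: cvgM.
Qed.

Section iid_expectation.
Context (R : realType) (d : nat).
Context disp (Omega : measurableType disp) (P : probability Omega R).
Context disp' (Omega' : measurableType disp') (P' : probability Omega' R).
Context (D : Omega -> observation R d) (n : nat)
  (Dn : 'I_n -> Omega' -> observation R d).
Hypothesis iid : iid_copies P P' D Dn.

(** Laws are compared after composition with a real-valued [f], since [observation] itself is not a
    measurable space. *)
Lemma iid_ge0_integral (f : observation R d -> R) (phi : R -> R) i :
  measurable_fun setT (f \o D) ->
  measurable_fun setT phi -> (forall x, 0 <= phi x) ->
  (\int[P']_w (phi (f (Dn i w)))%:E = \int[P]_w (phi (f (D w)))%:E)%E.
Proof.
move=> mf mphi phi0.
have := @integral_transfer _ R R _ _ P' _ _ P (f \o Dn i) (f \o D) (cst 1) (cst 1)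
  phi (iid_measurable iid i mf) mf.
under eq_integral do rewrite /= mulr1.
move=> -> //.
  by apply: eq_integral => x _; rewrite /= mulr1.
move=> B mB.
have mB' : measurable ((f \o D) @^-1` B) by rewrite -[_ @^-1` _]setTI; exact: mf.
have mB'' : measurable ((f \o Dn i) @^-1` B).
  by rewrite -[_ @^-1` _]setTI; exact: (iid_measurable iid i mf).
have cstE d0 (T0 : measurableType d0) (mu : {measure set T0 -> \bar R}) C :
    measurable C -> (\int[mu]_(x in C) (cst 1 x)%:E = mu C)%E.
  by move=> mC; rewrite (integral_cst mu mC 1%E) mul1e.
by rewrite !cstE//; exact: (iid_law iid (C := f @^-1` B) i mB').
Qed.

Lemma iid_integral (f : observation R d -> R) i :
  P.-integrable setT (EFin \o f \o D) ->
  P'.-integrable setT (EFin \o f \o Dn i) /\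
  (\int[P']_w (f (Dn i w))%:E = \int[P]_w (f (D w))%:E)%E.
Proof.
move=> fi; have mf : measurable_fun setT (f \o D).
  exact/measurable_EFinP/(measurable_int P).
split.
  apply/integrableP; split.
    by apply/measurable_EFinP; apply: (iid_measurable iid i mf).
  have /integrableP[_] := fi; rewrite /=.
  by rewrite (iid_ge0_integral (phi := @Num.norm R R)).
rewrite integralE [RHS]integralE; congr (_ - _)%E.
  under eq_integral do rewrite funeposE -EFin_max.
  under [RHS]eq_integral do rewrite funeposE -EFin_max.
  apply: (iid_ge0_integral (phi := fun x => Num.max x 0)) => //.
    exact: measurable_maxr.
  by move=> x; rewrite le_max lexx orbT.
under eq_integral do rewrite funenegE -EFinN -EFin_max.
under [RHS]eq_integral do rewrite funenegE -EFinN -EFin_max.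
apply: (iid_ge0_integral (phi := fun x => Num.max (- x) 0)) => //.
  exact: measurable_maxr.
by move=> x; rewrite le_max lexx orbT.
Qed.

(** The product formula is given for events. It extends to simple functions of [f] by expanding the
    product of sums, and to [f] by Fatou; simple functions below [f] have mean at most 1, hence so
    has their product. *)
Lemma iid_prod_integral_le1 (f : observation R d -> R) :
  measurable_fun setT (f \o D) -> (forall x, 0 <= f x) ->
  (\int[P]_w (f (D w))%:E <= 1)%E ->
  (\int[P']_w (\prod_(i < n) f (Dn i w))%:E <= 1)%E.
Proof.
move=> mf f0 f1.
have mid : measurable_fun setT (fun x : R => Num.max x 0) by exact: measurable_maxr.
have mid0 x : 0 <= Num.max x 0 :> R by rewrite le_max lexx orbT.
have [k [c [A [c0 mA ndA cvgA]]]] := step_sum_approx mid mid0.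
pose s m := step_sum (k m) (c m) (A m).
have s0 m x : 0 <= s m x by apply: sumr_ge0 => i _; rewrite mulr_ge0// indicE.
have ms m : measurable_fun setT (s m).
  by apply: measurable_sum => i; exact: measurable_funM.
have fmax x : Num.max (f x) 0 = f x by apply/max_idPl.
have sf m x : s m (f x) <= f x.
  rewrite -[leRHS]fmax -(cvg_lim _ (cvgA (f x)))//.
  apply: nondecreasing_cvgn_le; first exact: ndA.
  by apply/cvg_ex; eexists; exact: cvgA.
have mfA j B : measurable B -> measurable (Dn j @^-1` (f @^-1` B)).
  move=> mB; rewrite -comp_preimage -[_ @^-1` _]setTI.
  exact: (iid_measurable iid j mf).
have mDA B : measurable B -> measurable (D @^-1` (f @^-1` B)).
  by move=> mB; rewrite -comp_preimage -[_ @^-1` _]setTI; exact: mf.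
pose p m j := fine (P (D @^-1` (f @^-1` A m j))).
have pE m j : P (D @^-1` (f @^-1` A m j)) = (p m j)%:E.
  by rewrite /p fineK// fin_num_measure//; exact: mDA.
have EsE m : (\int[P]_w (s m (f (D w)))%:E = (\sum_(j < k m) c m j * p m j)%:E)%E.
  have := @step_sum_integral _ _ R _ _ P (f \o D) (cst 1) (k m) (c m) (A m) mf
     (measurable_cst _) (fun=> ler01) (c0 m) (mA m).
  under eq_integral do rewrite mulr1.
  move=> ->; rewrite -sumEFin; apply: eq_bigr => j _.
  rewrite EFinM -pE; congr (_ * _)%E.
  by rewrite (integral_cst P (mDA _ (mA m j)) 1%E) mul1e.
(* One term of the expanded product: the product of indicators is the indicator of an intersection
   to which independence applies. *)
have prodE m (phi : {ffun 'I_n -> 'I_(k m)}) :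
    (\int[P']_w (\prod_(i < n) (c m (phi i) * \1_(A m (phi i)) (f (Dn i w))))%:E =
     (\prod_(i < n) (c m (phi i) * p m (phi i)))%:E)%E.
  pose C i := f @^-1` A m (phi i).
  have mC : measurable (\bigcap_(i in setT) (Dn i @^-1` C i)).
    apply: fin_bigcap_measurable => //.
    by move=> i _; apply: mfA.
  have -> : (fun w => (\prod_(i < n) (c m (phi i) * \1_(A m (phi i)) (f (Dn i w))))%:E) =
    (fun w => (\prod_(i < n) c m (phi i))%:E *
       (\1_(\bigcap_(i in setT) (Dn i @^-1` C i)) w)%:E)%E.
    apply/funext => w; rewrite big_split/= EFinM; congr (_ * _%:E)%E.
    rewrite indicE; case: (boolP (w \in _)) => [/set_mem wC|wC].
      by apply: big1 => i _; rewrite indicE mem_set//; exact: wC.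
    have [i wCi] : exists i, ~ (Dn i @^-1` C i) w.
      apply: contrapT => nwC; move/negP: wC; apply; apply/mem_set => i _.
      by apply: contrapT => nw; apply: nwC; exists i.
    by rewrite (bigD1 i)//= indicE memNset// mul0r.
  rewrite ge0_integralZl_EFin//; last 2 first.
  - exact/measurable_EFinP/measurable_indic.
  - exact: prodr_ge0.
  rewrite integral_indic// setIT.
  rewrite [X in (_ * X)%E](_ : _ = (\prod_(i < n) P (D @^-1` C i))%E); last first.
    by apply: (iid.2 C) => i; apply: mDA.
  rewrite [X in (_ * X)%E](_ : _ = (\prod_(i < n) (p m (phi i)))%:E).
    by rewrite -EFinM -big_split.
  by rewrite -prodEFin; apply: eq_bigr => i _; rewrite -pE.
have sE m : (\int[P']_w (\prod_(i < n) s m (f (Dn i w)))%:E =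
   (\prod_(i < n) \sum_(j < k m) c m j * p m j)%:E)%E.
  under eq_integral do rewrite bigA_distr_bigA/= -sumEFin.
  rewrite ge0_integral_sum//; last 2 first.
    move=> phi; apply/measurable_EFinP; apply: measurable_prod => i _.
    apply: measurable_funM => //.
    apply: (@measurableT_comp _ _ _ _ _ _ (\1_(A m (phi i)) : R -> R) _ (fun w => f (Dn i w))) => //.
    exact: (iid_measurable iid i mf).
    by move=> phi x _; rewrite lee_fin prodr_ge0// => i _; rewrite mulr_ge0// indicE.
  by rewrite bigA_distr_bigA/= -sumEFin; apply: eq_bigr => phi _; rewrite prodE.
apply: (@fatou_le _ _ _ P' 1 (fun m w => \prod_(i < n) s m (f (Dn i w)))).
- move=> m; apply: measurable_prod => i _.
  exact: (measurableT_comp (ms m) (iid_measurable iid i mf)).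
- by move=> m w; apply: prodr_ge0.
- move=> w.
  have := @cvg_prodr R 'I_n (index_enum 'I_n) (fun i m => s m (f (Dn i w))) (fun i => f (Dn i w)).
  by apply => i; rewrite -[X in _ --> X]fmax; exact: cvgA.
- apply: nearW => m; rewrite sE lee_fin; apply: prodr_ile1 => i _.
  rewrite -!lee_fin -EsE; apply/andP; split.
    by apply: integral_ge0 => w _; rewrite lee_fin.
  apply: le_trans f1; apply: ge0_le_integral => //.
  - by move=> w _; rewrite lee_fin.
  - by apply/measurable_EFinP; exact: (measurableT_comp (ms m) mf).
  - exact/measurable_EFinP.
  - by move=> w _; rewrite lee_fin.
Qed.

End iid_expectation.

(** * Monotone-class argument for functions of time and covariates *)

Section bounded_closure.
Context (R : realType) d (S : measurableType d).
Implicit Types f g : R * S -> R.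

(** Cells are open at the left and closed at the right, like the intervals to which a
    right-continuous path assigns its increments. *)
Definition grid_const (r : nat) f := forall (j : nat) (s t : R) x,
  j%:R / r%:R < s <= j.+1%:R / r%:R -> j%:R / r%:R < t <= j.+1%:R / r%:R ->
  f (s, x) = f (t, x).

(** Cell [j] of the finer grid lies in cell [j %/ q] of the coarser one. *)
Lemma grid_const_refine r q f : (0 < r)%N -> (0 < q)%N ->
  grid_const r f -> grid_const (r * q) f.
Proof.
move=> r0 q0 fr j s t x; have jE := divn_eq j q; have jq := ltn_pmod j q0.
have r0' : 0 < r%:R :> R by rewrite ltr0n.
have q0' : 0 < q%:R :> R by rewrite ltr0n.
have h1 : (j %/ q)%:R / r%:R <= j%:R / (r * q)%:R :> R.
  rewrite natrM ler_pdivrMr// mulrAC ler_pdivlMr ?mulr_gt0//.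
  rewrite mulrA mulrAC ler_pM2r// -natrM ler_nat.
  exact: leq_trunc_div.
have h2 : j.+1%:R / (r * q)%:R <= (j %/ q).+1%:R / r%:R :> R.
  rewrite natrM ler_pdivlMr// mulrAC ler_pdivrMr ?mulr_gt0//.
  rewrite mulrA mulrAC ler_pM2r// -natrM ler_nat.
  exact: ltn_ceil.
move=> /andP[js sj] /andP[jt tj]; apply: (fr (j %/ q)%N).
  by rewrite (le_lt_trans h1 js) (le_trans sj h2).
by rewrite (le_lt_trans h1 jt) (le_trans tj h2).
Qed.

(* Bounded pointwise limits of functions that are step functions in time, the class
   on which the exponential moment bound can be checked on grids. *)
Inductive bclosure : (R * S -> R) -> Prop :=
| bclosure_step r K f : (0 < r)%N -> measurable_fun setT f ->
    (forall z, `|f z| <= K) -> grid_const r f -> bclosure f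
| bclosure_lim (F : nat -> R * S -> R) K f :
    (forall m, bclosure (F m)) -> (forall m z, `|F m z| <= K) ->
    (forall z, F m z @[m --> \oo] --> f z) -> bclosure f.

Lemma bclosure_measurable f : bclosure f -> measurable_fun setT f.
Proof.
elim=> // F K g _ mF _ Fg; exact: (@measurable_fun_cvg _ _ _ setT F).
Qed.

Lemma bclosure_bounded f : bclosure f -> exists K, forall z, `|f z| <= K.
Proof.
elim=> [r K g _ _ gK _|F K g _ _ FK Fg]; first by exists K.
exists K => z; rewrite -(cvg_lim _ (cvg_norm (Fg z)))//.
apply: limr_le; first by apply/cvg_ex; eexists; apply: cvg_norm; exact: Fg.
exact: nearW.
Qed.

(** Two step functions have the common grid [r * r']. Limits are absorbed one argument at a time, by
    an induction on [g] inside an induction on [f]; boundedness of [op] on bounded sets supplies the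
    uniform bound that the limit constructor asks for. *)
Lemma bclosure_op (op : R -> R -> R) :
  (forall (u v : nat -> R) a b, u m @[m --> \oo] --> a -> v m @[m --> \oo] --> b ->
     op (u m) (v m) @[m --> \oo] --> op a b) ->
  (forall K L, exists M, forall x y, `|x| <= K -> `|y| <= L -> `|op x y| <= M) ->
  (forall f g, measurable_fun setT f -> measurable_fun setT g ->
     measurable_fun setT (fun z => op (f z) (g z))) ->
  forall f g, bclosure f -> bclosure g -> bclosure (fun z => op (f z) (g z)).
Proof.
move=> opc opb opm f g cf; elim: cf g => {f} [r K f r0 mf fK fr|F K f cF IH FK Ff] g cg.
  elim: cg => {g} [r' L g r'0 mg gL gr|G L g cG IH GL Gg].
    have [M opM] := opb K L.
    apply: (@bclosure_step (r * r') M); first by rewrite muln_gt0 r0.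
    - exact: opm.
    - by move=> z; exact: opM.
    - move=> j s t x js jt.
      rewrite (grid_const_refine r0 r'0 fr x js jt).
      rewrite mulnC in js jt.
      by rewrite (grid_const_refine r'0 r0 gr x js jt).
  have [M opM] := opb K L.
  apply: (@bclosure_lim (fun m z => op (f z) (G m z)) M) => //.
    by move=> m z; exact: opM.
  by move=> z; apply: opc => //; exact: cvg_cst.
have [L gL] := bclosure_bounded cg; have [M opM] := opb K L.
apply: (@bclosure_lim (fun m z => op (F m z) (g z)) M).
- by move=> m; exact: IH.
- by move=> m z; exact: opM.
- by move=> z; apply: opc => //; exact: cvg_cst.
Qed.

Lemma bclosureD f g : bclosure f -> bclosure g -> bclosure (fun z => f z + g z).
Proof.
apply: (@bclosure_op +%R) => [u v a b|K L|]; first exact: cvgD.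
  by exists (K + L) => x y xK yL; rewrite (le_trans (ler_normD _ _))// lerD.
by move=> ? ? ? ?; exact: measurable_funD.
Qed.

Lemma bclosureM f g : bclosure f -> bclosure g -> bclosure (fun z => f z * g z).
Proof.
apply: (@bclosure_op *%R) => [u v a b|K L|]; first exact: cvgM.
  by exists (K * L) => x y xK yL; rewrite normrM ler_pM.
by move=> ? ? ? ?; exact: measurable_funM.
Qed.

Lemma bclosure_cst c : bclosure (fun=> c).
Proof. exact: (@bclosure_step 1 `|c|). Qed.

Let in_closure := [set C : set (R * S) | bclosure (\1_C)].

Let in_closureC C : in_closure C -> in_closure (~` C).
Proof.
move=> cC; rewrite /in_closure/=.
have -> : \1_(~` C) = (fun z => 1 + (-1) * \1_C z) :> (R * S -> R).
  apply/funext => z; rewrite !indicE in_setC; case: (z \in C) => /=; lra.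
by apply: bclosureD; [|apply: bclosureM => //]; exact: bclosure_cst.
Qed.

Let in_closureI A B : in_closure A -> in_closure B -> in_closure (A `&` B).
Proof.
move=> cA cB; rewrite /in_closure/= indicI.
by apply: bclosureM.
Qed.

Let in_closureU A B : in_closure A -> in_closure B -> in_closure (A `|` B).
Proof.
by move=> cA cB; rewrite -[A `|` B]setCK setCU; apply/in_closureC/in_closureI; exact: in_closureC.
Qed.

Let in_closure0 : in_closure set0.
Proof. by rewrite /in_closure/= indic0; exact: bclosure_cst. Qed.

Let in_closure_bigcup (A : nat -> set (R * S)) :
  (forall n, in_closure (A n)) -> in_closure (\bigcup_n A n).
Proof.
move=> cA; rewrite /in_closure/=.
apply: (@bclosure_lim (fun m => \1_(\big[setU/set0]_(i < m) A i)) 1).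
- elim=> [|m IH]; first by rewrite big_ord0; exact: in_closure0.
  by rewrite big_ord_recr/=; exact: in_closureU.
- by move=> m z; rewrite indicE ger0_norm// lern1 leq_b1.
- move=> z; rewrite [X in _ --> X]indicE; case: (boolP (z \in _)) => [/set_mem[n _ Anz]|nz].
    apply: cvg_near_cst; near=> m; rewrite indicE mem_set//.
    rewrite -bigcup_mkord; exists n => //=.
    by near: m; exists n.+1.
  apply: cvg_near_cst; apply: nearW => m; rewrite indicE memNset//.
  rewrite -bigcup_mkord => -[n _ Anz]; move/negP : nz; apply; apply/mem_set.
  by exists n.
Unshelve. all: by end_near. Qed.

Let in_closure_snd (B : set S) : measurable B -> in_closure (setT `*` B).
Proof.
move=> mB; apply: (@bclosure_step 1 1) => //.
- by apply: measurable_indic; exact: measurableX.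
- by move=> z; rewrite indicE ger0_norm// lern1 leq_b1.
Qed.

(** [b m / m.+1] is the largest grid point strictly below [a]. The open rays starting there contain
    [[a, +oo[], and a fixed t < a leaves them once (a - t) * m.+1 >= 1. As [b m] is an integer,
    membership is constant on each cell. *)
Let in_closure_fst_ray (a : R) : in_closure (`[a, +oo[ `*` setT).
Proof.
pose b m : R := (Num.ceil (a * m.+1%:R) - 1)%:~R.
have bE m t : (b m / m.+1%:R < t) = (b m < t * m.+1%:R) by rewrite ltr_pdivrMr.
apply: (@bclosure_lim (fun m => \1_(`]b m / m.+1%:R, +oo[ `*` setT)) 1).
- move=> m; apply: (@bclosure_step m.+1 1) => //.
  + by apply: measurable_indic; exact: measurableX.
  + by move=> z; rewrite indicE ger0_norm// lern1 leq_b1.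
  + have m0 : 0 < m.+1%:R :> R by [].
    have key j t : j%:R / m.+1%:R < t <= j.+1%:R / m.+1%:R ->
       (b m / m.+1%:R < t) = (b m < j.+1%:R).
      rewrite bE ltr_pdivrMr// ler_pdivlMr// => /andP[jt tj].
      apply/idP/idP => [/lt_le_trans|]; first exact.
      rewrite /b -[j.+1%:R]/((Posz j.+1)%:~R) ltr_int => bj.
      apply: le_lt_trans jt; rewrite -[j%:R]/((Posz j)%:~R) ler_int.
      by rewrite -ltzD1 -PoszD addn1.
    move=> j s t x js jt; rewrite !indicE !in_setX !in_setT !andbT/=.
    by rewrite !mem_setE/= !in_itv/= !andbT (key _ _ js) (key _ _ jt).
- by move=> m z; rewrite indicE ger0_norm// lern1 leq_b1.
- move=> [t x]; apply: cvg_near_cst; have [at_|ta] := leP a t.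
    apply: nearW => m; rewrite !indicE !in_setX !in_setT !mem_setE/= !in_itv/= !andbT at_.
    rewrite bE (lt_le_trans _ (_ : a * m.+1%:R <= _))// ?ler_wpM2r//.
    exact: gt_pred_ceil.
  near=> m; rewrite !indicE !in_setX !in_setT !mem_setE/= !in_itv/= !andbT leNgt ta/=.
  rewrite (_ : (_ < t) = false)//; apply/negbTE; rewrite bE -leNgt /b intrB.
  rewrite lerBrDr (le_trans _ (ceil_ge _))//.
  have m1 : (a - t)^-1 <= m.+1%:R.
    apply: (@le_trans _ _ m%:R); last by rewrite ler_nat.
    by near: m; exact: nbhs_infty_ger.
  have : (a - t)^-1 * (a - t) <= m.+1%:R * (a - t) by rewrite ler_wpM2r// subr_ge0 ltW.
  by rewrite mulVf ?subr_eq0 ?gt_eqF//; lra.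
Unshelve. all: by end_near. Qed.

(** The sets with indicator in the closure form a sigma-algebra. It contains the cylinders over
    rays, hence over Borel sets of times, and those over measurable sets of [S]; their intersections
    generate the product sigma-algebra. *)
Lemma bclosure_indic C : measurable C -> bclosure (\1_C).
Proof.
have sC : sigma_algebra setT in_closure.
  by split => // A cA; rewrite setTD; exact: in_closureC.
have fstC (A : set R) : measurable A -> in_closure (A `*` setT).
  move=> mA; have {mA} : (@RGenCInfty.G R).-sigma.-measurable A by rewrite -RGenCInfty.measurableE.
  pose G := [set A : set R | in_closure (A `*` setT)].
  have : <<s @RGenCInfty.G R >> `<=` G.
    apply: smallest_sub.
      split.
      - by rewrite /G/= set0X.
      - move=> B; rewrite /G/= setTD => /in_closureC; congr in_closure.
        by apply/seteqP; split => -[x y]/=; tauto.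
      - move=> B BG; rewrite /G/= (_ : _ `*` _ = \bigcup_n (B n `*` setT)).
          exact: in_closure_bigcup.
        apply/seteqP; split => -[x y]/=; first by move=> [[n _ Bn] _]; exists n.
        by move=> [n _ [? _]]; split => //; exists n.
    by move=> _ [x ->]; exact: in_closure_fst_ray.
  by apply.
rewrite measurable_prod_measurableType => mC.
suff : <<s [set A `*` B | A in @measurable _ R & B in @measurable _ S] >> `<=` in_closure.
  exact.
apply: smallest_sub => // _ [A mA [B mB <-]].
rewrite -[A `*` B](_ : (A `*` setT) `&` (setT `*` B) = _).
  by apply: in_closureI; [exact: fstC|exact: in_closure_snd].
by apply/seteqP; split => -[x y]/=; tauto.
Qed.

(** Adding [K] makes [f] nonnegative, hence an increasing limit of simple functions, all bounded by
    2 * K. *)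
Lemma bounded_measurable_bclosure K f : measurable_fun setT f ->
  (forall z, `|f z| <= K) -> bclosure f.
Proof.
move=> mf fK.
have fK0 z : 0 <= f z + K by have := fK z; rewrite ler_norml => /andP[]; lra.
have mfK : measurable_fun setT (fun z => f z + K) by exact: measurable_funD.
have [k [c [A [c0 mA ndA cvgA]]]] := step_sum_approx mfK fK0.
have -> : f = (fun z => (f z + K) + (- K)) by apply/funext => z; rewrite addrK.
apply: bclosureD; last exact: bclosure_cst.
apply: (@bclosure_lim (fun m => step_sum (k m) (c m) (A m)) (K + K)) => //.
- move=> m; rewrite /step_sum; elim: (k m) => [|l IH].
    have -> : (fun x : R * S => \sum_(i < 0) c m i * \1_(A m i) x) = (fun=> 0).
      by apply/funext => x; rewrite big_ord0.
    exact: bclosure_cst.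
  have -> : (fun x : R * S => \sum_(i < l.+1) c m i * \1_(A m i) x) =
     (fun x => \sum_(i < l) c m i * \1_(A m i) x + c m l * \1_(A m l) x).
    by apply/funext => x; rewrite big_ord_recr.
  apply: bclosureD => //; apply: bclosureM; first exact: bclosure_cst.
  exact: bclosure_indic.
- move=> m z; rewrite ger0_norm; last by apply: sumr_ge0 => i _; rewrite mulr_ge0// indicE.
  apply: (@le_trans _ _ (f z + K)).
    rewrite -(cvg_lim _ (cvgA z))//; apply: nondecreasing_cvgn_le; first exact: ndA.
    by apply/cvg_ex; eexists; exact: cvgA.
  by rewrite lerD2r; have := fK z; rewrite ler_norml => /andP[].
Qed.

End bounded_closure.

(** * Integrals against counting paths *)

Section counting_path_theory.
Context (R : realType) (N : counting_path R).

(** Unit jumps are a local property with a radius that depends on the point; compactness of [0,1]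
    gives one mesh below which no interval holds two jumps. *)
Lemma counting_path_unit_increments : \forall m \near \oo, forall s t : R,
  0 <= s <= 1 -> s <= t -> t <= s + m.+1%:R^-1 -> (N t <= (N s).+1)%N.
Proof.
have /compact_near_coveringP cK : compact (`[0, 1]%classic : set R).
  exact: segment_compact.
have near_point (x : R) : \forall s \near x & m \near \oo,
  forall t, s <= t -> t <= s + m.+1%:R^-1 -> (N t <= (N s).+1)%N.
  have [e1 /= e10 He1] := cp_right_continuous N x.
  have [e2 /= e20 He2] := cp_unit_jump N x.
  pose e := Num.min e1 e2; have e0 : 0 < e by rewrite lt_min e10 e20.
  have ee1 : e <= e1 by rewrite ge_min lexx.
  have ee2 : e <= e2 by rewrite ge_min lexx orbT.
  near=> s m => /= t st tm.
  have sx : `|x - s| < e / 2.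
    by near: s; exists (e / 2) => //=; rewrite divr_gt0.
  have m_small : m.+1%:R^-1 < e / 2.
    rewrite invf_plt ?posrE ?divr_gt0//.
    apply: (@le_lt_trans _ _ m%:R); last by rewrite ltr_nat.
    by near: m; exact: nbhs_infty_ger.
  move: tm m_small; set dt := _^-1 => tm m_small.
  have tx : t < x + e by move: sx; rewrite ltr_norml => /andP[? ?]; lra.
  have xs : x - e < s by move: sx; rewrite ltr_norml => /andP[? ?]; lra.
  have right u : x <= u -> u < x + e -> N u = N x.
    rewrite le_eqVlt => /predU1P[->//|xu] uxe; apply: He1 => //=.
    by rewrite /ball/= ltr_norml; lra.
  have left u : u < x -> x - e < u -> (N x <= (N u).+1)%N.
    move=> ux xeu; apply: He2 => //=.
    by rewrite /ball/= ltr_norml; lra.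
  (* Near [x] the path is constant to the right of [x] and at most one below [N x] to the left, so
     only an interval that starts before [x] can see a jump. *)
  have [xs'|sx'] := leP x s.
    by rewrite (right t) ?(le_trans xs')// -(right s)// (le_lt_trans st).
  apply: leq_trans (left s sx' xs).
  have [xt|tx'] := leP x t; first by rewrite right.
  exact/cp_nondecreasing/ltW.
have := cK nat \oo
  (fun m s => forall t, s <= t -> t <= s + m.+1%:R^-1 -> (N t <= (N s).+1)%N) _
  (fun x _ => near_point x).
move=> /(_ _); apply: filterS => m Hm s t s01; apply: Hm.
by rewrite /= in_itv.
Unshelve. all: by end_near. Qed.

Local Notation lsm := (lebesgue_stieltjes_measure (cp_real N)).

Lemma counting_path_measure_itv (a b : R) : a <= b ->
  lsm `]a, b]%classic = ((N b)%:R - (N a)%:R)%:E.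
Proof.
move=> ab; rewrite /lebesgue_stieltjes_measure /measure_extension/=.
by rewrite measurable_mu_extE/= ?wlength_itv_bnd//; exists (a, b).
Qed.

Lemma counting_path_measure01 : (lsm `]0%R, 1%R]%classic < +oo)%E.
Proof. by rewrite counting_path_measure_itv// ltry. Qed.

End counting_path_theory.

Section grid_integral.
Context (R : realType).
Variable mu : {measure set (measurableTypeR R) -> \bar R}.

Lemma Rintegral_grid (m : nat) (f : R -> R) : (0 < m)%N ->
  mu.-integrable `]0, 1] (EFin \o f) ->
  \int[mu]_(t in `]0, 1]) f t =
  \sum_(j < m) \int[mu]_(t in `](j%:R / m%:R), (j.+1%:R / m%:R)]) f t.
Proof.
move=> m0 fi; have m0' : 0 < m%:R :> R by rewrite ltr0n.
have mono j k : (j <= k)%N -> j%:R / m%:R <= k%:R / m%:R :> R.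
  by move=> jk; rewrite ler_pM2r ?invr_gt0// ler_nat.
suff H k : (k <= m)%N -> \int[mu]_(t in `]0, (k%:R / m%:R)]) f t =
    \sum_(j < k) \int[mu]_(t in `](j%:R / m%:R), (j.+1%:R / m%:R)]) f t.
  by rewrite -H// divff// gt_eqF.
elim: k => [_|k IH km].
  by rewrite big_ord0 mul0r set_itvoc0 Rintegral_set0.
rewrite big_ord_recr/= -IH; last exact: ltnW.
rewrite (@itv_bndbnd_setU _ _ _ (BRight (k%:R / m%:R))); last 2 first.
- by rewrite bnd_simp divr_ge0// ltW.
- by rewrite bnd_simp; exact: mono.
rewrite Rintegral_setU//.
- apply: integrableS fi => //; first exact: measurableU.
    move=> x /= []; rewrite !in_itv/= => /andP[x0 xk]; apply/andP; split => //.
    * by rewrite (le_trans xk)// ler_pdivrMr// mul1r ler_nat ltnW.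
    * by rewrite (le_lt_trans _ x0)// divr_ge0// ltW.
    * by rewrite (le_trans xk)// ler_pdivrMr// mul1r ler_nat.
- apply/disj_setPS => y [/=]; rewrite !in_itv/= => /andP[_ yk] /andP[].
    by rewrite ltNge yk.
Qed.

Lemma Rintegral_grid_const (m : nat) (f g : R -> R) (c : nat -> R) : (0 < m)%N ->
  mu.-integrable `]0, 1] (EFin \o (fun t => f t * g t)) ->
  mu.-integrable `]0, 1] (EFin \o g) ->
  (forall j t, j%:R / m%:R < t <= j.+1%:R / m%:R -> f t = c j) ->
  \int[mu]_(t in `]0, 1]) (f t * g t) =
  \sum_(j < m) c j * \int[mu]_(t in `](j%:R / m%:R), (j.+1%:R / m%:R)]) g t.
Proof.
move=> m0 fgi gi fc; have m0' : 0 < m%:R :> R by rewrite ltr0n.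
rewrite (Rintegral_grid m0 fgi); apply: eq_bigr => j _.
rewrite -RintegralZl//.
  by apply: eq_Rintegral => t /set_mem; rewrite /= in_itv/= => /fc ->.
apply: integrableS gi => //.
move=> x /=; rewrite !in_itv/= => /andP[x0 xk]; apply/andP; split.
  by rewrite (le_lt_trans _ x0)// divr_ge0// ltW.
by rewrite (le_trans xk)// ler_pdivrMr// mul1r ler_nat.
Qed.

End grid_integral.

Lemma counting_path_Rintegral_grid (R : realType) (N : counting_path R) (m : nat)
    (f : R -> R) (c : nat -> R) (K : R) : (0 < m)%N ->
  measurable_fun setT f -> (forall t, `|f t| <= K) ->
  (forall j t, j%:R / m%:R < t <= j.+1%:R / m%:R -> f t = c j) ->
  \int[lebesgue_stieltjes_measure (cp_real N)]_(t in `]0, 1]) f t =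
  \sum_(j < m) c j * ((N (j.+1%:R / m%:R))%:R - (N (j%:R / m%:R))%:R).
Proof.
move=> m0 mf fK fc; have m0' : 0 < m%:R :> R by rewrite ltr0n.
have N1 := counting_path_measure01 N.
have -> : \int[lebesgue_stieltjes_measure (cp_real N)]_(t in `]0, 1]) f t =
  \int[lebesgue_stieltjes_measure (cp_real N)]_(t in `]0, 1]) (f t * 1).
  by apply: eq_Rintegral => t _; rewrite mulr1.
have -> : \int[lebesgue_stieltjes_measure (cp_real N)]_(t in `]0, 1]) (f t * 1) =
  \sum_(j < m) c j * \int[lebesgue_stieltjes_measure (cp_real N)]_(t in
    `](j%:R / m%:R), (j.+1%:R / m%:R)]) 1.
  apply: (@Rintegral_grid_const R _ m f (fun=> 1) c m0) => //.
  - apply: (@bounded_integrable _ _ _ _ _ K) => //.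
    + by apply: measurable_funTS; apply: measurable_funM.
    + by move=> x _; rewrite mulr1.
  - by apply: (@bounded_integrable _ _ _ _ _ 1) => // x _; rewrite normr1.
apply: eq_bigr => j _; rewrite Rintegral_cst// mul1r.
rewrite [X in fine X](_ : _ = ((N (j.+1%:R / m%:R))%:R - (N (j%:R / m%:R))%:R)%:E)//.
by apply: counting_path_measure_itv; rewrite ler_pM2r ?invr_gt0// ler_nat.
Qed.

(** * Exponential moments of the compensated counting process *)

(** From exp(-x) >= 1 - x one gets exp x <= 1 / (1 - x), and (1 - x)(1 + x + 2 x^2) = 1 + x^2 (1 - 2
    x) >= 1. Large negative values of x are covered as well. *)
Lemma expR_le1DxD2x2 (R : realType) (x : R) : x <= 2^-1 -> expR x <= 1 + x + 2 * x ^+ 2.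
Proof.
move=> x2; have x1 : 0 < 1 - x by lra.
have := expR_ge1Dx (- x); rewrite expRN => h.
have e0 := expR_gt0 x.
have h1 : (1 - x) * expR x <= 1.
  by rewrite -[leRHS](mulVf (lt0r_neq0 e0)) ler_pM2r.
rewrite -(ler_pM2l x1) (le_trans h1)//.
have x20 : 0 <= x ^+ 2 * (1 - 2 * x) by rewrite mulr_ge0 ?sqr_ge0//; lra.
suff -> : (1 - x) * (1 + x + 2 * x ^+ 2) = 1 + x ^+ 2 * (1 - 2 * x) by rewrite lerDl.
ring.
Qed.

(* One increment of the exponential process: [i] is the truncated jump count and
   [D] the increment of the compensator. *)
Lemma jump_exp_step (R : realType) (v D E : R) (i : bool) :
  -1 <= v -> `|v| <= E -> 0 <= D -> E * D <= 2^-1 ->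
  (1 + v * i%:R) * expR (- (v * D)) <=
  1 + v * (i%:R - D) + 2 * (1 + E) * (E * D) ^+ 2.
Proof.
move=> v1 vE D0 ED.
have vED : `|v * D| <= E * D by rewrite normrM (ger0_norm D0) ler_wpM2r.
have [vD1 vD2] : - (E * D) <= v * D /\ v * D <= E * D by apply/andP; rewrite -ler_norml.
have [vE1 vE2] : - E <= v /\ v <= E by apply/andP; rewrite -ler_norml.
have E0 : 0 <= E by exact: le_trans (normr_ge0 v) vE.
have ex : expR (- (v * D)) <= 1 - v * D + 2 * (v * D) ^+ 2.
  by rewrite (le_trans (expR_le1DxD2x2 _))// ?sqrrN//; lra.
have sq : (v * D) ^+ 2 <= (E * D) ^+ 2.
  by rewrite -(real_normK (num_real (v * D))) lerXn2r// nnegrE ?mulr_ge0.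
have sq0 : 0 <= (v * D) ^+ 2 by exact: sqr_ge0.
have v0 : 0 <= 1 + v * i%:R by case: i => /=; lra.
apply: (le_trans (ler_wpM2l v0 ex)).
have vvD : 0 <= v * v * D by rewrite mulr_ge0// -expr2 sqr_ge0.
have : (1 + E) * (v * D) ^+ 2 <= (1 + E) * (E * D) ^+ 2 by rewrite ler_wpM2l//; lra.
have : (1 + v) * (v * D) ^+ 2 <= (1 + E) * (v * D) ^+ 2 by rewrite ler_wpM2r//; lra.
have : 0 <= E * (v * D) ^+ 2 by rewrite mulr_ge0.
move: vvD sq0; case: i {v0} => /=; rewrite ?(mulr0, mulr1, addr0); nra.
Qed.

(** * Weights measurable for a sub-sigma-algebra *)

Section sub_sigma_algebra.
Context (R : realType) d (Omega : measurableType d) (P : {measure set Omega -> \bar R}).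
Variable G : set (set Omega).
Hypotheses (sG : sigma_algebra setT G) (GM : G `<=` measurable).

(** Turns adaptedness into ordinary measurability on another measurable type, so that the closure
    properties of measurable functions apply to adapted ones. *)
Lemma sub_measurableP d' (T : measurableType d') (f : Omega -> T) :
  sub_measurable G f <-> measurable_fun setT (f : g_sigma_algebraType G -> T).
Proof.
split => [Gf _ B mB|mf B mB].
  by rewrite setTI (measurable_g_measurableTypeE sG); exact: Gf.
by rewrite -(measurable_g_measurableTypeE sG) -[_ @^-1` _]setTI; exact: mf.
Qed.

Lemma sub_measurable_measurable d' (T : measurableType d') (f : Omega -> T) :
  sub_measurable G f -> measurable_fun setT f.
Proof. by move=> Gf _ B mB; rewrite setTI; exact/GM/Gf. Qed.

(** The assumption on [D] says that its conditional expectation given [G] is 0. It extends from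
    indicators to simple functions, then to [W + C] >= 0 by dominated convergence with bound 2 C
    |D|; the constant [C] drops out because the whole space is in [G]. *)
Lemma sub_measurable_weight (D : Omega -> R) (W : Omega -> R) (C : R) :
  P.-integrable setT (EFin \o D) ->
  (forall A, G A -> (\int[P]_(w in A) (D w)%:E = 0)%E) ->
  sub_measurable G W -> (forall w, `|W w| <= C) ->
  \int[P]_w (W w * D w) = 0.
Proof.
move=> iD D0 GW WC.
have WC0 (w : g_sigma_algebraType G) : 0 <= W w + C.
  by have := WC w; rewrite ler_norml => /andP[? ?]; lra.
have mWC : measurable_fun setT (fun w : g_sigma_algebraType G => W w + C).
  by apply: measurable_funD => //; apply/sub_measurableP.
have [k [c [A [c0 mA ndA cvgA]]]] := step_sum_approx mWC WC0.
have GA n i : G (A n i) by rewrite -(measurable_g_measurableTypeE sG).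
have mD : measurable_fun setT D by exact/measurable_EFinP/(measurable_int P).
pose s n (w : Omega) := step_sum (k n) (c n) (A n) (w : g_sigma_algebraType G).
have s0 n w : 0 <= s n w by apply: sumr_ge0 => i _; rewrite mulr_ge0// indicE.
have sWC n w : s n w <= W w + C.
  rewrite -(cvg_lim _ (cvgA w))//; apply: nondecreasing_cvgn_le; first exact: ndA.
  by apply/cvg_ex; eexists; exact: cvgA.
have ms n : measurable_fun setT (s n).
  apply: measurable_sum => i; apply: measurable_funM => //.
  exact/measurable_indic/GM.
have mW : measurable_fun setT W := sub_measurable_measurable GW.
have int_bd (f : Omega -> R) (L : R) : measurable_fun setT f -> (forall w, `|f w| <= L) ->
   P.-integrable setT (EFin \o (fun w => f w * D w)).
  move=> mf fL; apply: (@le_integrable _ _ _ P setT measurableT _ (fun w => L%:E * (D w)%:E)%E).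
  - by apply/measurable_EFinP; exact: measurable_funM.
  - move=> w _; rewrite -EFinM /= lee_fin !normrM ler_wpM2r//.
    exact: le_trans (fL w) (ler_norm _).
  - exact: integrableZl.
have sD n : \int[P]_w (s n w * D w) = 0.
  have -> : (fun w => s n w * D w) =
     (fun w => \sum_(i < k n) c n i * (\1_(A n i) w * D w)).
    by apply/funext => w; rewrite /s /step_sum big_distrl/=; apply: eq_bigr => i _; rewrite mulrA.
  rewrite /Rintegral; under eq_integral do rewrite -sumEFin.
  have iAD i : P.-integrable setT (EFin \o (fun w => \1_(A n i) w * D w)).
    apply: (@int_bd _ 1); first exact/measurable_indic/GM.
    by move=> w; rewrite indicE ger0_norm// lern1 leq_b1.
  rewrite (@integral_sum _ _ _ P setT measurableT _ (fun (i : 'I_(k n)) w => (c n i * (\1_(A n i) w * D w))%:E)).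
    rewrite big1// => i _; under eq_integral do rewrite EFinM.
    rewrite (integralZl measurableT (iAD i)) -(D0 (A n i))//.
    rewrite [X in (_ * X)%E = _](_ : _ = 0)%E ?mule0 ?D0//.
    rewrite -(D0 (A n i) (GA n i)) [RHS]integral_mkcond; apply: eq_integral => w _.
    by rewrite patchE /= indicE; case: ifPn; rewrite ?mul1r ?mul0r.
  by move=> i; under eq_fun do rewrite EFinM; exact: (integrableZl measurableT _ (iAD i)).
have DCT := @dominated_convergence _ _ _ P setT measurableT
   (fun n w => (s n w * D w)%:E) (fun w => ((W w + C) * D w)%:E)
   (fun w => (C + C)%:E * `|D w|%:E)%E.
have {DCT} [] := DCT.
- by move=> n; apply/measurable_EFinP; exact: measurable_funM.
- by apply/measurable_EFinP; apply: measurable_funM => //; exact: measurable_funD.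
- apply: aeW => w _; apply: cvg_EFin; first exact: nearW.
  by apply: cvgMl; exact: cvgA.
- apply: integrableZl => //; exact: (integrable_norm iD).
- apply: aeW => w n _; rewrite -EFinM /= lee_fin normrM ler_wpM2r//.
  rewrite ger0_norm// (le_trans (sWC n w))// lerD2r.
  by have := WC w; rewrite ler_norml => /andP[].
move=> iWCD _ cvgE.
have cvgD : \int[P]_w (s n w * D w) @[n --> \oo] --> \int[P]_w ((W w + C) * D w).
  by apply/fine_cvg; rewrite fineK//; exact: integrable_fin_num.
have : \int[P]_w ((W w + C) * D w) = 0.
  rewrite -(cvg_lim _ cvgD)//.
  by under eq_fun do rewrite sD; exact: lim_cst.
under eq_Rintegral do rewrite mulrDl.
rewrite RintegralD//; last 2 first.
- exact: (int_bd _ C).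
- exact: (int_bd _ `|C|).
rewrite RintegralZl// /Rintegral (D0 setT) ?mulr0 ?addr0//.
by case: sG => G0 GC _; rewrite -(setD0 setT); exact: GC.
Qed.

End sub_sigma_algebra.

Lemma probability_setT_lty (R : realType) d (T : measurableType d) (P : probability T R) :
  (P setT < +oo)%E.
Proof. by rewrite probability_setT ltry. Qed.

(** * Counting processes with bounded intensity *)

Section exponential_bound.
Context (R : realType) dS (S : measurableType dS) disp (Omega : measurableType disp)
  (P : probability Omega R) (F : R -> set (set Omega)).
Variables (X : Omega -> S) (N : Omega -> counting_path R) (Y : R -> Omega -> R)
  (beta : R * S -> R) (B : R).

Definition cumulated_intensity (t : R) (w : Omega) : R :=
  \int[lebesgue_measure]_(u in `[0, t]) (beta (u, X w) * Y u w).

Local Notation Lam := cumulated_intensity.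

(** What the exponential bound uses of the model. Bounds and joint measurability hold at every
    point, so neither the cube nor exceptional sets occur until the model is reduced to this
    form. *)
Record bounded_intensity : Prop := {
  bi_filtration : filtration F ;
  bi_covariates : sub_measurable (F 0) X ;
  bi_adapted : forall t : R, 0 <= t -> sub_measurable (F t) (fun w => (N w t)%:R : R) ;
  bi_exposure_measurable : measurable_fun setT (fun z : R * Omega => Y z.1 z.2) ;
  bi_exposure_itv : forall t w, 0 <= Y t w <= 1 ;
  bi_measurable : measurable_fun setT beta ;
  bi_itv : forall z, 0 <= beta z <= B ;
  bi_compensator_adapted : forall t : R, 0 <= t <= 1 -> sub_measurable (F t) (Lam t) ;
  bi_integrable : P.-integrable setT (fun w => (N w 1)%:R%:E) ;
  bi_martingale : forall (s t : R) A, 0 <= s -> s <= t -> t <= 1 -> F s A ->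
    (\int[P]_(w in A) ((N w t)%:R - Lam t w)%:E =
     \int[P]_(w in A) ((N w s)%:R - Lam s w)%:E)%E
}.

Hypothesis bi : bounded_intensity.

Lemma exposure_section_measurable (phi : R * S -> R) w :
  measurable_fun setT phi -> measurable_fun setT (fun u => phi (u, X w) * Y u w).
Proof.
move=> mphi; apply: measurable_funM.
  exact: measurableT_comp mphi (@pair2_measurable _ _ _ _ _).
exact: measurableT_comp (bi_exposure_measurable bi) (@pair2_measurable _ _ _ _ _).
Qed.

Lemma exposure_normM K (phi : R * S -> R) z u w : (forall z, `|phi z| <= K) ->
  `|phi z * Y u w| <= K.
Proof.
move=> phiK; have /andP[Y0 Y1] := bi_exposure_itv bi u w.
by rewrite normrM (ger0_norm Y0) -[K]mulr1 ler_pM.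
Qed.

Lemma lebesgue_itv_lty (a b : bool) (s t : R) :
  (lebesgue_measure [set` Interval (BSide a s) (BSide b t)] < +oo)%E.
Proof. by rewrite lebesgue_measure_itv; case: ifP => _; rewrite ?ltry. Qed.

Lemma exposure_integrable K (phi : R * S -> R) (a b : bool) (s t : R) w :
  measurable_fun setT phi -> (forall z, `|phi z| <= K) ->
  lebesgue_measure.-integrable [set` Interval (BSide a s) (BSide b t)]
    (EFin \o (fun u => phi (u, X w) * Y u w)).
Proof.
move=> mphi phiK; apply: (@bounded_integrable _ _ _ _ _ K) => //.
- exact: lebesgue_itv_lty.
- by apply: measurable_funTS; exact: exposure_section_measurable.
- by move=> u _; exact: exposure_normM.
Qed.

Let beta_norm z : `|beta z| <= B.
Proof. by have /andP[b0 bB] := bi_itv bi z; rewrite ger0_norm. Qed.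

Let mbeta := bi_measurable bi.

Lemma cumulated_intensityB (s t : R) w : 0 <= s -> s <= t ->
  Lam t w - Lam s w =
  \int[lebesgue_measure]_(u in `]s, t]) (beta (u, X w) * Y u w).
Proof.
move=> s0 st; apply: Rintegral_itvB; rewrite ?bnd_simp//.
exact: (exposure_integrable _ _ _ _ _ mbeta beta_norm).
Qed.

Lemma cumulated_intensityB_itv (s t : R) w : 0 <= s -> s <= t ->
  0 <= Lam t w - Lam s w <= B * (t - s).
Proof.
move=> s0 st; rewrite cumulated_intensityB//; apply/andP; split.
  apply: Rintegral_ge0 => u _; apply: mulr_ge0.
    by have /andP[] := bi_itv bi (u, X w).
  by have /andP[] := bi_exposure_itv bi u w.
have -> : B * (t - s) = \int[lebesgue_measure]_(u in `]s, t]) B.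
  rewrite Rintegral_cst//= lebesgue_measure_itv/= lte_fin.
  by move: st; rewrite le_eqVlt => /predU1P[->|->]//; rewrite ltxx subrr mulr0.
apply: le_Rintegral => //.
- exact: (exposure_integrable _ _ _ _ _ mbeta beta_norm).
- apply: (@bounded_integrable _ _ _ _ _ `|B|) => //; exact: lebesgue_itv_lty.
- move=> u _; apply: le_trans (ler_norm _) _; exact: exposure_normM.
Qed.

Let FM (t : R) : 0 <= t -> F t `<=` measurable.
Proof. by have [_ + _] := bi_filtration bi; exact. Qed.

Let Fsigma (t : R) : 0 <= t -> sigma_algebra setT (F t).
Proof. by have [+ _ _] := bi_filtration bi; exact. Qed.

Lemma adapted_le d' (T : measurableType d') (f : Omega -> T) (s t : R) :
  0 <= s -> s <= t -> sub_measurable (F s) f -> sub_measurable (F t) f.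
Proof.
move=> s0 st sf C mC; have [_ _ FF] := bi_filtration bi.
exact/(FF s t s0 st)/sf.
Qed.

Lemma count_measurable (t : R) : 0 <= t -> measurable_fun setT (fun w => (N w t)%:R : R).
Proof. by move=> t0; apply: (sub_measurable_measurable (FM t0)); exact: (bi_adapted bi t0). Qed.

Lemma count_integrable (t : R) : 0 <= t <= 1 -> P.-integrable setT (fun w => (N w t)%:R%:E).
Proof.
move=> /andP[t0 t1]; apply: (le_integrable measurableT _ _ (bi_integrable bi)).
  exact/measurable_EFinP/count_measurable.
move=> w _; rewrite !gee0_abs ?lee_fin//.
by rewrite ler_nat; exact: cp_nondecreasing.
Qed.

Lemma cumulated_intensity_integrable (t : R) : 0 <= t <= 1 ->
  P.-integrable setT (EFin \o Lam t).
Proof.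
move=> /andP[t0 t1]; apply: (@bounded_integrable _ _ _ _ _ B) => //.
- exact: probability_setT_lty.
- apply: (sub_measurable_measurable (FM t0)); apply: (bi_compensator_adapted bi).
  by rewrite t0.
- move=> w _; have := cumulated_intensityB_itv w (lexx 0) t0.
  rewrite [Lam 0 w](_ : _ = 0) ?subr0; last first.
    by rewrite /cumulated_intensity set_itv1 Rintegral_set1.
  move=> /andP[L0 LB]; rewrite ger0_norm// (le_trans LB)//.
  have B0 : 0 <= B by have /andP[b0 bB] := bi_itv bi (0, X w); exact: le_trans bB.
  by rewrite -[leRHS]mulr1 ler_wpM2l.
Qed.

(** The martingale property between s and t gives the increment mean 0 on every event of [F s], and
    [sub_measurable_weight] lets the weight in. *)
Lemma weighted_increment (s t : R) (W : Omega -> R) (C : R) :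
  0 <= s -> s <= t -> t <= 1 -> sub_measurable (F s) W -> (forall w, `|W w| <= C) ->
  P.-integrable setT (EFin \o (fun w => W w *
    ((N w t)%:R - (N w s)%:R - (Lam t w - Lam s w)))) /\
  \int[P]_w (W w * ((N w t)%:R - (N w s)%:R - (Lam t w - Lam s w))) = 0.
Proof.
move=> s0 st t1 GW WC; have t0 := le_trans s0 st.
have s01 : 0 <= s <= 1 by rewrite s0 (le_trans st).
have t01 : 0 <= t <= 1 by rewrite t0.
have iM (u : R) : 0 <= u <= 1 -> P.-integrable setT (EFin \o (fun w => (N w u)%:R - Lam u w)).
  move=> u01; rewrite (_ : _ \o _ = (fun w => (N w u)%:R%:E - (Lam u w)%:E)%E)//.
  by apply: integrableB => //; [exact: count_integrable|exact: cumulated_intensity_integrable].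
have DE : (fun w => ((N w t)%:R - (N w s)%:R - (Lam t w - Lam s w))) =
  (fun w => ((N w t)%:R - Lam t w) - ((N w s)%:R - Lam s w)).
  by apply/funext => w; ring.
have iD : P.-integrable setT (EFin \o (fun w =>
    ((N w t)%:R - (N w s)%:R - (Lam t w - Lam s w)))).
  rewrite DE (_ : _ \o _ = ((EFin \o (fun w => (N w t)%:R - Lam t w)%R) \-
    (EFin \o (fun w => (N w s)%:R - Lam s w)%R))%E)//.
  by apply: integrableB => //; exact: iM.
split.
  apply: (@le_integrable _ _ _ P setT measurableT _ (fun w =>
     C%:E * ((N w t)%:R - (N w s)%:R - (Lam t w - Lam s w))%:E)%E).
  - apply/measurable_EFinP; apply: measurable_funM.
      exact: (sub_measurable_measurable (FM s0)).
    exact/measurable_EFinP/(measurable_int P).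
  - move=> w _; rewrite -EFinM /= lee_fin !normrM ler_wpM2r//.
    exact: le_trans (WC w) (ler_norm _).
  - exact: integrableZl.
apply: (sub_measurable_weight (Fsigma s0) (FM s0) iD _ GW WC) => A FA.
have -> : (\int[P]_(w in A) ((N w t)%:R - (N w s)%:R - (Lam t w - Lam s w))%:E =
  \int[P]_(w in A) (((N w t)%:R - Lam t w)%R%:E - ((N w s)%:R - Lam s w)%R%:E))%E.
  by apply: eq_integral => w _; rewrite -EFinB; congr (_%:E); ring.
have mA : measurable A by exact: (FM s0).
rewrite integralB//; last 2 first.
- by apply: integrableS (iM t t01).
- by apply: integrableS (iM s s01).
rewrite (bi_martingale bi s0 st t1 FA) subee//.
by apply: integrable_fin_num => //; apply: integrableS (iM s s01).
Qed.

End exponential_bound.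

(** * The exponential process on a grid *)

Section discretization.
Context (R : realType) dS (S : measurableType dS) disp (Omega : measurableType disp)
  (P : probability Omega R) (F : R -> set (set Omega)).
Variables (X : Omega -> S) (N : Omega -> counting_path R) (Y : R -> Omega -> R)
  (beta : R * S -> R) (B : R).
Hypothesis bi : bounded_intensity P F X N Y beta B.
Variables (m k : nat) (K : R) (c : nat -> S -> R).
Hypotheses (m0 : (0 < m)%N) (K0 : 0 <= K) (B0 : 0 <= B)
  (mc : forall j, measurable_fun setT (c j)) (cK : forall j x, `|c j x| <= K).

Local Notation Lam := (cumulated_intensity X Y beta).
Local Notation E := (expR K).

Definition tick (j : nat) : R := j%:R / m%:R.
Definition jump (j : nat) (w : Omega) : bool := (N w (tick j) < N w (tick j.+1))%N.
(** Subtraction of naturals: this is 0 for a tick without jump as well as for a tick with exactly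
    one. *)
Definition excess (j : nat) (w : Omega) : nat :=
  (N w (tick j.+1) - N w (tick j) - 1)%N.
(* The exponential process is frozen once [k] jumps have occurred, which keeps it bounded. *)
Definition rate (j : nat) (w : Omega) : R :=
  if (N w (tick j) < k)%N then expR (c j (X w)) - 1 else 0.
Definition dLam (j : nat) (w : Omega) : R := Lam (tick j.+1) w - Lam (tick j) w.

(* Grid analogue of the stochastic exponential of [rate . (N - Lam)]: several jumps
   within one tick count as one, and the loss is controlled by [excess]. *)
Fixpoint expo (j : nat) (w : Omega) : R :=
  if j is i.+1 then
    expo i w * ((1 + rate i w * (jump i w)%:R) * expR (- (rate i w * dLam i w)))
  else 1.

Let mR : 0 < m%:R :> R. Proof. by rewrite ltr0n. Qed.

Lemma tick_ge0 j : 0 <= tick j. Proof. by rewrite divr_ge0// ltW. Qed.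

Lemma tick_le1 j : (j <= m)%N -> tick j <= 1.
Proof. by move=> jm; rewrite ler_pdivrMr// mul1r ler_nat. Qed.

Lemma tickS j : tick j.+1 = tick j + m%:R^-1.
Proof. by rewrite /tick -natr1 mulrDl mul1r. Qed.

Lemma tick_leS j : tick j <= tick j.+1.
Proof. by rewrite tickS lerDl invr_ge0 ltW. Qed.

Lemma E_ge1 : 1 <= E. Proof. by rewrite -expR0 ler_expR. Qed.

Let E1 := E_ge1.

Lemma dLam_ge0 j w : 0 <= dLam j w.
Proof. by have /andP[] := cumulated_intensityB_itv bi w (tick_ge0 j) (tick_leS j). Qed.

Lemma dLam_le j w : dLam j w <= B / m%:R.
Proof.
have /andP[_] := cumulated_intensityB_itv bi w (tick_ge0 j) (tick_leS j).
rewrite [X in B * X](_ : _ = m%:R^-1) //.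
by rewrite tickS addrAC subrr add0r.
Qed.

Lemma rate_geN1 j w : -1 <= rate j w.
Proof. by rewrite /rate; case: ifP => _; [have := expR_ge0 (c j (X w))|]; lra. Qed.

Lemma rate_norm j w : `|rate j w| <= E.
Proof.
rewrite ler_norml; apply/andP; split.
  by apply: le_trans (rate_geN1 j w); rewrite lerN2.
rewrite /rate; case: ifP => _; last exact: expR_ge0.
rewrite lerBlDr (@le_trans _ _ E)// ?lerDl// ler_expR.
exact: le_trans (ler_norm _) (cK _ _).
Qed.

Lemma jump_factor_ge0 j w : 0 <= 1 + rate j w * (jump j w)%:R.
Proof. by have := rate_geN1 j w; case: (jump j w); rewrite ?mulr1 ?mulr0; lra. Qed.

Lemma expo_ge0 j w : 0 <= expo j w.
Proof.
elim: j => [|j IH] /=; first exact: ler01.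
by rewrite mulr_ge0// mulr_ge0 ?jump_factor_ge0// expR_ge0.
Qed.

Let FM (t : R) : 0 <= t -> F t `<=` measurable.
Proof. by have [_ + _] := bi_filtration bi; exact. Qed.

Let Fsigma (t : R) : 0 <= t -> sigma_algebra setT (F t).
Proof. by have [+ _ _] := bi_filtration bi; exact. Qed.

Let lt_measurable d' (T : measurableType d') (f g : T -> R) :
  measurable_fun setT f -> measurable_fun setT g ->
  measurable_fun setT (fun w => (f w < g w)).
Proof. by move=> mf mg; exact: measurable_fun_ltr. Qed.

Lemma rate_adapted j : sub_measurable (F (tick j)) (rate j).
Proof.
have t0 := tick_ge0 j; apply/(sub_measurableP (Fsigma t0)).
have -> : rate j = (fun w => if (N w (tick j))%:R < k%:R :> R then
   expR (c j (X w)) - 1 else 0).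
  by apply/funext => w; rewrite /rate ltr_nat.
apply: measurable_fun_ifT => //.
- apply: lt_measurable => //; apply/(sub_measurableP (Fsigma t0)).
  exact: (bi_adapted bi).
- apply: measurable_funB => //; apply: measurableT_comp => //.
  apply: measurableT_comp => //; apply/(sub_measurableP (Fsigma t0)).
  exact: (adapted_le bi (lexx 0) t0 (bi_covariates bi)).
Qed.

Lemma expo_adapted j : (j <= m)%N -> sub_measurable (F (tick j)) (expo j).
Proof.
elim: j => [_|j IH jm].
  apply/(sub_measurableP (Fsigma (tick_ge0 0))); exact: measurable_cst.
have t0 := tick_ge0 j; have t1 := tick_ge0 j.+1; have tS := tick_leS j.
apply/(sub_measurableP (Fsigma t1)) => /=.
have mle d' (T : measurableType d') (f : Omega -> T) : sub_measurable (F (tick j)) f ->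
  measurable_fun setT (f : g_sigma_algebraType (F (tick j.+1)) -> T).
  move=> mf; apply/(sub_measurableP (Fsigma t1)); exact: (adapted_le bi t0 tS).
have mrate := mle _ _ _ (rate_adapted j).
have mN0 := mle _ _ _ (bi_adapted bi t0).
have /(sub_measurableP (Fsigma t1)) mN1 := bi_adapted bi t1.
have mL0 : measurable_fun setT (Lam (tick j) : g_sigma_algebraType (F (tick j.+1)) -> R).
  by apply: mle; apply: (bi_compensator_adapted bi); rewrite t0 tick_le1// ltnW.
have mL1 : measurable_fun setT (Lam (tick j.+1) : g_sigma_algebraType (F (tick j.+1)) -> R).
  apply/(sub_measurableP (Fsigma t1)); apply: (bi_compensator_adapted bi).
  by rewrite t1 tick_le1.
apply: measurable_funM; first by apply: mle; exact/IH/ltnW.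
apply: measurable_funM.
  apply: measurable_funD => //; apply: measurable_funM => //.
  have -> : (fun w => (jump j w)%:R : R) = (fun w =>
     if (N w (tick j))%:R < (N w (tick j.+1))%:R :> R then 1 else 0).
    by apply/funext => w; rewrite ltr_nat /jump; case: ltnP.
  by apply: measurable_fun_ifT => //; exact: lt_measurable.
apply: measurableT_comp => //; apply: measurableT_comp => //.
by apply: measurable_funM => //; exact: measurable_funB.
Qed.

Lemma expo_measurable j : (j <= m)%N -> measurable_fun setT (expo j).
Proof. by move=> jm; apply: (sub_measurable_measurable (FM (tick_ge0 j))); exact: expo_adapted. Qed.

(** A tick contributes a factor exp K only if it holds a jump and the process is not yet frozen,
    which happens at most [minn k (N w (tick j))] times; the compensator costs at most exp(E * B /
    m) per tick. *)
Lemma expo_le_expR j w :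
  expo j w <= expR (K * (minn k (N w (tick j)))%:R) * expR (E * B * tick j).
Proof.
elim: j => [|j IH] /=.
  by rewrite -[leLHS](mulr1 1) ler_pM// -expR0 ler_expR mulr_ge0 ?tick_ge0// ?mulr_ge0 ?expR_ge0.
pose g := (N w (tick j) < k)%N && jump j w.
have h1 : 1 + rate j w * (jump j w)%:R <= expR (K * g%:R).
  rewrite /g /rate; case: ltnP => _ /=; last by rewrite mul0r mulr0 expR0 addr0.
  case: (jump j w); rewrite ?mulr0 ?mulr1 ?expR0 ?addr0//.
  by rewrite addrCA subrr addr0 ler_expR; exact: le_trans (ler_norm _) (cK _ _).
have h2 : expR (- (rate j w * dLam j w)) <= expR (E * B * (m%:R)^-1).
  rewrite ler_expR -mulNr (le_trans (ler_wpM2r (dLam_ge0 j w) (_ : _ <= E)))//.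
    by have := rate_norm j w; rewrite ler_norml => /andP[? ?]; lra.
  by rewrite -mulrA ler_wpM2l ?expR_ge0// dLam_le.
have h3 : (minn k (N w (tick j)) + g <= minn k (N w (tick j.+1)))%N.
  have := @cp_nondecreasing _ (N w) _ _ (tick_leS j).
  by rewrite /g /jump; lia.
apply: (@le_trans _ _ (expR (K * (minn k (N w (tick j)))%:R) * expR (E * B * tick j) *
    (expR (K * g%:R) * expR (E * B / m%:R)))).
  apply: ler_pM => //; first exact: expo_ge0.
    by rewrite mulr_ge0 ?jump_factor_ge0 ?expR_ge0.
  by apply: ler_pM => //; exact: jump_factor_ge0.
rewrite -!expRD ler_expR.
have tS : E * B * tick j.+1 = E * B * tick j + E * B / m%:R by rewrite tickS mulrDr.
have : K * (minn k (N w (tick j)))%:R + K * g%:R <= K * (minn k (N w (tick j.+1)))%:R.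
  by rewrite -mulrDr ler_wpM2l// -natrD ler_nat.
lra.
Qed.

Definition expo_bound : R := expR (K * k%:R) * expR (E * B).

Lemma expo_le j w : (j <= m)%N -> expo j w <= expo_bound.
Proof.
move=> jm; apply: (le_trans (expo_le_expR j w)); apply: ler_pM; rewrite ?expR_ge0//.
  by rewrite ler_expR ler_wpM2l// ler_nat geq_minl.
by rewrite ler_expR -[leRHS]mulr1 ler_wpM2l ?tick_le1// mulr_ge0// expR_ge0.
Qed.

Lemma expo_integrable j : (j <= m)%N -> P.-integrable setT (EFin \o expo j).
Proof.
move=> jm; apply: (@bounded_integrable _ _ _ _ _ expo_bound) => //.
- exact: probability_setT_lty.
- exact: expo_measurable.
- by move=> w _; rewrite ger0_norm ?expo_ge0// expo_le.
Qed.

Lemma increment_jump_excess j w :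
  (N w (tick j.+1))%:R - (N w (tick j))%:R = (jump j w)%:R + (excess j w)%:R :> R.
Proof.
have := @cp_nondecreasing _ (N w) _ _ (tick_leS j) => h.
rewrite -natrB// -natrD; congr (_%:R).
by move: h; rewrite /jump /excess; clear; lia.
Qed.

Lemma excess_measurable j : measurable_fun setT (fun w => (excess j w)%:R : R).
Proof.
have -> : (fun w => (excess j w)%:R : R) =
   (fun w => Num.max 0 ((N w (tick j.+1))%:R - (N w (tick j))%:R - 1)).
  apply/funext => w; rewrite increment_jump_excess.
  have := @cp_nondecreasing _ (N w) _ _ (tick_leS j).
  rewrite /jump /excess; case: ltnP => h _ /=.
    by rewrite addrAC subrr add0r; apply/esym/max_idPr.
  rewrite (_ : (_ - _ - 1)%N = 0%N) ?mulr0n; last by move: h; clear; lia.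
  by rewrite add0r sub0r; apply/esym/max_idPl; rewrite oppr_le0.
apply: measurable_maxr => //; apply: measurable_funB => //.
by apply: measurable_funB; apply: (count_measurable bi); exact: tick_ge0.
Qed.

Lemma excess_integrable j : (j < m)%N -> P.-integrable setT (fun w => (excess j w)%:R%:E).
Proof.
move=> jm; apply: (le_integrable measurableT _ _ (bi_integrable bi)).
  by apply/measurable_EFinP; exact: excess_measurable.
move=> w _; rewrite !gee0_abs ?lee_fin// ler_nat.
apply: leq_trans (cp_nondecreasing (N w) (tick_le1 jm)).
by rewrite /excess -subnDA leq_subr.
Qed.

(** Second-order remainder of [jump_exp_step]. It is of order 1/m^2, so m ticks together cost only
    order 1/m. *)
Definition step_error : R := 2 * (1 + E) * (E * (B / m%:R)) ^+ 2.

(** [jump_exp_step] involves the truncated jump minus the compensator. Putting the full increment in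
    place of the jump makes a martingale increment appear and leaves the excess, with a coefficient
    of size at most [expo_bound * E]. *)
Lemma expo_step j w : (j < m)%N -> E * (B / m%:R) <= 2^-1 ->
  expo j.+1 w <= (1 + step_error) * expo j w +
    (expo j w * rate j w) * ((N w (tick j.+1))%:R - (N w (tick j))%:R - dLam j w) +
    (expo_bound * E) * (excess j w)%:R.
Proof.
move=> jm EB.
have D0 := dLam_ge0 j w; have DB := dLam_le j w.
have E0 : 0 <= E by exact: expR_ge0.
have ED : E * dLam j w <= E * (B / m%:R) by rewrite ler_wpM2l.
have EDh : E * dLam j w <= 2^-1 by exact: le_trans EB.
have step := jump_exp_step (jump j w) (rate_geN1 j w) (rate_norm j w) D0 EDh.
have sq : 2 * (1 + E) * (E * dLam j w) ^+ 2 <= step_error.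
  by rewrite /step_error ler_wpM2l ?mulr_ge0 ?addr_ge0// lerXn2r// nnegrE mulr_ge0// divr_ge0// ltW.
have Z0 := expo_ge0 j w.
have := ler_wpM2l Z0 (le_trans step (lerD (lexx _) sq)).
rewrite [expo j.+1 w]/= increment_jump_excess => h; apply: (le_trans h).
have ex0 : 0 <= (excess j w)%:R :> R by [].
have : - (expo j w * rate j w) * (excess j w)%:R <= (expo_bound * E) * (excess j w)%:R.
  apply: ler_wpM2r => //; apply: (le_trans (ler_norm _)).
  rewrite normrN normrM (ger0_norm Z0) ler_pM ?rate_norm//.
  exact/expo_le/ltnW.
set Z := expo j w; set v := rate j w; set x := (excess j w)%:R; set D := dLam j w.
set i := (jump j w)%:R; set se := step_error; set CE := expo_bound * E.
move=> hx.
have -> : Z * (1 + v * (i - D) + se) =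
   (1 + se) * Z + (Z * v) * (i + x - D) + (- (Z * v) * x) by ring.
by rewrite lerD2l.
Qed.

(** The weight [expo j * rate j] of the martingale increment is bounded and known at time [tick j],
    so that term has mean 0. *)
Lemma expo_mean_step j : (j < m)%N -> E * (B / m%:R) <= 2^-1 ->
  \int[P]_w expo j.+1 w <= (1 + step_error) * (\int[P]_w expo j w) +
     (expo_bound * E) * \int[P]_w (excess j w)%:R.
Proof.
move=> jm EB.
have GW : sub_measurable (F (tick j)) (fun w => expo j w * rate j w).
  apply/(sub_measurableP (Fsigma (tick_ge0 j))); apply: measurable_funM.
    by apply/(sub_measurableP (Fsigma (tick_ge0 j))); exact/expo_adapted/ltnW.
  by apply/(sub_measurableP (Fsigma (tick_ge0 j))); exact: rate_adapted.
have WC w : `|expo j w * rate j w| <= expo_bound * E.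
  rewrite normrM (ger0_norm (expo_ge0 j w)) ler_pM ?expo_ge0 ?rate_norm//.
  exact/expo_le/ltnW.
have [iW W0] := weighted_increment bi (tick_ge0 j) (tick_leS j) (tick_le1 jm) GW WC.
have iZ := expo_integrable (ltnW jm).
have iZ1 : P.-integrable setT (EFin \o (fun w => (1 + step_error) * expo j w)).
  rewrite (_ : _ \o _ = (fun w => (1 + step_error)%:E * (EFin \o expo j) w)%E)//.
  exact: integrableZl.
have ie : P.-integrable setT (EFin \o (fun w => (expo_bound * E) * (excess j w)%:R)).
  rewrite (_ : _ \o _ = (fun w => (expo_bound * E)%:E * (excess j w)%:R%:E)%E)//.
  by apply: integrableZl => //; exact: excess_integrable.
have iZW : P.-integrable setT (EFin \o (fun w => (1 + step_error) * expo j w +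
   (expo j w * rate j w) * ((N w (tick j.+1))%:R - (N w (tick j))%:R - dLam j w))).
  exact: (integrableD measurableT iZ1 iW).
apply: (@le_trans _ _ (\int[P]_w ((1 + step_error) * expo j w +
    (expo j w * rate j w) * ((N w (tick j.+1))%:R - (N w (tick j))%:R - dLam j w) +
    (expo_bound * E) * (excess j w)%:R))).
  apply: le_Rintegral => //.
  - exact: expo_integrable.
  - exact: (integrableD measurableT iZW ie).
  - by move=> w _; exact: expo_step.
rewrite RintegralD// RintegralD// W0 addr0 RintegralZl// RintegralZl//.
exact: excess_integrable.
Qed.

(** Discrete Gronwall: in the iterated recursion each excess term is amplified by at most (1 +
    step_error)^m <= exp(m * step_error). *)
Lemma expo_mean : E * (B / m%:R) <= 2^-1 ->
  \int[P]_w expo m w <= expR (step_error *+ m) *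
    (1 + (expo_bound * E) * \int[P]_w (\sum_(i < m) (excess i w)%:R)).
Proof.
move=> EB.
have s0 : 0 <= step_error.
  by rewrite /step_error mulr_ge0 ?sqr_ge0// mulr_ge0// addr_ge0// expR_ge0.
have C0 : 0 <= expo_bound * E by rewrite /expo_bound !mulr_ge0// expR_ge0.
have rec j : (j <= m)%N -> \int[P]_w expo j w <= (1 + step_error) ^+ j *
   (1 + (expo_bound * E) * \sum_(i < j) \int[P]_w (excess i w)%:R).
  elim: j => [_|j IH jm].
    rewrite big_ord0 mulr0 addr0 expr0 mulr1 /=.
    by rewrite Rintegral_cst// mul1r [X in fine X](_ : _ = 1%E)//; exact: probability_setT.
  apply: (le_trans (expo_mean_step jm EB)).
  have I0 : 0 <= \int[P]_w (excess j w)%:R by apply: Rintegral_ge0.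
  rewrite big_ord_recr/=; set A := \sum_(i < j) _; set I := \int[P]_w (excess j w)%:R.
  have -> : (1 + step_error) ^+ j.+1 * (1 + expo_bound * E * (A + I)) =
    (1 + step_error) * ((1 + step_error) ^+ j * (1 + expo_bound * E * A)) +
    (1 + step_error) ^+ j.+1 * (expo_bound * E * I) by rewrite exprS; ring.
  rewrite lerD//; first by rewrite ler_wpM2l ?addr_ge0// IH// ltnW.
  by rewrite -[leLHS]mul1r ler_wpM2r ?mulr_ge0// exprn_ege1// lerDl.
apply: (le_trans (rec m (leqnn m))).
have -> : \int[P]_w (\sum_(i < m) (excess i w)%:R) = \sum_(i < m) \int[P]_w (excess i w)%:R.
  rewrite /Rintegral; under eq_integral do rewrite -sumEFin.
  rewrite (@integral_sum _ _ _ P setT measurableT _ (fun (i : 'I_m) w => (excess i w)%:R%:E)).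
    apply: EFin_inj; rewrite fineK; last first.
      by apply/sum_fin_numP => i _ _; apply: integrable_fin_num => //; exact: excess_integrable.
    rewrite -sumEFin; apply: eq_bigr => i _; rewrite fineK//.
    by apply: integrable_fin_num => //; exact: excess_integrable.
  by move=> i; exact: excess_integrable.
apply: ler_wpM2r.
  by rewrite addr_ge0// mulr_ge0// sumr_ge0// => i _; apply: Rintegral_ge0.
rewrite -mulr_natr expRM_natr lerXn2r ?nnegrE ?addr_ge0 ?expR_ge0//.
exact: expR_ge1Dx.
Qed.

End discretization.

(** * From the grid to bounded functions of time and covariates *)

Section exponential_moment.
Context (R : realType) dS (S : measurableType dS) disp (Omega : measurableType disp)
  (P : probability Omega R) (F : R -> set (set Omega)).
Variables (X : Omega -> S) (N : Omega -> counting_path R) (Y : R -> Omega -> R)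
  (beta : R * S -> R) (B : R).
Hypothesis bi : bounded_intensity P F X N Y beta B.

Definition exposure_integral (phi : R * S -> R) (w : Omega) : R :=
  \int[lebesgue_measure]_(t in `[0, 1]) (phi (t, X w) * Y t w).

Definition jump_integral (phi : R * S -> R) (w : Omega) : R :=
  \int[lebesgue_stieltjes_measure (cp_real (N w))]_(t in `]0, 1]) phi (t, X w).

Local Notation I := exposure_integral.
Local Notation J := jump_integral.

Let iI (K : R) (phi : R * S -> R) (w : Omega)
   (mphi : measurable_fun setT phi) (phiK : forall z, `|phi z| <= K) :=
  @exposure_integrable _ _ _ _ _ _ _ _ _ _ _ _ bi K phi true false 0 1 w mphi phiK.

Lemma exposure_integralD (K L : R) (phi psi : R * S -> R) w :
  measurable_fun setT phi -> (forall z, `|phi z| <= K) ->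
  measurable_fun setT psi -> (forall z, `|psi z| <= L) ->
  I (fun z => phi z + psi z) w = I phi w + I psi w.
Proof.
move=> mphi phiK mpsi psiL; rewrite /exposure_integral -RintegralD//.
- by apply: eq_Rintegral => t _; rewrite mulrDl.
- exact: (iI w mphi phiK).
- exact: (iI w mpsi psiL).
Qed.

Lemma exposure_integralZ (K a : R) (phi : R * S -> R) w :
  measurable_fun setT phi -> (forall z, `|phi z| <= K) ->
  I (fun z => a * phi z) w = a * I phi w.
Proof.
move=> mphi phiK; rewrite /exposure_integral -RintegralZl//.
- by apply: eq_Rintegral => t _; rewrite mulrA.
- exact: (iI w mphi phiK).
Qed.

Lemma le_exposure_integral (K L : R) (phi psi : R * S -> R) w :
  measurable_fun setT phi -> (forall z, `|phi z| <= K) ->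
  measurable_fun setT psi -> (forall z, `|psi z| <= L) ->
  (forall z, phi z <= psi z) -> I phi w <= I psi w.
Proof.
move=> mphi phiK mpsi psiL le; apply: le_Rintegral => //.
- exact: (iI w mphi phiK).
- exact: (iI w mpsi psiL).
- by move=> t _; apply: ler_wpM2r => //; have /andP[] := bi_exposure_itv bi t w.
Qed.

Lemma exposure_integral_ge0 (phi : R * S -> R) w : (forall z, 0 <= phi z) -> 0 <= I phi w.
Proof.
move=> phi0; apply: Rintegral_ge0 => t _; apply: mulr_ge0 => //.
by have /andP[] := bi_exposure_itv bi t w.
Qed.

Lemma exposure_integral_norm (K : R) (phi : R * S -> R) w :
  measurable_fun setT phi -> (forall z, `|phi z| <= K) -> `|I phi w| <= K.
Proof.
move=> mphi phiK; apply: (le_trans (le_normr_Rintegral _ (iI w mphi phiK))) => //.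
have -> : K = \int[lebesgue_measure]_(t in `[0%R, 1%R]) K.
  rewrite Rintegral_cst//= lebesgue_measure_itv/= lte_fin ltr01.
  by rewrite /= subr0 mulr1.
apply: le_Rintegral => //.
- exact: (integrable_norm (iI w mphi phiK)).
- by apply: (@bounded_integrable _ _ _ _ _ `|K|) => //; exact: lebesgue_itv_lty.
- by move=> t _; exact: (exposure_normM bi).
Qed.

Lemma ge0_exposure_integral_measurable (phi : R * S -> R) :
  measurable_fun setT phi -> (forall z, 0 <= phi z) ->
  measurable_fun setT (fun w => (\int[lebesgue_measure]_(t in `[0%R, 1%R]) (phi (t, X w) * Y t w)%:E)%E).
Proof.
move=> mphi phi0.
have Y0 t w : 0 <= Y t w by have /andP[] := bi_exposure_itv bi t w.
have [_ FMs _] := bi_filtration bi.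
have mX : measurable_fun setT X.
  exact: (sub_measurable_measurable (FMs 0 (lexx 0)) (bi_covariates bi)).
pose h (z : Omega * measurableTypeR R) : \bar R :=
  ((\1_(`[0%R, 1%R]%classic : set R) z.2) * (phi (z.2, X z.1) * Y z.2 z.1))%:E.
have mh : measurable_fun setT h.
  apply/measurable_EFinP; apply: measurable_funM.
    apply: (@measurableT_comp _ _ _ _ _ _ (\1_(`[0%R, 1%R]%classic : set R) : R -> R)) => //.
  apply: measurable_funM.
    apply: (measurableT_comp mphi); apply: measurable_fun_pair => //.
    exact: measurableT_comp.
  apply: (@measurableT_comp _ _ _ _ _ _ (fun z : R * Omega => Y z.1 z.2) _
     (fun z : Omega * measurableTypeR R => (z.2, z.1))) => //.
    exact: (bi_exposure_measurable bi).
  exact: measurable_fun_pair.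
have h0 z : (0 <= h z)%E by rewrite lee_fin mulr_ge0 ?mulr_ge0// indicE.
have := @measurable_fun_fubini_tonelli_F _ _ _ _ _ (@lebesgue_measure R) h mh h0.
apply: eq_measurable_fun => w _; rewrite /fubini_F [RHS]integral_mkcond.
apply: eq_integral => t _; rewrite /h patchE indicE /=.
by case: ifPn => _; rewrite ?mul1r ?mul0r.
Qed.

Lemma exposure_integral_measurable (K : R) (phi : R * S -> R) :
  measurable_fun setT phi -> (forall z, `|phi z| <= K) ->
  measurable_fun setT (I phi).
Proof.
move=> mphi phiK.
(* A point of [Omega] gives a point of [S] through [X], hence 0 <= K, and the constant [K] may be
   subtracted as [|K|]. *)
have [w0|] := pselect (exists w : Omega, True); last first.
  move=> nw _ A mA; rewrite (_ : _ `&` _ = set0)//.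
  by apply/seteqP; split => // w; exfalso; apply: nw; exists w.
have Kz z : 0 <= phi z + K by have := phiK z; rewrite ler_norml => /andP[]; lra.
have mphiK : measurable_fun setT (fun z => phi z + K) by exact: measurable_funD.
have -> : I phi = (fun w => I (fun z => phi z + K) w - I (fun=> `|K|) w).
  have {w0} [w0 _] := w0.
  have K0 : `|K| = K.
    rewrite ger0_norm//; exact: le_trans (normr_ge0 _) (phiK (0, X w0)).
  apply/funext => w; rewrite K0 (exposure_integralD w mphi phiK (psi := fun=> K) (L := `|K|))//.
  by rewrite addrK.
apply: measurable_funB.
  apply: measurableT_comp (ge0_exposure_integral_measurable mphiK Kz).
  exact: fine_measurable.
exact: measurableT_comp (ge0_exposure_integral_measurable (phi := fun=> `|K|) _ _).
Qed.

(** Logarithm, at time 1, of the Doleans-Dade exponential of the integral of exp f - 1 against N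
    minus its compensator. *)
Definition log_exponential (f : R * S -> R) (w : Omega) : R := J f w - I (fun z => (expR (f z) - 1) * beta z) w.

Lemma intensity_bound_ge0 (w : Omega) : 0 <= B.
Proof. by have /andP[b0 bB] := bi_itv bi (0, X w); exact: le_trans bB. Qed.

Lemma expR_sub1_norm (K x : R) : `|x| <= K -> `|expR x - 1| <= expR K.
Proof.
move=> xK; have K0 : 0 <= K by exact: le_trans (normr_ge0 x) xK.
have E1 : 1 <= expR K by rewrite -expR0 ler_expR.
have := expR_ge0 x; have : expR x <= expR K.
  by rewrite ler_expR; exact: le_trans (ler_norm _) xK.
by rewrite ler_norml => ? ?; apply/andP; split; lra.
Qed.

Lemma intensity_exp_measurable (f : R * S -> R) : measurable_fun setT f ->
  measurable_fun setT (fun z => (expR (f z) - 1) * beta z).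
Proof.
move=> mf; apply: measurable_funM; last exact: (bi_measurable bi).
by apply: measurable_funB => //; exact: measurableT_comp.
Qed.

Lemma intensity_exp_norm (K : R) (f : R * S -> R) : (forall z, `|f z| <= K) ->
  forall z, `|(expR (f z) - 1) * beta z| <= expR K * B.
Proof.
move=> fK z; rewrite normrM ler_pM//; first exact: expR_sub1_norm.
by have /andP[b0 bB] := bi_itv bi z; rewrite ger0_norm.
Qed.

Section step_function.
Variables (K : R) (r : nat) (f : R * S -> R).
Hypotheses (r0 : (0 < r)%N) (mf : measurable_fun setT f)
  (fK : forall z, `|f z| <= K) (fr : grid_const r f).

Let m q := (r * q.+1)%N.
(** Read at the right end, the tick that belongs to the cell. As [f] is deterministic and [X] is
    known at time 0, this value is already available at the left end. *)
Let c q j x := f (tick R (m q) j.+1, x).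

Let m_gt0 q : (0 < m q)%N. Proof. by rewrite muln_gt0 r0. Qed.

Let f_tick q j t x : j%:R / (m q)%:R < t <= j.+1%:R / (m q)%:R -> f (t, x) = c q j x.
Proof.
move=> jt; apply: (grid_const_refine r0 (ltn0Sn q) fr _ jt).
by rewrite /tick lexx andbT ltr_pM2r ?invr_gt0 ?ltr0n ?m_gt0// ltr_nat.
Qed.

Let mc q j : measurable_fun setT (c q j).
Proof. exact: measurableT_comp mf (@pair1_measurable _ _ _ _ _). Qed.

Let cK q j x : `|c q j x| <= K. Proof. exact: fK. Qed.

Lemma jump_integral_step q w :
  J f w = \sum_(j < m q) c q j (X w) *
    ((N w (tick R (m q) j.+1))%:R - (N w (tick R (m q) j))%:R).
Proof.
rewrite /jump_integral (@counting_path_Rintegral_grid _ _ (m q) _ (fun j => c q j (X w)) K)//.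
- exact: measurableT_comp mf (@pair2_measurable _ _ _ _ _).
- by move=> j t /f_tick.
Qed.

Lemma exposure_integral_step q w :
  I (fun z => (expR (f z) - 1) * beta z) w =
  \sum_(j < m q) (expR (c q j (X w)) - 1) * dLam X Y beta (m q) j w.
Proof.
have mg := intensity_exp_measurable mf; have gK := intensity_exp_norm fK.
rewrite /exposure_integral -Rintegral_itv_obnd_cbnd; last first.
  exact: (exposure_integrable bi _ _ _ _ _ mg gK).
have -> : \int[lebesgue_measure]_(t in `]0%R, 1%R])
    ((expR (f (t, X w)) - 1) * beta (t, X w) * Y t w) =
  \int[lebesgue_measure]_(t in `]0%R, 1%R])
    ((expR (f (t, X w)) - 1) * (beta (t, X w) * Y t w)).
  by apply: eq_Rintegral => t _; rewrite mulrA.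
have beta_norm z : `|beta z| <= B.
  by have /andP[b0 bB] := bi_itv bi z; rewrite ger0_norm.
rewrite (@Rintegral_grid_const R lebesgue_measure (m q) (fun t => expR (f (t, X w)) - 1)
  (fun t => beta (t, X w) * Y t w) (fun j => expR (c q j (X w)) - 1) (m_gt0 q)).
- apply: eq_bigr => j _; congr (_ * _); rewrite /dLam (cumulated_intensityB bi)//.
    exact: tick_ge0.
  exact: tick_leS.
- have := exposure_integrable bi false false 0 1 w mg gK.
  by apply: eq_integrable => // t _ /=; rewrite mulrA.
- exact: (exposure_integrable bi _ _ _ _ _ (bi_measurable bi) beta_norm).
- by move=> j t /f_tick ->.
Qed.

Lemma jump_integral_step_measurable : measurable_fun setT (J f).
Proof.
have -> : J f = (fun w => \sum_(j < m 0) c 0 j (X w) *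
    ((N w (tick R (m 0) j.+1))%:R - (N w (tick R (m 0) j))%:R)).
  by apply/funext => w; rewrite (jump_integral_step 0).
have [_ FMs _] := bi_filtration bi.
apply: measurable_sum => j; apply: measurable_funM.
  apply: measurableT_comp (mc 0 j) _.
  exact: (sub_measurable_measurable (FMs 0 (lexx 0)) (bi_covariates bi)).
by apply: measurable_funB; apply: (count_measurable bi); exact: tick_ge0.
Qed.

(** Without freezing and without excess nothing is lost on the grid: a tick with a jump contributes
    1 + (exp c - 1) = exp c, any other tick contributes 1. *)
Lemma expo_eq_exp k q w : (N w 1%R < k)%N ->
  (forall j, (j < m q)%N -> excess N (m q) j w = 0%N) ->
  expo X N Y beta (m q) k (c q) (m q) w = expR (log_exponential f w).
Proof.
move=> Nk ex0; rewrite /log_exponential (jump_integral_step q) (exposure_integral_step q).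
rewrite -sumrB.
suff H j : (j <= m q)%N -> expo X N Y beta (m q) k (c q) j w =
  expR (\sum_(i < j) (c q i (X w) * ((N w (tick R (m q) i.+1))%:R - (N w (tick R (m q) i))%:R) -
     (expR (c q i (X w)) - 1) * dLam X Y beta (m q) i w)) by exact: H.
elim: j => [_|j IH jm]; first by rewrite big_ord0 expR0.
rewrite [LHS]/= IH ?(ltnW jm)// big_ord_recr/= expRD; congr (_ * _).
rewrite (increment_jump_excess _ (m_gt0 q)) ex0// addr0 expRD /rate.
have -> : (N w (tick R (m q) j) < k)%N.
  apply: leq_ltn_trans Nk; apply: cp_nondecreasing.
  exact/tick_le1/ltnW.
congr (_ * _); case: (jump _ _ _ _); last by rewrite !mulr0 expR0 addr0.
by rewrite !mulr1 addrC subrK.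
Qed.

Lemma excess_near0 w : \forall q \near \oo,
  forall j, (j < m q)%N -> excess N (m q) j w = 0%N.
Proof.
have [M _ HM] := counting_path_unit_increments (N w).
exists M => // q /= Mq j jm.
(* [counting_path_unit_increments] speaks of the mesh 1/(m+1), hence the predecessor. *)
have mE : m q = (m q).-1.+1 by rewrite prednK// m_gt0.
have Mm : (M <= (m q).-1)%N.
  by rewrite -ltnS -mE (leq_ltn_trans Mq)// /m -[X in (X < _)%N]mul1n (leq_trans (_ : 1 * q < 1 * q.+1)%N)// ?ltn_pmul2l// leq_mul2r r0 orbT.
have t0 := tick_ge0 R (m q) j.
have t1 := tick_le1 R (m_gt0 q) (ltnW jm).
have tl := tick_leS R (m_gt0 q) j.
have tS : tick R (m q) j.+1 <= tick R (m q) j + (m q).-1.+1%:R^-1 by rewrite -mE tickS.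
have := HM (m q).-1 Mm (tick R (m q) j) (tick R (m q) j.+1).
rewrite t0 t1 => /(_ isT tl tS); rewrite /excess; lia.
Qed.

Lemma sum_excess_le q w : (\sum_(i < m q) excess N (m q) i w <= N w 1%R)%N.
Proof.
suff H j : (j <= m q)%N -> (\sum_(i < j) excess N (m q) i w <= N w (tick R (m q) j))%N.
  apply: leq_trans (H _ (leqnn _)) _; apply: cp_nondecreasing.
  exact: tick_le1.
elim: j => [_|j IH jm]; first by rewrite big_ord0.
rewrite big_ord_recr/=; have := IH (ltnW jm).
have := @cp_nondecreasing _ (N w) _ _ (tick_leS R (m_gt0 q) j).
by move: (\sum_(i < j) excess N (m q) i w)%N => s; rewrite /excess; clear; lia.
Qed.

(** For each path the excess is eventually 0, and it never exceeds the integrable [N w 1]: dominated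
    convergence. *)
Lemma mean_excess_cvg0 :
  \int[P]_w (\sum_(i < m q) (excess N (m q) i w)%:R) @[q --> \oo] --> (0 : R).
Proof.
have [] := @dominated_convergence _ _ _ P setT measurableT
  (fun q w => (\sum_(i < m q) (excess N (m q) i w)%:R)%:E) (fun=> 0%E)
  (fun w => (N w 1)%:R%:E).
- move=> q; apply/measurable_EFinP; apply: measurable_sum => i.
  exact: (excess_measurable bi (m_gt0 q)).
- exact: measurable_cst.
- apply: aeW => w _; apply: cvg_near_cst.
  apply: filterS (excess_near0 w) => q ex0.
  by rewrite big1// => i _; rewrite ex0.
- exact: (bi_integrable bi).
- apply: aeW => w q _; rewrite /= lee_fin ger0_norm ?sumr_ge0//.
  by rewrite -natr_sum ler_nat sum_excess_le.
move=> _ _; rewrite integral0 => h.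
by apply/fine_cvg.
Qed.

(** Two limits, both by Fatou: first the mesh goes to 0 at a fixed freezing level [k], which keeps
    [expo_bound] constant, then [k] grows. *)
Lemma exp_moment_step : (\int[P]_w (expR (log_exponential f w))%:E <= 1)%E.
Proof.
have [[w0 _]|] := pselect (exists w : Omega, True); last first.
  move=> nw; rewrite (_ : (\int[P]_w _ = 0)%E) ?lee01//.
  by apply: integral0_eq => w _; exfalso; apply: nw; exists w.
have B0 := intensity_bound_ge0 w0.
have K0 : 0 <= K by exact: le_trans (normr_ge0 _) (fK (0, X w0)).
(* With fewer than [k] jumps the freezing never acts, so on this event the grid process reaches the
   unfrozen exponential. *)
pose Z k q w := if (N w 1)%:R < k%:R :> R then expo X N Y beta (m q) k (c q) (m q) w else 0.
pose G w := expR (log_exponential f w).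
have mN1 : measurable_fun setT (fun w => (N w 1)%:R : R) by exact: (count_measurable bi).
have mG : measurable_fun setT G.
  apply: measurableT_comp => //; apply: measurable_funB.
    exact: jump_integral_step_measurable.
  exact: (exposure_integral_measurable (intensity_exp_measurable mf) (intensity_exp_norm fK)).
pose Gk k w := if (N w 1)%:R < k%:R :> R then G w else 0.
have Gk1 k : (\int[P]_w (Gk k w)%:E <= 1)%E.
  (* The bounds on the grid tend to 1 without being at most 1, hence the detour through 1 + e. *)
  apply/lee_addgt0Pr => e e0; rewrite -EFinD.
  apply: (@fatou_le _ _ _ P (1 + e) (Z k)).
  - move=> q; apply: measurable_fun_ifT => //.
      exact: measurable_fun_ltr.
    exact: (expo_measurable bi).
  - by move=> q w; rewrite /Z; case: ifP => // _; exact: expo_ge0.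
  - move=> w; apply: cvg_near_cst; apply: filterS (excess_near0 w) => q ex0.
    rewrite /Z /Gk ltr_nat; case: ifP => // Nk.
    by rewrite expo_eq_exp.
  (* The bound of [expo_mean], with [step_error *+ m] rewritten as a constant over [m q]; for fixed
     [k] it tends to 1. *)
  - pose u q := expR (2 * (1 + expR K) * (expR K * B) ^+ 2 * (m q)%:R^-1) *
      (1 + expo_bound B k K * expR K * \int[P]_w (\sum_(i < m q) (excess N (m q) i w)%:R)).
    have m_cvg : ((m q)%:R : R)^-1 @[q --> \oo] --> (0 : R).
      have -> : (fun q => ((m q)%:R : R)^-1) = (fun q => r%:R^-1 * harmonic q).
        by apply/funext => q; rewrite /m natrM invfM.
      by rewrite -[X in _ --> X](mulr0 r%:R^-1); apply: cvgMr; exact: cvg_harmonic.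
    have u1 : u q @[q --> \oo] --> (1 : R).
      rewrite -[X in _ --> X](mulr1 1); apply: cvgM.
        rewrite -[X in _ --> X]expR0; apply: continuous_cvg; first exact: continuous_expR.
        rewrite -[X in _ --> X](mulr0 (2 * (1 + expR K) * (expR K * B) ^+ 2)).
        by apply: cvgMr; exact: m_cvg.
      rewrite -[X in _ --> X](addr0 1); apply: cvgD; first exact: cvg_cst.
      rewrite -[X in _ --> X](mulr0 (expo_bound B k K * expR K)).
      by apply: cvgMr; exact: mean_excess_cvg0.
    have EB0 : expR K * (B * ((m q)%:R)^-1) @[q --> \oo] --> (0 : R).
      rewrite -[X in _ --> X](mulr0 (expR K)); apply: cvgMr.
      by rewrite -[X in _ --> X](mulr0 B); apply: cvgMr.
    near=> q.
    apply: (@le_trans _ _ (\int[P]_w (expo X N Y beta (m q) k (c q) (m q) w)%:E)%E).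
      apply: integral_le_nonmeasurable => w.
        by rewrite lee_fin /Z; case: ifP => // _; exact: expo_ge0.
      by rewrite lee_fin /Z; case: ifP => // _; exact: expo_ge0.
    have iZ := expo_integrable bi k (m_gt0 q) K0 B0 (mc q) (cK q) (leqnn (m q)).
    rewrite -[X in (X <= _)%E]fineK; last exact: integrable_fin_num.
    rewrite lee_fin.
    have EB : expR K * (B / (m q)%:R) <= 2^-1.
      by near: q; apply: (cvgr_le (0 : R)) => //; rewrite invr_gt0.
    apply: (le_trans (expo_mean bi k (m_gt0 q) K0 B0 (mc q) (cK q) EB)).
    have uq : u q <= 1 + e by near: q; apply: (cvgr_le (1 : R)) => //; rewrite ltrDl.
    apply: le_trans uq; rewrite /u; apply: ler_wpM2r.
      rewrite addr_ge0// mulr_ge0 ?Rintegral_ge0//.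
        by rewrite /expo_bound !mulr_ge0// expR_ge0.
      by move=> w _; rewrite sumr_ge0.
    rewrite ler_expR /step_error -mulr_natr.
    have mq : (m q)%:R != 0 :> R by rewrite pnatr_eq0 -lt0n m_gt0.
    by rewrite le_eqVlt; apply/orP; left; apply/eqP; field.
apply: (@fatou_le _ _ _ P 1 Gk).
- move=> k; apply: measurable_fun_ifT => //; exact: measurable_fun_ltr.
- by move=> k w; rewrite /Gk; case: ifP => // _; exact: expR_ge0.
- move=> w; apply: cvg_near_cst; exists (N w 1%R).+1 => // k /= Nk.
  by rewrite /Gk ltr_nat Nk.
- exact: nearW.
Unshelve. all: by end_near. Qed.

End step_function.

(** Measurability of the jump integral in [w] travels with the induction: for steps it is a finite
    sum of counts, and it survives limits. Bounded convergence handles the integrals inside the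
    exponential, Fatou the mean. *)
Lemma exp_moment_closure f : bclosure f ->
  measurable_fun setT (J f) /\ (\int[P]_w (expR (log_exponential f w))%:E <= 1)%E.
Proof.
elim=> {f} [r K f r0 mf fK fr|G K f cG IH GK Gf].
  split; first exact: (jump_integral_step_measurable r0 mf fK fr).
  exact: (exp_moment_step r0 mf fK fr).
have mG q : measurable_fun setT (G q) by exact: bclosure_measurable.
have Jcvg w : J (G q) w @[q --> \oo] --> J f w.
  apply: (@bounded_cvg_Rintegral _ _ _ _ _ K) => //.
  - exact: counting_path_measure01.
  - move=> q; apply: measurable_funTS.
    exact: measurableT_comp (mG q) (@pair2_measurable _ _ _ _ _).
have mJ : measurable_fun setT (J f).
  apply: (@measurable_fun_cvg _ _ _ setT (fun q => J (G q))) => [q|w _].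
    exact: (IH q).1.
  exact: Jcvg.
split => //.
apply: (@fatou_le _ _ _ P 1 (fun q w => expR (log_exponential (G q) w))).
- move=> q; apply: measurableT_comp => //; apply: measurable_funB.
    exact: (IH q).1.
  exact: (exposure_integral_measurable (intensity_exp_measurable (mG q)) (intensity_exp_norm (GK q))).
- by move=> q w; exact: expR_ge0.
- move=> w; apply: continuous_cvg; first exact: continuous_expR.
  apply: cvgB; first exact: Jcvg.
  apply: (@bounded_cvg_Rintegral _ _ _ _ _ (expR K * B)) => //.
  + exact: lebesgue_itv_lty.
  + move=> q; apply: measurable_funTS.
    exact: (exposure_section_measurable bi w (intensity_exp_measurable (mG q))).
  + move=> q t _; exact: (exposure_normM bi (t, X w) t w (intensity_exp_norm (GK q))).
  + move=> t _; apply: cvgMl; apply: cvgMl; apply: cvgB; last exact: cvg_cst.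
    by apply: continuous_cvg; [exact: continuous_expR|exact: Gf].
- by apply: nearW => q; exact: (IH q).2.
Qed.

Lemma jump_integral_measurable (K : R) (f : R * S -> R) :
  measurable_fun setT f -> (forall z, `|f z| <= K) -> measurable_fun setT (J f).
Proof. by move=> mf fK; exact: (exp_moment_closure (bounded_measurable_bclosure mf fK)).1. Qed.

Lemma exp_moment_le1 (K : R) (f : R * S -> R) :
  measurable_fun setT f -> (forall z, `|f z| <= K) ->
  (\int[P]_w (expR (log_exponential f w))%:E <= 1)%E.
Proof. by move=> mf fK; exact: (exp_moment_closure (bounded_measurable_bclosure mf fK)).2. Qed.

End exponential_moment.

(** * Laplace transform and mean of the excess loss of one individual *)

(** Since r and q lie in [0, D2], their squares are at most D2 times themselves, so the quadratic
    term is again linear: (r - rho q)^2 <= 2 r^2 + 2 rho^2 q^2 with 2 rho^2 <= 9/2 < 5. A linear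
    bound is what can be averaged over q. *)
Lemma expR_le_linear (R : realType) (k D2 r q eta : R) :
  0 < k -> 0 < eta <= 1 -> 0 <= r <= D2 -> 0 <= q <= D2 -> 128 * k * D2 <= eta ->
  expR (2 * k * (r - (1 + eta / 2) * q)) <=
  1 + 2 * k * (r - (1 + eta / 2) * q) + 8 * k ^+ 2 * D2 * (2 * r + 5 * q).
Proof.
move=> k0 /andP[e0 e1] /andP[r0 rD] /andP[q0 qD] kD.
set rho := 1 + eta / 2; have rho0 : 0 <= rho by rewrite /rho; lra.
have rho2 : rho <= 3 / 2 by rewrite /rho; lra.
have rq0 : 0 <= rho * q by rewrite mulr_ge0.
have y2 : 2 * k * (r - rho * q) <= 2^-1.
  have : 2 * k * (r - rho * q) <= 2 * k * D2.
    by apply: ler_wpM2l; [rewrite mulr_ge0// ltW|lra].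
  lra.
apply: (le_trans (expR_le1DxD2x2 y2)); rewrite lerD2l.
have -> : 2 * (2 * k * (r - rho * q)) ^+ 2 = 8 * k ^+ 2 * (r - rho * q) ^+ 2 by ring.
have k20 : 0 <= 8 * k ^+ 2 by rewrite mulr_ge0// sqr_ge0.
rewrite -[leRHS]mulrA ler_wpM2l//.
have rr : r ^+ 2 <= D2 * r by rewrite expr2 ler_wpM2r.
have qq : q ^+ 2 <= D2 * q by rewrite expr2 ler_wpM2r.
have rho9 : rho ^+ 2 <= 9 / 4.
  by rewrite (le_trans (_ : _ <= (3 / 2) ^+ 2)) ?lerXn2r ?nnegrE//; lra.
have : rho ^+ 2 * q ^+ 2 <= 9 / 4 * (D2 * q) by rewrite ler_pM// sqr_ge0.
have : (r - rho * q) ^+ 2 + (r + rho * q) ^+ 2 = 2 * r ^+ 2 + 2 * (rho ^+ 2 * q ^+ 2) by ring.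
have := sqr_ge0 (r + rho * q).
have : 0 <= D2 * q by rewrite mulr_ge0// (le_trans q0).
lra.
Qed.

(** With t = 4 k (1 + eta) the first-order terms in [Ip] cancel. The second-order term is 2 k q
    times 16 k B (1 + eta)^2 <= 64 k B <= eta / 2, which lowers 1 + eta to 1 + eta / 2. *)
Lemma laplace_exponent_le (R : realType) (k eta B Ip Ie q r : R) :
  0 < k -> 0 < eta <= 1 -> 0 <= B -> 0 <= q -> 128 * k * B <= eta ->
  Ie <= 4 * (k * (1 + eta)) * Ip + 2 * (4 * (k * (1 + eta))) ^+ 2 * B * q ->
  2 * k * r - 2 * (k * (1 + eta)) * (q + 2 * Ip) + Ie <= 2 * k * (r - (1 + eta / 2) * q).
Proof.
move=> k0 /andP[e0 e1] B0 q0 kB le.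
have kB0 : 0 <= k * B by rewrite mulr_ge0// ltW.
have e4 : (1 + eta) ^+ 2 <= 4 by rewrite (_ : 4 = 2 ^+ 2) ?lerXn2r ?nnegrE; [| lra | lra | lra | ring].
have h1 : 16 * (k * B) * (1 + eta) ^+ 2 <= eta / 2.
  have := ler_wpM2l kB0 e4; lra.
have kq0 : 0 <= 2 * k * q by rewrite !mulr_ge0// ltW.
have h2 := ler_wpM2l kq0 h1.
have E : 2 * (4 * (k * (1 + eta))) ^+ 2 * B * q = 2 * k * q * (16 * (k * B) * (1 + eta) ^+ 2) by ring.
rewrite E in le; lra.
Qed.

(** Does the work of Cauchy-Schwarz: it separates the exponential martingale from the part without
    jumps. *)
Lemma expR_half_le (R : realType) (x y : R) :
  expR ((x + y) / 2) <= 2^-1 * expR x + 2^-1 * expR y.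
Proof.
have half (z : R) : expR z = expR (z / 2) ^+ 2.
  by rewrite -expRM_natl; congr expR; field.
rewrite (half x) (half y) mulrDl expRD.
have := sqr_ge0 (expR (x / 2) - expR (y / 2)); lra.
Qed.

Section one_observation.
Context (R : realType) dS (S : measurableType dS) disp (Omega : measurableType disp)
  (P : probability Omega R) (F : R -> set (set Omega)).
Variables (X : Omega -> S) (N : Omega -> counting_path R) (Y : R -> Omega -> R)
  (beta : R * S -> R) (B : R).
Hypothesis bi : bounded_intensity P F X N Y beta B.
Variables (a : R * S -> R) (b : R).
Hypotheses (ma : measurable_fun setT a) (ab : forall z, `|a z| <= b)
  (b0 : 0 <= b) (B0 : 0 <= B).

Local Notation I := (exposure_integral X Y).
Local Notation J := (jump_integral X N).
Local Notation D := (b + B).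

Let psi z := a z - beta z.
Let mbeta := bi_measurable bi.

Let mpsi : measurable_fun setT psi. Proof. exact: measurable_funB. Qed.

Let beta_norm z : `|beta z| <= B.
Proof. by have /andP[? ?] := bi_itv bi z; rewrite ger0_norm. Qed.

Let psiD z : `|psi z| <= D.
Proof. by rewrite (le_trans (ler_normB _ _))// lerD. Qed.

Let D0 : 0 <= D. Proof. exact: addr_ge0. Qed.

Let psi2D z : `|psi z ^+ 2| <= D ^+ 2.
Proof. by rewrite normrX lerXn2r// nnegrE. Qed.

Let mpsi2 : measurable_fun setT (fun z => psi z ^+ 2).
Proof. exact: measurable_funX. Qed.

Definition sq_loss (w : Omega) : R := I (fun z => (a z - beta z) ^+ 2) w.

Definition excess_loss (w : Omega) : R :=
  I (fun z => a z ^+ 2 - beta z ^+ 2) w - 2 * J (fun z => a z - beta z) w.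

Definition mean_sq_loss : R := \int[P]_w sq_loss w.

Local Notation Q := sq_loss.
Local Notation h := excess_loss.
Local Notation r := mean_sq_loss.

Lemma sq_loss_itv w : 0 <= Q w <= D ^+ 2.
Proof.
have Q0 : 0 <= Q w by apply: (exposure_integral_ge0 bi) => z; exact: sqr_ge0.
by rewrite Q0/= -[leLHS]ger0_norm//; exact: (exposure_integral_norm bi w mpsi2 psi2D).
Qed.

Lemma sq_loss_measurable : measurable_fun setT Q.
Proof. exact: (exposure_integral_measurable bi mpsi2 psi2D). Qed.

Lemma sq_loss_integrable : P.-integrable setT (EFin \o Q).
Proof.
apply: (@bounded_integrable _ _ _ _ _ (D ^+ 2)) => //.
- exact: probability_setT_lty.
- exact: sq_loss_measurable.
- by move=> w _; have /andP[? ?] := sq_loss_itv w; rewrite ger0_norm.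
Qed.

Lemma mean_sq_loss_itv : 0 <= r <= D ^+ 2.
Proof.
apply/andP; split; first by apply: Rintegral_ge0 => w _; have /andP[] := sq_loss_itv w.
have -> : D ^+ 2 = \int[P]_w (D ^+ 2).
  by rewrite Rintegral_cst// [X in fine X](_ : _ = 1%E) ?mulr1//; exact: probability_setT.
apply: le_Rintegral => //.
- exact: sq_loss_integrable.
- apply: (@bounded_integrable _ _ _ _ _ (D ^+ 2)) => //; first exact: probability_setT_lty.
  by move=> w _; rewrite ger0_norm// sqr_ge0.
- by move=> w _; have /andP[] := sq_loss_itv w.
Qed.

Lemma jump_integralZ s w : J (fun z => s * psi z) w = s * J psi w.
Proof.
rewrite /jump_integral RintegralZl//.
apply: (@bounded_integrable _ _ _ _ _ D) => //.
- exact: counting_path_measure01.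
- by apply: measurable_funTS; exact: measurableT_comp mpsi (@pair2_measurable _ _ _ _ _).
Qed.

Lemma jump_integral_norm w : `|J psi w| <= D * (N w 1)%:R.
Proof.
have N01 := counting_path_measure01 (N w).
have iJ : (lebesgue_stieltjes_measure (cp_real (N w))).-integrable `]0%R, 1%R]
    (EFin \o (fun t => psi (t, X w))).
  apply: (@bounded_integrable _ _ _ _ _ D) => //.
  by apply: measurable_funTS; exact: measurableT_comp mpsi (@pair2_measurable _ _ _ _ _).
apply: (le_trans (le_normr_Rintegral _ iJ)) => //.
have -> : D * (N w 1)%:R = \int[lebesgue_stieltjes_measure (cp_real (N w))]_(t in `]0%R, 1%R]) D.
  rewrite Rintegral_cst// [X in fine X](_ : _ = ((N w 1)%:R - (N w 0)%:R)%:E); last first.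
    exact: counting_path_measure_itv.
  by rewrite (cp_start (N w) (lexx 0)) subr0.
apply: le_Rintegral => //.
- exact: (integrable_norm iJ).
- by apply: (@bounded_integrable _ _ _ _ _ D) => // t _; rewrite ger0_norm.
Qed.

Lemma jump_integral_integrable : P.-integrable setT (EFin \o J psi).
Proof.
apply: (@le_integrable _ _ _ P setT measurableT _ (fun w => D%:E * (N w 1)%:R%:E)%E).
- by apply/measurable_EFinP; exact: (jump_integral_measurable bi mpsi psiD).
- move=> w _; rewrite -EFinM lee_fin [leRHS]ger0_norm ?mulr_ge0//.
  exact: jump_integral_norm.
- apply: integrableZl => //; exact: (bi_integrable bi).
Qed.

Let ab2 z : `|a z ^+ 2 - beta z ^+ 2| <= b ^+ 2 + B ^+ 2.
Proof.
rewrite (le_trans (ler_normB _ _))// !normrX lerD// lerXn2r// nnegrE//.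
Qed.

Let mab2 : measurable_fun setT (fun z => a z ^+ 2 - beta z ^+ 2).
Proof. by apply: measurable_funB; exact: measurable_funX. Qed.

Lemma excess_loss_integrable : P.-integrable setT (EFin \o h).
Proof.
have i1 : P.-integrable setT (EFin \o I (fun z => a z ^+ 2 - beta z ^+ 2)).
  apply: (@bounded_integrable _ _ _ _ _ (b ^+ 2 + B ^+ 2)) => //.
  - exact: probability_setT_lty.
  - exact: (exposure_integral_measurable bi mab2 ab2).
  - by move=> w _; exact: (exposure_integral_norm bi w mab2 ab2).
have i2 : P.-integrable setT (fun w => 2%:E * (J psi w)%:E)%E.
  exact: (integrableZl measurableT 2 jump_integral_integrable).
exact: (integrableB measurableT i1 i2).
Qed.

(* [exp v - 1 <= v + 2 v^2], integrated against the intensity for [v = t psi]. *)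
Lemma intensity_exp_integral_le t w : `|t| * D <= 2^-1 ->
  I (fun z => (expR (t * psi z) - 1) * beta z) w <=
  I (fun z => t * psi z * beta z) w + 2 * t ^+ 2 * B * Q w.
Proof.
move=> tD.
have mt : measurable_fun setT (fun z => t * psi z) by exact: measurable_funM.
have tpsi z : `|t * psi z| <= `|t| * D by rewrite normrM ler_wpM2l.
have m1 := intensity_exp_measurable bi mt.
have n1 := intensity_exp_norm bi tpsi.
have m2 : measurable_fun setT (fun z => t * psi z * beta z) by exact: measurable_funM.
have n2 z : `|t * psi z * beta z| <= `|t| * D * B by rewrite normrM ler_pM.
have n3 z : `|2 * t ^+ 2 * B * psi z ^+ 2| <= `|2 * t ^+ 2 * B| * D ^+ 2.
  by rewrite normrM ler_wpM2l.
have m3 : measurable_fun setT (fun z => 2 * t ^+ 2 * B * psi z ^+ 2).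
  exact: measurable_funM.
rewrite /sq_loss -(exposure_integralZ bi (2 * t ^+ 2 * B) w mpsi2 psi2D).
rewrite -(exposure_integralD bi w m2 n2 m3 n3).
apply: (le_exposure_integral bi w m1 n1 _ (K := _)).
- exact: measurable_funD.
- by move=> z; apply: (le_trans (ler_normD _ _)); apply: lerD; [exact: n2|exact: n3].
- move=> z; have /andP[be0 beB] := bi_itv bi z.
  have v2 : t * psi z <= 2^-1.
    by rewrite (le_trans (ler_norm _))// (le_trans (tpsi z)).
  have ev := expR_le1DxD2x2 v2.
  have e1 : expR (t * psi z) - 1 <= t * psi z + 2 * (t * psi z) ^+ 2 by lra.
  apply: (le_trans (ler_wpM2r be0 e1)); rewrite mulrDl lerD2l exprMn.
  have -> : 2 * t ^+ 2 * B * psi z ^+ 2 = (2 * (t ^+ 2 * psi z ^+ 2)) * B by ring.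
  by rewrite ler_wpM2l// mulr_ge0// mulr_ge0// sqr_ge0.
Qed.

(** From a^2 - beta^2 = psi^2 + 2 psi beta. Hence the excess loss is [Q] minus twice
    [J psi - I (psi * beta)], the integral of [psi] against the compensated process. *)
Lemma excess_loss_decomp w :
  I (fun z => a z ^+ 2 - beta z ^+ 2) w = Q w + 2 * I (fun z => psi z * beta z) w.
Proof.
have m1 : measurable_fun setT (fun z => psi z * beta z) by exact: measurable_funM.
have n1 z : `|psi z * beta z| <= D * B by rewrite normrM ler_pM.
rewrite /sq_loss -(exposure_integralZ bi 2 w m1 n1).
have m2 : measurable_fun setT (fun z => 2 * (psi z * beta z)) by exact: measurable_funM.
have n2 z : `|2 * (psi z * beta z)| <= 2 * (D * B) by rewrite normrM ger0_norm// ler_wpM2l.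
rewrite -(exposure_integralD bi w mpsi2 psi2D m2 n2).
by congr (exposure_integral _ _ _ w); apply/funext => z; rewrite /psi; ring.
Qed.

Lemma intensity_integralZ t w :
  I (fun z => t * psi z * beta z) w = t * I (fun z => psi z * beta z) w.
Proof.
have m1 : measurable_fun setT (fun z => psi z * beta z) by exact: measurable_funM.
have n1 z : `|psi z * beta z| <= D * B by rewrite normrM ler_pM.
rewrite -(exposure_integralZ bi t w m1 n1).
by congr (exposure_integral _ _ _ w); apply/funext => z; rewrite mulrA.
Qed.

Variable eta : R.
Hypothesis eta01 : 0 < eta <= 1.

(* Any rate below [eta / (C (D + 1)^2)] with [C] large absorbs the second-order terms
   of [excess_loss_mean_le] and [excess_loss_laplace]; [C = 128] suffices. *)
Definition laplace_rate : R := eta / (128 * (D + 1) ^+ 2).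

Local Notation kap := laplace_rate.

Let eta0 : 0 < eta. Proof. by have /andP[] := eta01. Qed.
Let eta1 : eta <= 1. Proof. by have /andP[] := eta01. Qed.

Lemma laplace_rate_gt0 : 0 < kap.
Proof. by rewrite divr_gt0// mulr_gt0// exprn_gt0// ltr_wpDl. Qed.

Lemma laplace_rate_le : 128 * kap * B <= eta /\ 128 * kap * D <= 1 /\ 128 * kap * D ^+ 2 <= eta.
Proof.
have D1 : 0 < D + 1 by rewrite ltr_wpDl.
have E : 128 * kap = eta / (D + 1) ^+ 2.
  rewrite /laplace_rate; field; exact: lt0r_neq0.
have D2 : 0 < (D + 1) ^+ 2 by rewrite exprn_gt0.
rewrite E; have DD : D <= (D + 1) ^+ 2 by nra.
have BD : B <= (D + 1) ^+ 2 by apply: le_trans DD; rewrite lerDr.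
have D2D : D ^+ 2 <= (D + 1) ^+ 2 by rewrite lerXn2r ?nnegrE ?addr_ge0// lerDl.
split; last split.
- by rewrite mulrAC ler_pdivrMr// ler_wpM2l// ltW.
- by rewrite mulrAC ler_pdivrMr// ler_pM// ltW.
- by rewrite mulrAC ler_pdivrMr// ler_wpM2l// ltW.
Qed.

(** The martingale part has mean 0, so the mean is in fact r. The weaker bound follows from the
    exponential moment through 1 + x <= exp x; t = - 2 kap gives the jump integral the coefficient
    -2 after division by kap, at the price of 8 kap B Q. *)
Lemma excess_loss_mean_le : \int[P]_w h w <= (1 + eta) * r.
Proof.
have k0 := laplace_rate_gt0; have [kB [kD kD2]] := laplace_rate_le.
pose t := - (2 * kap).
have tE : `|t| = 2 * kap by rewrite normrN ger0_norm// mulr_ge0// ltW.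
have tD : `|t| * D <= 2^-1 by rewrite tE; nra.
have mt : measurable_fun setT (fun z => t * psi z) by exact: measurable_funM.
have tpsi z : `|t * psi z| <= `|t| * D by rewrite normrM ler_wpM2l.
pose L := log_exponential X N Y beta (fun z => t * psi z).
have m1 := intensity_exp_measurable bi mt.
have n1 := intensity_exp_norm bi tpsi.
have iI : P.-integrable setT (EFin \o I (fun z => (expR (t * psi z) - 1) * beta z)).
  apply: (@bounded_integrable _ _ _ _ _ (expR (`|t| * D) * B)) => //.
  - exact: probability_setT_lty.
  - exact: (exposure_integral_measurable bi m1 n1).
  - by move=> w _; exact: (exposure_integral_norm bi w m1 n1).
have LE w : L w = t * J psi w - I (fun z => (expR (t * psi z) - 1) * beta z) w.
  by rewrite /L /log_exponential jump_integralZ.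
have iL : P.-integrable setT (EFin \o L).
  rewrite (_ : EFin \o L = (fun w => t%:E * (J psi w)%:E - (I (fun z => (expR (t * psi z) - 1) * beta z) w)%:E)%E); last first.
    by apply/funext => w; rewrite /= LE EFinB EFinM.
  exact: (integrableB measurableT (integrableZl measurableT t jump_integral_integrable) iI).
have L0 : \int[P]_w L w <= 0.
  have mL : measurable_fun setT (fun w => expR (L w)).
    by apply: measurableT_comp => //; exact/measurable_EFinP/(measurable_int P).
  have eL1 := exp_moment_le1 bi mt tpsi.
  have ieL : P.-integrable setT (EFin \o (fun w => expR (L w))).
    apply/integrableP; split; first exact/measurable_EFinP.
    apply: le_lt_trans (ltry 1); apply: le_trans eL1.
    rewrite [leLHS](_ : _ = (\int[P]_w (expR (L w))%:E)%E)//.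
    by apply: eq_integral => w _; rewrite /= ger0_norm ?expR_ge0.
  have : \int[P]_w (1 + L w) <= \int[P]_w expR (L w).
    apply: le_Rintegral => //.
      exact: (integrableD measurableT (finite_measure_integrable_cst P 1 measurableT) iL).
    by move=> w _; exact: expR_ge1Dx.
  rewrite RintegralD//; last exact: finite_measure_integrable_cst.
  rewrite Rintegral_cst// [X in 1 * fine X](_ : _ = 1%E); last exact: probability_setT.
  have : \int[P]_w expR (L w) <= 1.
    by rewrite -lee_fin /Rintegral fineK//; exact: integrable_fin_num.
  by rewrite mulr1; lra.
have hle w : h w <= (1 + 8 * kap * B) * Q w + kap^-1 * L w.
  have := intensity_exp_integral_le w tD.
  rewrite intensity_integralZ /excess_loss excess_loss_decomp LE.
  set Ie := I (fun z => (expR (t * psi z) - 1) * beta z) w.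
  set Ip := I (fun z => psi z * beta z) w.
  rewrite -/psi; set j := J _ w => le.
  have -> : kap^-1 * (t * j - Ie) = - 2 * j - kap^-1 * Ie.
    by rewrite /t; field; exact: lt0r_neq0.
  have : kap^-1 * Ie <= kap^-1 * (t * Ip + 2 * t ^+ 2 * B * Q w).
    by rewrite ler_wpM2l// invr_ge0 ltW.
  have -> : kap^-1 * (t * Ip + 2 * t ^+ 2 * B * Q w) = - 2 * Ip + 8 * kap * B * Q w.
    by rewrite /t; field; exact: lt0r_neq0.
  lra.
have iQ := sq_loss_integrable.
have iQ1 : P.-integrable setT (EFin \o (fun w => (1 + 8 * kap * B) * Q w)).
  rewrite (_ : _ \o _ = (fun w => (1 + 8 * kap * B)%:E * (Q w)%:E)%E)//.
  exact: integrableZl.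
have iL1 : P.-integrable setT (EFin \o (fun w => kap^-1 * L w)).
  rewrite (_ : _ \o _ = (fun w => (kap^-1)%:E * (L w)%:E)%E)//.
  exact: integrableZl.
apply: (@le_trans _ _ (\int[P]_w ((1 + 8 * kap * B) * Q w + kap^-1 * L w))).
  apply: le_Rintegral => //; first exact: excess_loss_integrable.
  exact: (integrableD measurableT iQ1 iL1).
rewrite RintegralD// RintegralZl// RintegralZl// -/r.
have /andP[r0 _] := mean_sq_loss_itv.
have : kap^-1 * \int[P]_w L w <= 0 by rewrite mulr_ge0_le0// invr_ge0 ltW.
have kB0 : 0 <= kap * B by rewrite mulr_ge0// ltW.
have : 8 * kap * B * r <= eta * r by rewrite ler_wpM2r//; lra.
lra.
Qed.

(** The exponent is the midpoint of L and y: the choice t = 4 kap (1 + eta) puts the whole jump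
    integral into L, and y involves time integrals only. By convexity it suffices that exp L and exp
    y both have mean at most 1; for exp y this holds through the linear bound [lin]. *)
Lemma excess_loss_laplace :
  (\int[P]_w (expR (kap * (r - (1 + eta) * h w)))%:E <= 1)%E.
Proof.
have k0 := laplace_rate_gt0; have [kB [kD kD2]] := laplace_rate_le.
have /andP[r0 rD] := mean_sq_loss_itv.
pose s := kap * (1 + eta); pose t := 4 * s.
have s0 : 0 < s by rewrite mulr_gt0// addr_gt0.
have ke : kap * eta <= kap by rewrite -[leRHS]mulr1 ler_wpM2l// ltW.
have s2 : s <= 2 * kap by rewrite /s mulrDr mulr1; lra.
have tE : `|t| = 4 * s by rewrite ger0_norm// mulr_ge0// ltW.
have tD : `|t| * D <= 2^-1 by rewrite tE; nra.
have mt : measurable_fun setT (fun z => t * psi z) by exact: measurable_funM.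
have tpsi z : `|t * psi z| <= `|t| * D by rewrite normrM ler_wpM2l.
pose L := log_exponential X N Y beta (fun z => t * psi z).
have m1 := intensity_exp_measurable bi mt.
have n1 := intensity_exp_norm bi tpsi.
have mI := exposure_integral_measurable bi m1 n1.
have LE w : L w = t * J psi w - I (fun z => (expR (t * psi z) - 1) * beta z) w.
  by rewrite /L /log_exponential jump_integralZ.
have mL : measurable_fun setT L.
  exact: (measurable_funB (jump_integral_measurable bi mt tpsi) mI).
pose rho := 1 + eta / 2.
pose lin w := 1 + 2 * kap * (r - rho * Q w) + 8 * kap ^+ 2 * D ^+ 2 * (2 * r + 5 * Q w).
have lin_ge0 w : expR (2 * kap * (r - rho * Q w)) <= lin w.
  exact: (expR_le_linear k0 eta01 mean_sq_loss_itv (sq_loss_itv w) kD2).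
have main w : expR (kap * (r - (1 + eta) * h w)) <= 2^-1 * expR (L w) + 2^-1 * lin w.
  have /andP[Q0 QD] := sq_loss_itv w.
  have := intensity_exp_integral_le w tD.
  rewrite intensity_integralZ.
  set Ie := I (fun z => (expR (t * psi z) - 1) * beta z) w.
  set Ip := I (fun z => psi z * beta z) w => le.
  pose y := 2 * kap * r - 2 * s * (Q w + 2 * Ip) + Ie.
  have E1 : kap * (r - (1 + eta) * h w) = (L w + y) / 2.
    rewrite /excess_loss excess_loss_decomp LE /y -/Ip -/Ie -/psi /t /s.
    by field.
  have yle : y <= 2 * kap * (r - rho * Q w).
    exact: (laplace_exponent_le r k0 eta01 B0 Q0 kB le).
  have E2 := expR_half_le (L w) y.
  rewrite E1; apply: (le_trans E2); rewrite lerD2l ler_wpM2l//.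
  by apply: le_trans (lin_ge0 w); rewrite ler_expR.
have lin0 w : 0 <= lin w by apply: le_trans (lin_ge0 w); exact: expR_ge0.
have iQ := sq_loss_integrable.
have linE : (\int[P]_w (lin w)%:E <= 1)%E.
  pose c1 := 8 * kap ^+ 2 * D ^+ 2 * 5 - 2 * kap * rho.
  pose c0 := 1 + 2 * kap * r + 8 * kap ^+ 2 * D ^+ 2 * 2 * r.
  have linw w : lin w = c0 + c1 * Q w by rewrite /lin /c0 /c1; ring.
  have ic : P.-integrable setT (EFin \o cst c0) by exact: finite_measure_integrable_cst.
  have iQ1 : P.-integrable setT (EFin \o (fun w => c1 * Q w)).
    rewrite (_ : _ \o _ = (fun w => c1%:E * (Q w)%:E)%E)//.
    exact: integrableZl.
  have ilin : P.-integrable setT (EFin \o lin).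
    have := integrableD measurableT ic iQ1; apply: eq_integrable => // w _.
    by rewrite /= linw.
  rewrite -[X in (X <= _)%E]fineK; last exact: integrable_fin_num.
  rewrite -/(Rintegral _ _ _) lee_fin.
  rewrite (_ : \int[P]_w lin w = \int[P]_w (c0 + c1 * Q w)); last first.
    by apply: eq_Rintegral => w _; exact: linw.
  rewrite RintegralD// RintegralZl// -/r Rintegral_cst//.
  rewrite [X in c0 * fine X](_ : _ = 1%E); last exact: probability_setT.
  (* 56 = 8 * (2 + 5). Since [Q] has mean r, the first-order part of [lin] has mean - kap * eta * r,
     which outweighs the second-order part. *)
  have : 56 * kap ^+ 2 * D ^+ 2 * r <= kap * eta * r.
    rewrite ler_wpM2r// expr2; have : 56 * kap * D ^+ 2 <= eta by nra.
    move=> h; have := ler_wpM2l (ltW k0) h; lra.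
  by rewrite /c0 /c1 /rho mulr1; lra.
apply: (@le_trans _ _ (\int[P]_w ((2^-1)%:E * (expR (L w))%:E + (2^-1)%:E * (lin w)%:E))%E).
  apply: integral_le_nonmeasurable => w; first by rewrite lee_fin expR_ge0.
  by rewrite -!EFinM -EFinD lee_fin.
have mlin : measurable_fun setT lin.
  rewrite /lin; apply: measurable_funD.
    apply: measurable_funD => //; apply: measurable_funM => //; apply: measurable_funB => //.
    by apply: measurable_funM => //; exact: sq_loss_measurable.
  apply: measurable_funM => //; apply: measurable_funD => //.
  by apply: measurable_funM => //; exact: sq_loss_measurable.
have meL : measurable_fun setT (fun w => (expR (L w))%:E).
  by apply/measurable_EFinP; exact: measurableT_comp.
rewrite ge0_integralD//; last 3 first.
- exact: measurable_funeM.
- by move=> w _; rewrite -EFinM lee_fin mulr_ge0.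
- by apply: measurable_funeM; exact/measurable_EFinP.
rewrite ge0_integralZl_EFin//.
rewrite ge0_integralZl_EFin//; last 2 first.
- by move=> w _; rewrite lee_fin.
- exact/measurable_EFinP.
have -> : (1 = (2^-1)%:E * 1 + (2^-1)%:E * 1 :> \bar R)%E.
  by rewrite !mule1 -EFinD; congr (_%:E); lra.
apply: leeD; apply: lee_wpmul2l => //; exact: (exp_moment_le1 bi mt tpsi).
Qed.

End one_observation.

(** * Reduction of the model to a bounded intensity *)

Section covariate_cube.
Context (R : realType) (d : nat).
Implicit Type x : d.-tuple R.

Lemma cube_measurable : measurable (@cube R d).
Proof.
have -> : cube (R := R) (d := d) = \bigcap_(i in [set: 'I_d])
    ((fun x : d.-tuple R => tnth x i) @^-1` `[0, 1]).
  apply/seteqP; split => [x xc i _|x xc i]; first by rewrite /= in_itv/=; exact: xc.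
  by have := xc i I; rewrite /= in_itv.
apply: fin_bigcap_measurable => // i _.
rewrite -[_ @^-1` _]setTI; apply: measurable_tnth => //.
Qed.

Lemma time_cube_measurable : measurable (@time_cube R d).
Proof. by apply: measurableX => //; exact: cube_measurable. Qed.

Lemma time_cube0 : time_cube (0 : R, [tuple 0 | i < d] : d.-tuple R).
Proof.
split => /=; first by rewrite in_itv/= lexx ler01.
by move=> i; rewrite tnth_mktuple lexx ler01.
Qed.

Lemma supnorm_le (f : R * d.-tuple R -> R) (b : R) z :
  (supnorm f <= b%:E)%E -> time_cube z -> `|f z| <= b.
Proof.
move=> fb cz; rewrite -lee_fin; apply: le_trans fb.
by apply: ereal_sup_ubound; exists z.
Qed.

(* Off [0,1]^(d+1) the given functions are arbitrary; replacing them by 0 there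
   makes the sup-norm bounds hold everywhere. *)
Definition clip (f : R * d.-tuple R -> R) (z : R * d.-tuple R) : R :=
  \1_(time_cube (R := R) (d := d)) z * f z.

Lemma clip_id f z : time_cube z -> clip f z = f z.
Proof. by move=> cz; rewrite /clip indicE mem_set// mul1r. Qed.

Lemma clip_out f z : ~ time_cube z -> clip f z = 0.
Proof. by move=> cz; rewrite /clip indicE memNset// mul0r. Qed.

Lemma clip_measurable f : measurable_fun setT f -> measurable_fun setT (clip f).
Proof.
move=> mf; apply: measurable_funM => //.
by apply: measurable_indic; exact: time_cube_measurable.
Qed.

Lemma clip_norm f (b : R) : 0 <= b -> (supnorm f <= b%:E)%E -> forall z, `|clip f z| <= b.
Proof.
move=> b0 fb z; have [cz|ncz] := pselect (time_cube z).
  by rewrite clip_id//; exact: supnorm_le.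
by rewrite clip_out// normr0.
Qed.

(* The complement of the support is covered by countably many null boxes with
   rational centres and radii. *)
Lemma law_support_null (mu : probability (d.-tuple R) R) :
  measurable (law_support mu) -> mu (~` law_support mu) = 0%E.
Proof.
move=> msupp.
have mbox (x : d.-tuple R) (e : R) :
    measurable [set y : d.-tuple R | forall i, `|tnth y i - tnth x i| < e].
  rewrite (_ : [set y : d.-tuple R | _] = \bigcap_(i in [set: 'I_d])
     ((fun y : d.-tuple R => tnth y i) @^-1` `](tnth x i - e), (tnth x i + e)[)).
    apply: fin_bigcap_measurable => // i _.
    by rewrite -[_ @^-1` _]setTI; exact: measurable_tnth.
  apply/seteqP; split => [y yx i _|y yx i].
    by rewrite /= in_itv/= -ltr_distl; exact: yx.
  by have := yx i I; rewrite /= in_itv/= -ltr_distl.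
pose box (p : d.-tuple rat * nat) : set (d.-tuple R) :=
  [set y | forall i, `|tnth y i - tnth [tuple ratr (tnth p.1 i) | i < d] i| < p.2.+1%:R^-1].
have mboxq p : measurable (box p) by exact: mbox.
pose A p := if mu (box p) == 0%E then box p else set0.
have A0 p : mu (A p) = 0%E.
  by rewrite /A; case: ifP => [/eqP//|_]; rewrite measure0.
have mA p : measurable (A p) by rewrite /A; case: ifP.
pose Apick n := if unpickle n is Some p then A p else set0.
have sub : ~` law_support mu `<=` \bigcup_n Apick n.
  move=> x /= /existsNP[e] /not_implyP[e0] mue.
  have [k ke] : exists k : nat, k.+1%:R^-1 < e / 2.
    exists (Num.truncn (e / 2)^-1).
    by rewrite invf_plt ?posrE ?divr_gt0// truncnS_gt.
  have k0 : 0 < k.+1%:R^-1 :> R by rewrite invr_gt0.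
  have qx i : exists q : rat, `|tnth x i - ratr q| < k.+1%:R^-1.
    have : tnth x i - k.+1%:R^-1 < tnth x i + k.+1%:R^-1.
      by rewrite ltrD2l (lt_trans _ k0)// oppr_lt0.
    move=> /rat_in_itvoo[q]; rewrite in_itv/= => /andP[q1 q2]; exists q.
    by rewrite distrC ltr_distl q1.
  pose q := [tuple sval (cid (qx i)) | i < d].
  have qE i : `|tnth x i - tnth [tuple ratr (tnth q i) | i < d] i| < k.+1%:R^-1.
    by rewrite !tnth_mktuple; exact: svalP (cid (qx i)).
  have box0 : mu (box (q, k)) = 0%E.
    apply/eqP; rewrite -measure_le0.
    apply: (@le_trans _ _ (mu [set y | forall i, `|tnth y i - tnth x i| < e])).
      apply: le_measure; rewrite ?inE//.
      move=> y yb i; have := yb i; have := qE i.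
      move: (tnth (mktuple _) i) => c xc yc.
      have -> : tnth y i - tnth x i = (tnth y i - c) - (tnth x i - c) by ring.
      rewrite (le_lt_trans (ler_normB _ _))// [e]splitr ltrD//.
        exact: lt_trans ke.
      exact: lt_trans ke.
    by rewrite leNgt; apply/negP.
  exists (pickle (q, k)) => //; rewrite /Apick pickleK /A box0 eqxx.
  exact: qE.
have mApick n : measurable (Apick n) by rewrite /Apick; case: unpickle.
apply/eqP; rewrite -measure_le0.
apply: (@le_trans _ _ (mu (\bigcup_n Apick n))).
  by apply: le_measure; rewrite ?inE//; [exact: measurableC|exact: bigcup_measurable].
have mU : measurable (\bigcup_n Apick n) by exact: bigcup_measurable.
apply: (le_trans (@measure_sigma_subadditive _ _ _ mu _ _ mApick mU (@subset_refl _ _))).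
rewrite [X in (X <= _)%E](_ : _ = 0%E)//; apply: eseries0 => n _ _.
by rewrite /Apick; case: (unpickle n) => [p|]; [exact: A0|exact: measure0].
Qed.

End covariate_cube.

Section model_reduction.
Context (R : realType) (d : nat) disp (Omega : measurableType disp)
  (P : probability Omega R) (F : R -> set (set Omega))
  (alpha0 : R * d.-tuple R -> R) (X : {mfun Omega >-> d.-tuple R})
  (N : Omega -> counting_path R) (Y : R -> Omega -> R) (a0 : R).
Hypotheses (model : counting_model P F alpha0 X N Y) (alpha0_norm : supnorm alpha0 = a0%:E).

Local Notation cube := (cube (R := R) (d := d)).
Local Notation time_cube := (time_cube (R := R) (d := d)).

(** [Y] is constrained at nonnegative times only; cut to [0,1], where the losses live, it is bounded
    and jointly measurable on the whole line. *)
Definition clip_exposure (t : R) (w : Omega) : R :=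
  \1_(`[0, 1]%classic : set R) t * Y t w.

Lemma intensity_norm_ge0 : 0 <= a0.
Proof.
have := @supnorm_le R d alpha0 a0 _ _ (time_cube0 R d).
by rewrite alpha0_norm => /(_ (lexx _)); exact: le_trans.
Qed.

(** Predictable rectangles are products of a Borel set of times and an event, so predictability
    implies joint measurability. *)
Lemma clip_exposure_measurable :
  measurable_fun setT (fun z : R * Omega => clip_exposure z.1 z.2).
Proof.
have [_ FMs _] := cm_filtration model.
pose D0 : set (R * Omega) := `[0, +oo[ `*` [set: Omega].
have mD0 : measurable D0 by exact: measurableX.
have sub : <<s D0, predictable_rectangles F>> `<=` measurable.
  apply: smallest_sub.
    split => //; first by move=> A mA; exact: measurableD.
    by move=> A mA; exact: bigcup_measurable.
  move=> _ [[A FA <-]|[s [t [A [s0 st FA ->]]]]]; apply: measurableX => //.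
    exact: (FMs 0).
  exact: (FMs s s0).
have mY : measurable_fun D0 (fun z : R * Omega => Y z.1 z.2).
  by move=> _ B mB; apply: sub; exact: (cm_predictable model mB).
pose D1 : set (R * Omega) := `[0, 1] `*` [set: Omega].
have mD1 : measurable D1 by exact: measurableX.
have mY1 : measurable_fun D1 (fun z : R * Omega => Y z.1 z.2).
  apply: measurable_funS mY => //.
  by move=> [t w] [/=]; rewrite in_itv/= => /andP[t0 _] _; split => //=; rewrite in_itv/= t0.
have -> : (fun z : R * Omega => clip_exposure z.1 z.2) = (fun z : R * Omega => Y z.1 z.2) \_ D1.
  apply/funext => -[t w]; rewrite patchE /clip_exposure indicE in_setX in_setT andbT/=.
  by case: ifP => _; rewrite ?mul1r ?mul0r.
exact/(measurable_restrictT _ _).1.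
Qed.

Lemma clip_exposure_itv t w : 0 <= clip_exposure t w <= 1.
Proof.
rewrite /clip_exposure indicE; case: (boolP (t \in _)) => [/set_mem|_]; last first.
  by rewrite mul0r lexx ler01.
rewrite /= in_itv/= => /andP[t0 _]; rewrite mul1r; exact: (cm_exposure_itv model).
Qed.

Lemma covariates_in_cube : P (~` (X @^-1` cube)) = 0%E.
Proof.
have := @law_support_null R d (distribution P X).
by rewrite (cm_covariates_support model); apply; exact: cube_measurable.
Qed.

Lemma clip_cumulated_intensity (t : R) w : 0 <= t <= 1 ->
  cumulated_intensity X clip_exposure (clip alpha0) t w =
  \1_(X @^-1` cube) w * compensator alpha0 X Y t w.
Proof.
move=> /andP[t0 t1]; rewrite /cumulated_intensity /compensator.
have inI u : `[0, t]%classic u -> `[0, 1]%classic u.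
  by rewrite /= !in_itv/= => /andP[-> ut]; exact: le_trans t1.
rewrite indicE; case: (boolP (w \in _)) => [/set_mem cw|cw].
  rewrite mul1r; apply: eq_Rintegral => u /set_mem /inI uI.
  by rewrite clip_id// /clip_exposure indicE mem_set// mul1r.
rewrite [RHS]mul0r; transitivity (\int[lebesgue_measure]_(u in `[0, t]) (0 : R)).
  apply: eq_Rintegral => u _; rewrite clip_out ?mul0r//.
  by move=> [_ /= Xc]; move/negP : cw; apply; exact/mem_set.
by rewrite Rintegral_cst// mul0r.
Qed.

(** Adaptedness of the clipped compensator comes from the martingale: on the event that X lies in
    the cube, which is in [F 0], it equals N minus the adapted N - compensator. Likewise N(1) is
    integrable as an integrable martingale value plus a compensator bounded by [a0]. *)
Lemma bounded_intensity_model :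
  bounded_intensity P F X N clip_exposure (clip alpha0) a0.
Proof.
have [Fs FMs FF] := cm_filtration model.
have a00 := intensity_norm_ge0.
have mcube := @cube_measurable R d.
have F0cube t : 0 <= t -> F t (X @^-1` cube).
  by move=> t0; apply: (FF 0 t (lexx 0) t0); exact: (cm_covariates_F0 model).
have mXc : measurable (X @^-1` cube) by exact: (FMs 0 (lexx 0) _ (F0cube 0 (lexx 0))).
have clip0 z : 0 <= clip alpha0 z <= a0.
  have h : `|clip alpha0 z| <= a0 by apply: clip_norm => //; rewrite alpha0_norm.
  have c0 : 0 <= clip alpha0 z by rewrite mulr_ge0 ?indicE//; exact: (cm_intensity_ge0 model).
  by rewrite c0/= -[leLHS]ger0_norm.
have adN t : 0 <= t -> sub_measurable (F t) (fun w => (N w t)%:R : R).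
  move=> t0 B mB; have [F0 FC FU] := Fs t t0.
  rewrite (_ : _ @^-1` B = \bigcup_n (if n%:R \in B then [set w | N w t = n] else set0)).
    by apply: FU => n; case: ifP => _ //; exact: (cm_adapted model).
  apply/seteqP; split => [w /= Bw|w [n _]].
    by exists (N w t) => //; rewrite mem_set.
  by case: ifP => // /set_mem nB /= Nn; rewrite Nn.
have mN t : 0 <= t -> measurable_fun setT (fun w => (N w t)%:R : R).
  by move=> t0; exact: (sub_measurable_measurable (FMs t t0) (adN t t0)).
have [Mad Mmart] := cm_martingale model.
have adL t : 0 <= t <= 1 -> sub_measurable (F t)
    (cumulated_intensity X clip_exposure (clip alpha0) t).
  move=> t01; have /andP[t0 t1] := t01; apply/(sub_measurableP (Fs t t0)).
  rewrite (_ : cumulated_intensity _ _ _ t = (fun w => \1_(X @^-1` cube) w *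
     ((N w t)%:R - ((N w t)%:R - compensator alpha0 X Y t w)))); last first.
    by apply/funext => w; rewrite clip_cumulated_intensity// opprB addrC subrK.
  apply: measurable_funM.
    apply: measurable_indic; rewrite (measurable_g_measurableTypeE (Fs t t0)).
    exact: F0cube.
  apply: measurable_funB; apply/(sub_measurableP (Fs t t0)); first exact: adN.
  exact: (Mad t t0).1.
have aeM t : 0 <= t <= 1 -> {ae P, forall w,
    (N w t)%:R - compensator alpha0 X Y t w =
    (N w t)%:R - cumulated_intensity X clip_exposure (clip alpha0) t w}.
  move=> t01; exists (~` (X @^-1` cube)); split.
  - exact: measurableC.
  - exact: covariates_in_cube.
  - move=> w /= nE cw; apply: nE.
    by rewrite clip_cumulated_intensity// indicE mem_set// mul1r.
have mLam t : 0 <= t <= 1 -> measurable_fun setT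
    (cumulated_intensity X clip_exposure (clip alpha0) t).
  by move=> t01; have /andP[t0 _] := t01; exact: (sub_measurable_measurable (FMs t t0) (adL t t01)).
have t11 : (0 : R) <= 1 <= (1 : R) by rewrite ler01 lexx.
have bYnorm u w : `|clip alpha0 (u, X w) * clip_exposure u w| <= a0.
  have /andP[c0 ca] := clip0 (u, X w); have /andP[y0 y1] := clip_exposure_itv u w.
  rewrite ger0_norm; last exact: mulr_ge0.
  by apply: (le_trans (ler_wpM2l c0 y1)); rewrite mulr1.
have iLw w : lebesgue_measure.-integrable `[0%R, 1%R]
    (EFin \o (fun u => clip alpha0 (u, X w) * clip_exposure u w)).
  apply: (@bounded_integrable _ _ _ _ _ a0) => //; first exact: lebesgue_itv_lty.
  apply: measurable_funTS; apply: measurable_funM.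
    exact: measurableT_comp (clip_measurable (cm_intensity_measurable model)) (@pair2_measurable _ _ _ _ _).
  exact: measurableT_comp clip_exposure_measurable (@pair2_measurable _ _ _ _ _).
split.
- exact: (cm_filtration model).
- exact: (cm_covariates_F0 model).
- exact: adN.
- exact: clip_exposure_measurable.
- exact: clip_exposure_itv.
- exact: clip_measurable (cm_intensity_measurable model).
- exact: clip0.
- exact: adL.
- have iM := (Mad 1 ler01).2.
  have iM' : P.-integrable setT (fun w => ((N w 1)%:R - cumulated_intensity X clip_exposure (clip alpha0) 1 w)%:E).
    apply/integrableP; split; first by apply/measurable_EFinP; apply: measurable_funB; [exact: mN|exact: mLam].
    have /integrableP[mM finM] := iM.
    apply: le_lt_trans finM; apply: ae_ge0_le_integral => //.
    + by apply: measurableT_comp => //; apply/measurable_EFinP; apply: measurable_funB; [exact: mN|exact: mLam].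
    + exact: measurableT_comp.
    + by apply: filterS (aeM 1 t11) => w /= -> _.
  have iL : P.-integrable setT (fun w => (cumulated_intensity X clip_exposure (clip alpha0) 1 w)%:E).
    apply: (@bounded_integrable _ _ _ _ _ a0) => //.
    + exact: probability_setT_lty.
    + exact: mLam.
    + move=> w _; apply: (le_trans (le_normr_Rintegral _ (iLw w))) => //.
      rewrite -[a0](_ : \int[lebesgue_measure]_(u in `[0%R, 1%R]) a0 = a0); last first.
        rewrite Rintegral_cst//= lebesgue_measure_itv/= lte_fin ltr01.
        by rewrite /= subr0 mulr1.
      apply: le_Rintegral => //.
      * exact: (integrable_norm (iLw w)).
      * apply: (@bounded_integrable _ _ _ _ _ `|a0|) => //; exact: lebesgue_itv_lty.
  have := integrableD measurableT iM' iL; apply: eq_integrable => // w _.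
  by rewrite /= -EFinD subrK.
- move=> s t A s0 st t1 FA; have t0 := le_trans s0 st.
  have s01 : 0 <= s <= 1 by rewrite s0 (le_trans st).
  have t01 : 0 <= t <= 1 by rewrite t0.
  have mA : measurable A := FMs s s0 _ FA.
  have E u : 0 <= u <= 1 ->
    (\int[P]_(w in A) ((N w u)%:R - cumulated_intensity X clip_exposure (clip alpha0) u w)%:E =
     \int[P]_(w in A) ((N w u)%:R - compensator alpha0 X Y u w)%:E)%E.
    move=> u01; have /andP[u0 _] := u01; apply: ae_eq_integral => //.
    + apply: measurable_funTS; apply/measurable_EFinP; apply: measurable_funB; [exact: mN|exact: mLam].
    + apply: measurable_funTS; have /integrableP[m _] := (Mad u u0).2; exact: m.
    + by apply: filterS (aeM u u01) => w /= -> _.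
  rewrite (E t t01) (E s s01); exact: (Mmart s t A s0 st FA).
Qed.

End model_reduction.

(** * The weighted norm as a mean over the exposure *)

Section conditional_mean.
Context (R : realType) (d : nat) disp (Omega : measurableType disp)
  (P : probability Omega R) (X : {mfun Omega >-> d.-tuple R})
  (Y : R -> Omega -> R) (g : R * d.-tuple R -> R).
Hypotheses (mY : measurable_fun setT (fun z : R * Omega => Y z.1 z.2))
  (Y0 : forall t w, 0 <= Y t w)
  (gD : measurable_fun [set z : R * d.-tuple R | 0 <= z.1 <= 1] g)
  (gE : forall t : R, 0 <= t <= 1 ->
    (distribution P X).-integrable setT (fun x => (g (t, x))%:E) /\
    forall B, measurable B ->
      (\int[distribution P X]_(x in B) (g (t, x))%:E =
       \int[P]_(w in X @^-1` B) (Y t w)%:E)%E).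

Local Notation PX := (distribution P X).
Local Notation leb := (@lebesgue_measure R).

(** A version of the conditional mean may be negative on null sets and is arbitrary off [0,1]; it is
    cut off and split into signs so that Tonelli applies to each part. *)
Let g1 := g \_ [set z : R * d.-tuple R | 0 <= z.1 <= 1].
Let gp (z : R * d.-tuple R) := Num.max (g1 z) 0.
Let gn (z : R * d.-tuple R) := Num.max (- g1 z) 0.

Let g1_in t x : 0 <= t <= 1 -> g1 (t, x) = g (t, x).
Proof. by move=> t01; rewrite /g1 patchE mem_set. Qed.

Let g1_out t x : ~~ (0 <= t <= 1) -> g1 (t, x) = 0.
Proof. by move=> t01; rewrite /g1 patchE memNset//=; exact/negP. Qed.

Let mg1 : measurable_fun setT g1.
Proof.
apply/(measurable_restrictT _ _).1 => //.
rewrite (_ : [set _ | _] = setT `&` (fst @^-1` `[0, 1])).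
  exact: measurable_fst.
by rewrite setTI; apply/seteqP; split => z; rewrite /= in_itv.
Qed.

Let mgp : measurable_fun setT gp. Proof. exact: measurable_maxr. Qed.
Let mgn : measurable_fun setT gn.
Proof. by apply: measurable_maxr => //; exact: measurable_funN. Qed.
Let gp0 z : 0 <= gp z. Proof. by rewrite le_max lexx orbT. Qed.
Let gn0 z : 0 <= gn z. Proof. by rewrite le_max lexx orbT. Qed.

Let msec t : measurable_fun setT (fun x => g1 (t, x)).
Proof. exact: measurableT_comp mg1 (@pair1_measurable _ _ _ _ _). Qed.

(* [E[Y(t) | X] >= 0] almost surely, as seen by integrating over [g < 0]. *)
Let gn_integral t : (\int[PX]_x (gn (t, x))%:E = 0)%E.
Proof.
have [t01|t01] := boolP (0 <= t <= 1); last first.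
  by apply: integral0_eq => x _; rewrite /gn g1_out// oppr0 maxxx.
pose B := [set x | g1 (t, x) < 0].
have mB : measurable B.
  rewrite -[B]setTI; have := msec t measurableT (measurable_itv `]-oo, 0[).
  by congr measurable; apply/seteqP; split => x; rewrite /= in_itv.
have gnB : (\int[PX]_x (gn (t, x))%:E = \int[PX]_(x in B) (gn (t, x))%:E)%E.
  rewrite [RHS]integral_mkcond; apply: eq_integral => x _; rewrite patchE.
  case: ifPn => // /negP xB; congr (_%:E); apply/max_idPr.
  by rewrite oppr_le0 leNgt; apply/negP => xB'; apply: xB; exact/mem_set.
have := (gE t01).2 B mB; rewrite integralE.
rewrite (_ : \int[PX]_(x in B) _ = 0)%E; last first.
  apply: integral0_eq => x Bx; rewrite funeposE -EFin_max; congr (_%:E); apply/max_idPr.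
  by rewrite -g1_in// ltW.
rewrite (_ : \int[PX]_(x in B) _ = \int[PX]_x (gn (t, x))%:E)%E; last first.
  by rewrite gnB; apply: eq_integral => x _; rewrite funenegE -EFinN -EFin_max /gn g1_in.
rewrite sub0e => E; apply/eqP; rewrite eq_le; apply/andP; split.
  rewrite -leeN2 oppe0 E; apply: integral_ge0 => w _; rewrite lee_fin; exact: Y0.
by apply: integral_ge0 => x _; rewrite lee_fin.
Qed.

Let gp_ae t : 0 <= t <= 1 -> ae_eq PX setT (fun x => (g (t, x))%:E) (fun x => (gp (t, x))%:E).
Proof.
move=> t01.
have mgnt : measurable_fun setT (fun x => (gn (t, x))%:E).
  by apply/measurable_EFinP; exact: measurableT_comp mgn (@pair1_measurable _ _ _ _ _).
have /(ae_eq_integral_abs PX measurableT mgnt) : (\int[PX]_x `|(gn (t, x))%:E| = 0)%E.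
  by rewrite -(gn_integral t); apply: eq_integral => x _; rewrite gee0_abs// lee_fin.
apply: filterS => x /(_ I) /= [gnx] _; congr (_%:E); rewrite /gp g1_in//.
apply/esym/max_idPl; move: gnx; rewrite /gn g1_in// => gnx.
by rewrite -oppr_le0 -gnx le_max lexx.
Qed.

Variable phi : R * d.-tuple R -> R.
Hypothesis mphi : measurable_fun setT phi.

Let phi2 z := phi z ^+ 2.
Let mphi2 : measurable_fun setT phi2. Proof. exact: measurable_funX. Qed.
Let phi20 z : 0 <= phi2 z. Proof. exact: sqr_ge0. Qed.

Let section_transfer t : 0 <= t <= 1 ->
  (\int[PX]_x (phi2 (t, x) * gp (t, x))%:E = \int[P]_w (phi2 (t, X w) * Y t w)%:E)%E.
Proof.
move=> t01.
have mgpt : measurable_fun setT (fun x => gp (t, x)).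
  exact: measurableT_comp mgp (@pair1_measurable _ _ _ _ _).
have mYt : measurable_fun setT (Y t).
  exact: measurableT_comp mY (@pair1_measurable _ _ _ _ _).
have mphit : measurable_fun setT (fun x => phi2 (t, x)).
  exact: measurableT_comp mphi2 (@pair1_measurable _ _ _ _ _).
apply: (@integral_transfer _ _ R _ _ PX _ _ P id X (fun x => gp (t, x)) (Y t)
  (fun x => phi2 (t, x)) _ _ mgpt mYt _ (Y0 t) mphit) => //.
move=> B mB; rewrite -((gE t01).2 B mB); apply: ae_eq_integral => //.
- by apply: measurable_funTS; exact/measurable_EFinP.
- by apply: measurable_funTS; have /integrableP[] := (gE t01).1.
- by apply: filterS (gp_ae t01) => x /(_ I) /= ->.
Qed.

Let Hp (z : measurableTypeR R * d.-tuple R) := (phi2 z * gp z)%:E.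
Let Hn (z : measurableTypeR R * d.-tuple R) := (phi2 z * gn z)%:E.
Let mHp : measurable_fun setT Hp. Proof. by apply/measurable_EFinP; exact: measurable_funM. Qed.
Let mHn : measurable_fun setT Hn. Proof. by apply/measurable_EFinP; exact: measurable_funM. Qed.
Let Hp0 z : (0 <= Hp z)%E. Proof. by rewrite lee_fin mulr_ge0. Qed.
Let Hn0 z : (0 <= Hn z)%E. Proof. by rewrite lee_fin mulr_ge0. Qed.

Let inner_split x : (\int[leb]_(t in `[0%R, 1%R]) (phi (t, x) ^+ 2 * g (t, x))%:E =
  \int[leb]_t Hp (t, x) - \int[leb]_t Hn (t, x))%E.
Proof.
rewrite (_ : (\int[leb]_(t in _) _ = \int[leb]_t (phi2 (t, x) * g1 (t, x))%:E)%E); last first.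
  rewrite [LHS]integral_mkcond; apply: eq_integral => t _; rewrite patchE.
  case: ifPn => [/set_mem|/negP t01]; first by rewrite /= in_itv/= => t01; rewrite g1_in.
  rewrite g1_out ?mulr0//; apply/negP => t01'; apply: t01; apply/mem_set.
  by rewrite /= in_itv.
rewrite integralE; congr (_ - _)%E; apply: eq_integral => t _.
  by rewrite funeposE -EFin_max /Hp /gp maxr_pMr// mulr0.
by rewrite funenegE -EFinN -EFin_max /Hn /gn maxr_pMr// mulr0 mulrN.
Qed.

(** For each t the negative part vanishes for almost every x, with a null set depending on t;
    Tonelli turns this into a null time integral for almost every x. For the positive part the order
    is swapped, each time section is moved from [PX] to [P], and the order is swapped back. *)
Lemma sqnorm_mean :
  sqnorm P X g phi =
  (\int[P]_w \int[leb]_(t in `[0%R, 1%R]) (phi (t, X w) ^+ 2 * Y t w)%:E)%E.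
Proof.
have mHpF := measurable_fun_fubini_tonelli_G (m1 := leb) Hp mHp Hp0.
have mHnF := measurable_fun_fubini_tonelli_G (m1 := leb) Hn mHn Hn0.
have Hn_null : (\int[PX]_x \int[leb]_t Hn (t, x) = 0)%E.
  rewrite -(fubini_tonelli (m1 := leb) (m2 := PX) _ mHn Hn0).
  apply: integral0_eq => t _; apply/eqP; rewrite eq_le; apply/andP; split; last first.
    by apply: integral_ge0 => x _; exact: Hn0.
  have mgnt : measurable_fun setT (fun x => (gn (t, x))%:E).
    by apply/measurable_EFinP; exact: measurableT_comp mgn (@pair1_measurable _ _ _ _ _).
  have gnt : ae_eq PX setT (fun x => (gn (t, x))%:E) (cst 0%E).
    apply/(ae_eq_integral_abs PX measurableT mgnt).
    by rewrite -(gn_integral t); apply: eq_integral => x _; rewrite gee0_abs// lee_fin.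
  have -> : (\int[PX]_x Hn (t, x) = \int[PX]_x (cst 0 x))%E.
    apply: ae_eq_integral => //.
      exact: measurableT_comp mHn (@pair1_measurable _ _ _ _ _).
    by apply: filterS gnt => x /(_ I) /= [gnx] _; rewrite /Hn gnx mulr0.
  by rewrite integral0.
have Hn_ae : ae_eq PX setT (fun x => \int[leb]_t Hn (t, x))%E (cst 0%E).
  apply/(ae_eq_integral_abs PX measurableT mHnF).
  rewrite -Hn_null; apply: eq_integral => x _; rewrite gee0_abs//.
  by apply: integral_ge0 => t _; exact: Hn0.
transitivity (\int[PX]_x \int[leb]_t Hp (t, x))%E.
  rewrite /sqnorm; apply: ae_eq_integral => //.
    apply: eq_measurable_fun (emeasurable_funB mHpF mHnF) => x _.
    by rewrite inner_split.
  by apply: filterS Hn_ae => x /(_ I) /= Hnx _; rewrite inner_split Hnx sube0.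
rewrite -(fubini_tonelli (m1 := leb) (m2 := PX) _ mHp Hp0).
pose K (z : measurableTypeR R * Omega) :=
  (\1_(`[0%R, 1%R]%classic : set R) z.1 * (phi2 (z.1, X z.2) * Y z.1 z.2))%:E.
have mK : measurable_fun setT K.
  apply/measurable_EFinP; apply: measurable_funM.
    exact: (@measurableT_comp _ _ _ _ _ _ (\1_(`[0%R, 1%R]%classic : set R) : R -> R)).
  apply: measurable_funM => //.
  apply: (measurableT_comp mphi2); apply: measurable_fun_pair => //.
  exact: measurableT_comp.
have K0 z : (0 <= K z)%E by rewrite lee_fin; apply: mulr_ge0; [rewrite indicE|exact: mulr_ge0].
transitivity (\int[leb]_t \int[P]_w K (t, w))%E.
  apply: eq_integral => t _; have [t01|t01] := boolP (0 <= t <= 1).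
    rewrite section_transfer//; apply: eq_integral => w _.
    by rewrite /K indicE mem_set ?mul1r//= in_itv.
  rewrite !integral0_eq// => [w _|x _]; last by rewrite /Hp /gp g1_out// maxxx mulr0.
  by rewrite /K indicE memNset ?mul0r//= in_itv/=; exact/negP.
rewrite (fubini_tonelli (m1 := leb) (m2 := P) _ mK K0); apply: eq_integral => w _.
rewrite [RHS]integral_mkcond; apply: eq_integral => t _; rewrite patchE /K indicE.
by case: ifPn => _; rewrite ?mul1r ?mul0r.
Qed.

End conditional_mean.

(** * Exponential weights and convexity *)

Section exponential_weights.
Context (R : realType) (L : finType).
Implicit Types theta u v : L -> R.

Lemma ln_le_subr1 (x : R) : 0 < x -> ln x <= x - 1.
Proof.
move=> x0; rewrite -[leLHS](_ : 1 + (ln x - 1) = _); last by ring.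
by have := expR_ge1Dx (ln x); rewrite lnK//; lra.
Qed.

(** Donsker-Varadhan for the uniform prior, linearised by ln x <= x - 1 at x = exp(u l) / (m * theta
    l). The exponentials then enter linearly, so that their means can be inserted later although
    [theta] depends on the sample. *)
Lemma gibbs_le theta u : (0 < #|L|)%N -> (forall l, 0 < theta l) ->
  \sum_l theta l = 1 ->
  \sum_l theta l * u l <=
  \sum_l theta l * ln (theta l) + ln #|L|%:R + (\sum_l expR (u l)) / #|L|%:R - 1.
Proof.
move=> L0 th0 th1; set m : R := #|L|%:R.
have m0 : 0 < m by rewrite ltr0n.
have le l : theta l * u l <= theta l * ln (theta l) + theta l * ln m + expR (u l) / m - theta l.
  have q0 : 0 < expR (u l) / (m * theta l) by rewrite divr_gt0 ?expR_gt0// mulr_gt0.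
  have := ler_wpM2l (ltW (th0 l)) (ln_le_subr1 q0).
  rewrite ln_div ?posrE ?expR_gt0 ?mulr_gt0// lnM ?posrE// expRK.
  have -> : theta l * (expR (u l) / (m * theta l) - 1) = expR (u l) / m - theta l.
    by field; rewrite !lt0r_neq0.
  by rewrite mulrBr mulrDr; lra.
apply: (le_trans (ler_sum _ (fun l _ => le l))).
by rewrite sumrB !big_split/= -!mulr_suml th1 mul1r.
Qed.

Lemma ler_wavg theta u c : (forall l, 0 < theta l) -> \sum_l theta l = 1 ->
  (forall l, u l <= c) -> \sum_l theta l * u l <= c.
Proof.
move=> th0 th1 uc; rewrite -[leRHS]mul1r -th1 mulr_suml.
by apply: ler_sum => l _; rewrite ler_wpM2l// ltW.
Qed.

(** Variance decomposition: the sides differ by the [theta]-average of (u - m)^2, with m the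
    [theta]-average of u. *)
Lemma wavg_sqr_le theta u c : (forall l, 0 < theta l) -> \sum_l theta l = 1 ->
  (\sum_l theta l * u l - c) ^+ 2 <= \sum_l theta l * (u l - c) ^+ 2.
Proof.
move=> th0 th1; set m := \sum_l theta l * u l.
have -> : (m - c) ^+ 2 = \sum_l (theta l * u l * (2 * m - 2 * c) + theta l * (c ^+ 2 - m ^+ 2)).
  by rewrite big_split/= -!mulr_suml th1 -/m; ring.
apply: ler_sum => l _; rewrite -subr_ge0.
rewrite (_ : _ - _ = theta l * (u l - m) ^+ 2); last by ring.
by rewrite mulr_ge0 ?sqr_ge0// ltW.
Qed.

Definition softmax v (l : L) : R := expR (v l) / \sum_k expR (v k).

Lemma softmax_sum_gt0 v : (0 < #|L|)%N -> 0 < \sum_k expR (v k).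
Proof.
move=> /card_gt0P[l0 _]; rewrite (bigD1 l0)//= ltr_pwDl ?expR_gt0//.
by apply: sumr_ge0 => l _; exact: expR_ge0.
Qed.

Lemma softmax_gt0 v l : (0 < #|L|)%N -> 0 < softmax v l.
Proof. by move=> L0; rewrite divr_gt0 ?expR_gt0// softmax_sum_gt0. Qed.

Lemma softmax_sum1 v : (0 < #|L|)%N -> \sum_l softmax v l = 1.
Proof. by move=> L0; rewrite -mulr_suml divff// lt0r_neq0// softmax_sum_gt0. Qed.

(** Allows the empirical risk of [alpha0] to be subtracted from all exponents without changing the
    weights. *)
Lemma softmax_shift v c : softmax (fun l => v l + c) =1 softmax v.
Proof.
move=> l; rewrite /softmax expRD; under eq_bigr do rewrite expRD.
rewrite -mulr_suml invfM mulrACA divff ?mulr1//.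
by rewrite lt0r_neq0// expR_gt0.
Qed.

(** [gibbs_le] with u = 0 says that the entropy of the weights is at most the log of their number;
    since ln(softmax) = v - ln Z, the average of v is at least ln Z minus that log, and ln Z >= v
    l0. *)
Lemma softmax_avg_ge v l0 : v l0 - ln #|L|%:R <= \sum_l softmax v l * v l.
Proof.
have L0 : (0 < #|L|)%N by apply/card_gt0P; exists l0.
have Z0 := softmax_sum_gt0 v L0.
have t0 l := softmax_gt0 v l L0; have t1 := softmax_sum1 v L0.
set Z := \sum_k expR (v k) in Z0.
have lnt l : softmax v l * ln (softmax v l) = softmax v l * v l - softmax v l * ln Z.
  by rewrite /softmax ln_div ?posrE ?expR_gt0// expRK mulrBr.
have := @gibbs_le (softmax v) (fun=> 0) L0 t0 t1.
rewrite big1 => [|l _]; last by rewrite mulr0.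
under eq_bigr do rewrite lnt.
rewrite sumrB -mulr_suml t1 mul1r expR0 sumr_const -[1 *+ _]/(#|L|%:R) divff ?pnatr_eq0 -?lt0n//.
have : v l0 <= ln Z.
  rewrite -[leLHS]expRK ler_ln ?posrE ?expR_gt0// /Z (bigD1 l0)//= lerDl.
  by apply: sumr_ge0 => l _; exact: expR_ge0.
lra.
Qed.

Lemma softmax_entropy_le0 v : (0 < #|L|)%N ->
  \sum_l softmax v l * ln (softmax v l) <= 0.
Proof.
move=> L0; apply: sumr_le0 => l _; apply: mulr_ge0_le0; first exact/ltW/softmax_gt0.
rewrite -ln1 ler_ln ?posrE ?softmax_gt0// -(softmax_sum1 v L0) (bigD1 l)//= lerDl.
by apply: sumr_ge0 => k _; rewrite ltW// softmax_gt0.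
Qed.

(* Donsker-Varadhan for [kap * n * (risk - (1 + eta) * emp]) bounds the risk of
   the Gibbs mixture by its empirical risk, and the entropy bound for the Gibbs
   weights compares the latter with that of a single element. *)
Lemma gibbs_risk_le (T kap eta : R) (n : nat) (risk emp : L -> R) l0 :
  0 < T -> 0 < kap -> 0 <= eta -> (0 < n)%N ->
  \sum_l softmax (fun k => - n%:R * emp k / T) l * risk l <=
  (1 + eta) * (emp l0 + T * ln #|L|%:R / n%:R) +
  (kap * n%:R)^-1 * (ln #|L|%:R +
    (\sum_l expR (kap * n%:R * (risk l - (1 + eta) * emp l))) / #|L|%:R - 1).
Proof.
move=> T0 k0 eta0 n0; set th := softmax _.
have L0 : (0 < #|L|)%N by apply/card_gt0P; exists l0.
have nR : 0 < n%:R :> R by rewrite ltr0n.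
have kn : 0 < kap * n%:R by rewrite mulr_gt0.
have th0 l : 0 < th l by exact: softmax_gt0.
have th1 : \sum_l th l = 1 by exact: softmax_sum1.
have emp_le : \sum_l th l * emp l <= emp l0 + T * ln #|L|%:R / n%:R.
  have := softmax_avg_ge (fun k => - n%:R * emp k / T) l0; rewrite -/th.
  have -> : \sum_l th l * (- n%:R * emp l / T) = (- n%:R / T) * \sum_l th l * emp l.
    by rewrite mulr_sumr; apply: eq_bigr => l _; ring.
  move=> h; have := ler_wpM2l (ltW (divr_gt0 T0 nR)) h.
  have -> : T / n%:R * (- n%:R / T * \sum_l th l * emp l) = - \sum_l th l * emp l.
    by field; rewrite !lt0r_neq0.
  have -> : T / n%:R * (- n%:R * emp l0 / T - ln #|L|%:R) = - (emp l0 + T * ln #|L|%:R / n%:R).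
    by field; rewrite !lt0r_neq0.
  by rewrite lerN2.
have := gibbs_le (fun l => kap * n%:R * (risk l - (1 + eta) * emp l)) L0 th0 th1.
have -> : \sum_l th l * (kap * n%:R * (risk l - (1 + eta) * emp l)) =
    kap * n%:R * (\sum_l th l * risk l - (1 + eta) * \sum_l th l * emp l).
  rewrite mulrBr !mulr_sumr -sumrB; apply: eq_bigr => l _; ring.
have := softmax_entropy_le0 (fun k => - n%:R * emp k / T) L0; rewrite -/th.
set H := \sum_l th l * ln _; set S := \sum_l expR _.
set A := \sum_l th l * risk l; set E := \sum_l th l * emp l => H0 h.
have h1 : A - (1 + eta) * E <= (kap * n%:R)^-1 * (ln #|L|%:R + S / #|L|%:R - 1).
  rewrite [leRHS]mulrC ler_pdivlMr// [leLHS]mulrC; lra.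
have e1 : 0 <= 1 + eta by lra.
have := ler_wpM2l e1 emp_le; rewrite -/E; lra.
Qed.

End exponential_weights.

Lemma Rintegral_sum (R : realType) d (T : measurableType d)
    (mu : {measure set T -> \bar R}) (D : set T) (I : Type) (s : seq I) (f : I -> T -> R) :
  measurable D -> (forall i, mu.-integrable D (EFin \o f i)) ->
  \int[mu]_(x in D) (\sum_(i <- s) f i x) = \sum_(i <- s) \int[mu]_(x in D) f i x.
Proof.
move=> mD fi; rewrite /Rintegral; under eq_integral do rewrite -sumEFin.
rewrite (integral_sum mD (f := fun i x => (f i x)%:E))//.
apply/esym/sum_fine => i _; exact: (integrable_fin_num mD (fi i)).
Qed.

Section mixture.
Context (R : realType) dS (S : measurableType dS) disp (Omega : measurableType disp)
  (P : probability Omega R) (F : R -> set (set Omega)).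
Variables (X : Omega -> S) (N : Omega -> counting_path R) (Y : R -> Omega -> R)
  (beta : R * S -> R) (B : R).
Hypothesis bi : bounded_intensity P F X N Y beta B.
Variables (L : finType) (a : L -> R * S -> R) (b : R).
Hypotheses (ma : forall l, measurable_fun setT (a l)) (ab : forall l z, `|a l z| <= b)
  (b0 : 0 <= b) (B0 : 0 <= B).

(** Pointwise convexity of the square, integrated against the exposure and then over [Omega]. *)
Lemma mean_sq_loss_mixture (theta : L -> R) :
  (forall l, 0 < theta l) -> \sum_l theta l = 1 ->
  mean_sq_loss P X Y beta (fun z => \sum_l theta l * a l z) <=
  \sum_l theta l * mean_sq_loss P X Y beta (a l).
Proof.
move=> th0 th1.
have mmix : measurable_fun setT (fun z => \sum_l theta l * a l z).
  by apply: measurable_sum => l; exact: measurable_funM.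
have mixb z : `|\sum_l theta l * a l z| <= b.
  apply: (le_trans (ler_norm_sum _ _ _)).
  under eq_bigr do rewrite normrM (gtr0_norm (th0 _)).
  exact: ler_wavg.
have mbeta := bi_measurable bi.
have msq l : measurable_fun setT (fun z => (a l z - beta z) ^+ 2).
  by apply: measurable_funX; exact: measurable_funB.
have bN z : `|beta z| <= B by have /andP[? ?] := bi_itv bi z; rewrite ger0_norm.
have sqn (x y : R) : `|x| <= b -> `|y| <= B -> `|(x - y) ^+ 2| <= (b + B) ^+ 2.
  move=> xb yB; rewrite normrX lerXn2r// ?nnegrE ?addr_ge0//.
  by rewrite (le_trans (ler_normB _ _))// lerD.
have iQ l := sq_loss_integrable bi (ma l) (ab l) b0 B0.
have iQth l : P.-integrable setT (EFin \o (fun w => theta l * sq_loss X Y beta (a l) w)).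
  rewrite (_ : _ \o _ = (fun w => (theta l)%:E * (sq_loss X Y beta (a l) w)%:E)%E)//.
  exact: (integrableZl measurableT (theta l) (iQ l)).
have -> : \sum_l theta l * mean_sq_loss P X Y beta (a l) =
    \int[P]_w (\sum_l theta l * sq_loss X Y beta (a l) w).
  by rewrite Rintegral_sum//; apply: eq_bigr => l _; rewrite RintegralZl.
apply: le_Rintegral => //.
- exact: (sq_loss_integrable bi mmix mixb b0 B0).
- have := @integrable_sum _ _ _ P setT measurableT _ (index_enum L) xpredT
    (fun l w => (theta l * sq_loss X Y beta (a l) w)%:E) (fun l _ => iQth l).
  by apply: eq_integrable => // w _; rewrite /= sumEFin.
move=> w _.
have iS l : lebesgue_measure.-integrable `[0%R, 1%R]
    (EFin \o (fun t => theta l * ((a l (t, X w) - beta (t, X w)) ^+ 2 * Y t w))).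
  have := @exposure_integrable _ _ _ _ _ _ _ _ _ _ _ _ bi (theta l * (b + B) ^+ 2)
    (fun z => theta l * (a l z - beta z) ^+ 2) true false 0 1 w.
  have mth : measurable_fun setT (fun z => theta l * (a l z - beta z) ^+ 2).
    exact: measurable_funM.
  move=> /(_ mth) H; apply: eq_integrable (H _) => // [t _|z]; first by rewrite /= mulrA.
  rewrite normrM (gtr0_norm (th0 l)); apply: ler_wpM2l; [exact/ltW/th0|exact: sqn].
have -> : \sum_l theta l * sq_loss X Y beta (a l) w =
    \int[lebesgue_measure]_(t in `[0, 1])
      (\sum_l theta l * ((a l (t, X w) - beta (t, X w)) ^+ 2 * Y t w)).
  rewrite Rintegral_sum//; apply: eq_bigr => l _; rewrite RintegralZl//.
  exact: (exposure_integrable bi true false 0 1 w (msq l) (fun z => sqn _ _ (ab l z) (bN z))).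
apply: le_Rintegral => //.
- apply: (exposure_integrable bi true false 0 1 w _ (K := (b + B) ^+ 2)
    (phi := fun z => (\sum_l theta l * a l z - beta z) ^+ 2)).
    by apply: measurable_funX; exact: measurable_funB.
  by move=> z; apply: sqn.
- have := @integrable_sum _ _ _ lebesgue_measure `[0%R, 1%R]%classic (measurable_itv _) _ (index_enum L) xpredT
    (fun l t => (theta l * ((a l (t, X w) - beta (t, X w)) ^+ 2 * Y t w))%:E) (fun l _ => iS l).
  by apply: eq_integrable => // t _; rewrite /= sumEFin.
move=> t _.
have -> : \sum_l theta l * ((a l (t, X w) - beta (t, X w)) ^+ 2 * Y t w) =
    (\sum_l theta l * (a l (t, X w) - beta (t, X w)) ^+ 2) * Y t w.
  by rewrite mulr_suml; apply: eq_bigr => l _; rewrite mulrA.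
apply: ler_wpM2r; first by have /andP[] := bi_exposure_itv bi t w.
exact: (wavg_sqr_le (fun l => a l (t, X w)) (beta (t, X w)) th0 th1).
Qed.

End mixture.

(** * Oracle inequality *)

Section observation_risk.
Context (R : realType) (d : nat).
Implicit Types (phi : R * d.-tuple R -> R) (o : observation R d).

Definition obs_risk phi o : R :=
  \int[lebesgue_measure]_(t in `[0, 1]) (phi (t, o.1.1) ^+ 2 * o.2 t) -
  2 * \int[lebesgue_stieltjes_measure (cp_real o.1.2)]_(t in `]0, 1]) phi (t, o.1.1).

Lemma empirical_riskE n (D : 'I_n -> observation R d) phi :
  empirical_risk D phi = n%:R^-1 * \sum_(i < n) obs_risk phi (D i).
Proof.
rewrite /empirical_risk /obs_risk sumrB mulrBr -mulr_sumr; congr (_ - _).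
by rewrite mulrA [2 / _]mulrC.
Qed.

Lemma obs_risk_clip phi o : @cube R d o.1.1 -> obs_risk (clip phi) o = obs_risk phi o.
Proof.
move=> co; congr (_ - 2 * _); apply: eq_Rintegral => t /set_mem/= t01.
  by rewrite clip_id//; split.
rewrite clip_id//; split => //=; move: t01; rewrite !in_itv/= => /andP[t0 t1].
by rewrite (ltW t0).
Qed.

End observation_risk.

Section oracle.
Context (R : realType) (d : nat) disp (Omega : measurableType disp)
  (P : probability Omega R) (F : R -> set (set Omega))
  (alpha0 : R * d.-tuple R -> R) (X : {mfun Omega >-> d.-tuple R})
  (N : Omega -> counting_path R) (Y : R -> Omega -> R) (a0 b : R).
Hypotheses (model : counting_model P F alpha0 X N Y)
  (alpha0_norm : supnorm alpha0 = a0%:E) (b0 : 0 <= b).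

Local Notation Yc := (clip_exposure Y).
Local Notation be := (clip alpha0).
Local Notation obs := (observe X N Y).
Local Notation risk f := (mean_sq_loss P X Yc be (clip f)).

Let bi := bounded_intensity_model model alpha0_norm.
Let a00 : 0 <= a0 := intensity_norm_ge0 alpha0_norm.

Let obs_riskE (phi : R * d.-tuple R -> R) w :
  obs_risk phi (obs w) =
  exposure_integral X Yc (fun z => phi z ^+ 2) w - 2 * jump_integral X N phi w.
Proof.
congr (_ - _); apply: eq_Rintegral => t /set_mem/= t01.
by rewrite /clip_exposure indicE mem_set// mul1r.
Qed.

Lemma covariates_cube_measurable : measurable (X @^-1` @cube R d).
Proof.
have [_ FMs _] := cm_filtration model.
exact: (FMs 0 (lexx 0) _ (cm_covariates_F0 model (@cube_measurable R d))).
Qed.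

Lemma obs_risk_excess f w : measurable_fun setT f -> (supnorm f <= b%:E)%E ->
  obs_risk (clip f) (obs w) - obs_risk be (obs w) = excess_loss X N Yc be (clip f) w.
Proof.
move=> mf fb; rewrite !obs_riskE /excess_loss.
have mc := clip_measurable mf; have nc := clip_norm b0 fb.
have mb := bi_measurable bi.
have nb z : `|be z| <= a0 by have /andP[? ?] := bi_itv bi z; rewrite ger0_norm.
have sq (h : R * d.-tuple R -> R) c : (forall z, `|h z| <= c) -> forall z, `|h z ^+ 2| <= c ^+ 2.
  move=> hc z; rewrite normrX lerXn2r// nnegrE//; exact: le_trans (hc z).
have -> : exposure_integral X Yc (fun z => clip f z ^+ 2 - be z ^+ 2) w =
  exposure_integral X Yc (fun z => clip f z ^+ 2) w -
  exposure_integral X Yc (fun z => be z ^+ 2) w.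
  rewrite /exposure_integral -RintegralB//.
  - by apply: eq_Rintegral => t _; rewrite mulrBl.
  - exact: (exposure_integrable bi true false 0 1 w (measurable_funX _ mc) (sq _ _ nc)).
  - exact: (exposure_integrable bi true false 0 1 w (measurable_funX _ mb) (sq _ _ nb)).
have -> : jump_integral X N (fun z => clip f z - be z) w =
  jump_integral X N (clip f) w - jump_integral X N be w.
  rewrite /jump_integral RintegralB//.
  - apply: (@bounded_integrable _ _ _ _ _ b) => //; first exact: counting_path_measure01.
    by apply: measurable_funTS; exact: measurableT_comp mc (@pair2_measurable _ _ _ _ _).
  - apply: (@bounded_integrable _ _ _ _ _ a0) => //; first exact: counting_path_measure01.
    by apply: measurable_funTS; exact: measurableT_comp mb (@pair2_measurable _ _ _ _ _).
by ring.
Qed.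

Lemma covariates_in_cube_ae : {ae P, forall w, (X @^-1` @cube R d) w}.
Proof.
exists (~` (X @^-1` @cube R d)); split => //; last exact: covariates_in_cube model.
exact/measurableC/covariates_cube_measurable.
Qed.

Lemma sqnorm_exposure (g f : R * d.-tuple R -> R) : cond_mean P X Y g ->
  measurable_fun setT f ->
  sqnorm P X g (f \- alpha0)%R =
  (\int[P]_w \int[lebesgue_measure]_(t in `[0%R, 1%R])
    ((f (t, X w) - alpha0 (t, X w)) ^+ 2 * Yc t w)%:E)%E.
Proof.
move=> [mg gE] mf.
have Yc0 t w : 0 <= Yc t w by have /andP[] := bi_exposure_itv bi t w.
have gE' t : 0 <= t <= 1 -> (distribution P X).-integrable setT (fun x => (g (t, x))%:E) /\
    forall B, measurable B -> (\int[distribution P X]_(x in B) (g (t, x))%:E =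
       \int[P]_(w in X @^-1` B) (Yc t w)%:E)%E.
  move=> t01; split => [|B mB]; first exact: (gE t t01).1.
  rewrite (gE t t01).2//; apply: eq_integral => w _.
  by rewrite /clip_exposure indicE mem_set ?mul1r//= in_itv.
have mfa : measurable_fun setT (f \- alpha0)%R.
  exact: measurable_funB mf (cm_intensity_measurable model).
exact: (sqnorm_mean (bi_exposure_measurable bi) Yc0 mg gE' mfa).
Qed.

Lemma sqnorm_ge0 (g f : R * d.-tuple R -> R) : cond_mean P X Y g ->
  measurable_fun setT f -> (0 <= sqnorm P X g (f \- alpha0)%R)%E.
Proof.
move=> gc mf; rewrite sqnorm_exposure//; apply: integral_ge0 => w _.
apply: integral_ge0 => t _; rewrite lee_fin mulr_ge0 ?sqr_ge0//.
by have /andP[] := bi_exposure_itv bi t w.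
Qed.

(** The norm sees the functions as given, [risk] sees the clipped ones; they agree whenever X lies
    in the cube. Boundedness of [clip f] makes the value a real number. *)
Lemma sqnorm_mean_sq_loss (g f : R * d.-tuple R -> R) : cond_mean P X Y g ->
  measurable_fun setT f -> (forall z, `|clip f z| <= b) ->
  sqnorm P X g (f \- alpha0)%R = (risk f)%:E.
Proof.
move=> gc mf nc; rewrite sqnorm_exposure//.
have mc := clip_measurable mf; have mb := bi_measurable bi.
have iQ := sq_loss_integrable bi mc nc b0 a00.
rewrite /mean_sq_loss /Rintegral fineK; last exact: integrable_fin_num.
have mS : measurable_fun setT (fun z => (clip f z - be z) ^+ 2).
  by apply: measurable_funX; exact: measurable_funB.
have nS z : `|(clip f z - be z) ^+ 2| <= (b + a0) ^+ 2.
  rewrite normrX lerXn2r// ?nnegrE ?addr_ge0//.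
  have /andP[? ?] := bi_itv bi z.
  by rewrite (le_trans (ler_normB _ _))// lerD// ger0_norm.
have mfa : measurable_fun setT (fun z => (f z - alpha0 z) ^+ 2).
  by apply: measurable_funX; exact: measurable_funB mf (cm_intensity_measurable model).
apply: ae_eq_integral => //.
- exact: (ge0_exposure_integral_measurable bi mfa (fun z => sqr_ge0 _)).
- by have /integrableP[] := iQ.
apply: filterS covariates_in_cube_ae => w cw _.
rewrite /sq_loss /exposure_integral /Rintegral fineK; last first.
  apply: integrable_fin_num => //.
  exact: (exposure_integrable bi true false 0 1 w mS nS).
by apply: eq_integral => t /set_mem/= t01; rewrite !clip_id.
Qed.

Variables (L : finType) (alpha : L -> R * d.-tuple R -> R).
Hypotheses (L_gt0 : (0 < #|L|)%N) (alpha_meas : forall l, measurable_fun setT (alpha l))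
  (alpha_norm : forall l, (supnorm (alpha l) <= b%:E)%E).
Variables (n : nat) (disp' : measure_display) (Omega' : measurableType disp')
  (P' : probability Omega' R) (Dn : 'I_n -> Omega' -> observation R d).
Hypotheses (n_gt0 : (0 < n)%N) (Dn_iid : iid_copies P P' obs Dn).
Variables (T eta : R).
Hypotheses (T0 : 0 < T) (eta01 : 0 < eta <= 1).

Local Notation kap := (laplace_rate a0 b eta).

Definition obs_excess l (o : observation R d) : R := obs_risk (clip (alpha l)) o - obs_risk be o.

Definition emp_excess (w : Omega') (l : L) : R := n%:R^-1 * \sum_(i < n) obs_excess l (Dn i w).

Let obs_excessE l : obs_excess l \o obs = excess_loss X N Yc be (clip (alpha l)).
Proof. by apply/funext => w; rewrite /= /obs_excess obs_risk_excess. Qed.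

Let mc l := clip_measurable (alpha_meas l).
Let nc l := clip_norm b0 (alpha_norm l).
Let nR : 0 < n%:R :> R. Proof. by rewrite ltr0n. Qed.

Let obs_excess_integrable l : P.-integrable setT (EFin \o obs_excess l \o obs).
Proof.
rewrite (_ : _ \o _ = EFin \o (obs_excess l \o obs))// obs_excessE.
exact: (excess_loss_integrable bi (mc l) (nc l) b0 a00).
Qed.

Lemma emp_excess_integrable l : P'.-integrable setT (EFin \o (emp_excess ^~ l)).
Proof.
have iS : P'.-integrable setT (fun w => \sum_(i < n) (obs_excess l (Dn i w))%:E)%E.
  apply: (integrable_sum measurableT) => i _.
  exact: (iid_integral Dn_iid i (obs_excess_integrable l)).1.
have := integrableZl measurableT n%:R^-1 iS; apply: eq_integrable => // w _.
by rewrite /= sumEFin.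
Qed.

Lemma emp_excess_mean_le l : \int[P']_w emp_excess w l <= (1 + eta) * risk (alpha l).
Proof.
have iD i := iid_integral Dn_iid i (obs_excess_integrable l).
have iS : P'.-integrable setT (EFin \o (fun w => \sum_(i < n) obs_excess l (Dn i w))).
  have : P'.-integrable setT (fun w => \sum_(i < n) (obs_excess l (Dn i w))%:E)%E.
    by apply: (integrable_sum measurableT) => i _; exact: (iD i).1.
  by apply: eq_integrable => // w _; rewrite /= sumEFin.
rewrite /emp_excess RintegralZl// Rintegral_sum//; last by move=> i; exact: (iD i).1.
have E i : \int[P']_w obs_excess l (Dn i w) = \int[P]_w excess_loss X N Yc be (clip (alpha l)) w.
  by rewrite /Rintegral (iD i).2 -obs_excessE.
under eq_bigr do rewrite E.
rewrite sumr_const card_ord -[X in _ * X <= _]mulr_natl mulrA mulVf ?lt0r_neq0// mul1r.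
exact: (excess_loss_mean_le bi (mc l) (nc l) b0 a00 eta01).
Qed.

(** Multiplied by n the empirical mean is a sum, so the exponential is a product of n copies of the
    one-individual exponential. *)
Lemma emp_excess_laplace l :
  (\int[P']_w (expR (kap * n%:R * (risk (alpha l) - (1 + eta) * emp_excess w l)))%:E <= 1)%E.
Proof.
pose f (o : observation R d) := expR (kap * (risk (alpha l) - (1 + eta) * obs_excess l o)).
have mf : measurable_fun setT (f \o obs).
  rewrite (_ : f \o obs = (fun w => expR (kap * (risk (alpha l) - (1 + eta) * (obs_excess l \o obs) w))))//.
  apply: measurableT_comp => //; apply: measurable_funM => //; apply: measurable_funB => //.
  by apply: measurable_funM => //; apply/measurable_EFinP; exact: (measurable_int P (obs_excess_integrable l)).
have f1 : (\int[P]_w (f (obs w))%:E <= 1)%E.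
  have := excess_loss_laplace bi (mc l) (nc l) b0 a00 eta01.
  by rewrite -obs_excessE.
have := iid_prod_integral_le1 Dn_iid mf (fun o => expR_ge0 _) f1.
congr (_ <= _)%E; apply: eq_integral => w _; congr (_%:E).
rewrite -expR_sum; congr expR; rewrite -mulr_sumr sumrB -mulr_sumr sumr_const card_ord.
rewrite /emp_excess -mulrA; congr (kap * _); rewrite -mulr_natl.
by field; rewrite lt0r_neq0.
Qed.

(** Almost sure only: the empirical risk uses the given functions and [emp_excess] the clipped ones,
    which agree once all sampled covariates lie in the cube. The risk of [alpha0] is a shift common
    to all exponents. *)
Lemma exp_weight_softmax : {ae P', forall w l,
  exp_weight alpha T (fun i => Dn i w) l =
  softmax (fun k => - n%:R * emp_excess w k / T) l}.
Proof.
pose C : set (observation R d) := [set o | @cube R d o.1.1].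
have mX := covariates_cube_measurable.
have mC : measurable (obs @^-1` (~` C)) by exact: measurableC.
have all_cube : {ae P', forall w i, C (Dn i w)}.
  apply: filter_forall => i; exists (Dn i @^-1` (~` C)); split.
  - exact: Dn_iid.1.
  - by rewrite (iid_law Dn_iid)//; exact: covariates_in_cube model.
  - by [].
apply: filterS all_cube => w cw l.
pose c0 := - (\sum_(i < n) obs_risk be (Dn i w)) / T.
rewrite -(softmax_shift _ c0) /exp_weight /softmax.
have E k : - n%:R * empirical_risk (fun i => Dn i w) (alpha k) / T =
  - n%:R * emp_excess w k / T + c0.
  have SE : \sum_(i < n) obs_excess k (Dn i w) =
      \sum_(i < n) obs_risk (alpha k) (Dn i w) - \sum_(i < n) obs_risk be (Dn i w).
    rewrite -sumrB; apply: eq_bigr => i _; rewrite /obs_excess obs_risk_clip//; exact: cw.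
  rewrite empirical_riskE /emp_excess SE /c0.
  move: (\sum_(i < n) obs_risk (alpha k) _) (\sum_(i < n) obs_risk be _) => x y.
  by field; rewrite !lt0r_neq0.
by rewrite E; congr (_ / _); apply: eq_bigr => k _; rewrite E.
Qed.

(** The dominating [G] is the bound of [gibbs_risk_le], affine in [emp_excess w l0] and in the sum
    [S] of exponentials; only the means of these two enter. *)
Lemma aggregate_risk_le (g : R * d.-tuple R -> R) l0 : cond_mean P X Y g ->
  (\int[P']_w sqnorm P X g (aggregate alpha T (fun i => Dn i w) \- alpha0)%R
   <= ((1 + eta) ^+ 2 * risk (alpha l0) +
       ((1 + eta) * T + kap^-1) * ln #|L|%:R / n%:R)%:E)%E.
Proof.
move=> gc.
have k0 : 0 < kap by exact: laplace_rate_gt0.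
have eta0 : 0 < eta by have /andP[] := eta01.
pose S w := \sum_l expR (kap * n%:R * (risk (alpha l) - (1 + eta) * emp_excess w l)).
pose G w := (1 + eta) * (emp_excess w l0 + T * ln #|L|%:R / n%:R) +
  (kap * n%:R)^-1 * (ln #|L|%:R + S w / #|L|%:R - 1).
have memp l : measurable_fun setT (emp_excess ^~ l).
  exact/measurable_EFinP/(measurable_int P')/emp_excess_integrable.
have iexp l : P'.-integrable setT (EFin \o (fun w =>
    expR (kap * n%:R * (risk (alpha l) - (1 + eta) * emp_excess w l)))).
  apply/integrableP; split.
    apply/measurable_EFinP; apply: measurableT_comp => //; apply: measurable_funM => //.
    by apply: measurable_funB => //; exact: measurable_funM.
  apply: le_lt_trans (ltry 1); apply: le_trans (emp_excess_laplace l).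
  by apply: integral_le_nonmeasurable => w; rewrite /= ?lee_fin// ger0_norm// expR_ge0.
have iS : P'.-integrable setT (EFin \o S).
  have := integrable_sum measurableT (index_enum L) (fun l (_ : true) => iexp l).
  by apply: eq_integrable => // w _; rewrite /= sumEFin.
have SL : \int[P']_w S w <= #|L|%:R.
  rewrite /S Rintegral_sum// (le_trans (_ : _ <= \sum_(l : L) 1))//; last by rewrite sumr_const.
  apply: ler_sum => l _; rewrite -lee_fin /Rintegral fineK; last exact: (integrable_fin_num measurableT (iexp l)).
  exact: emp_excess_laplace.
(* The nonrandom part of [G], which holds the -1 of the linearised entropy bound. *)
pose c1 := (1 + eta) * (T * ln #|L|%:R / n%:R) + (kap * n%:R)^-1 * (ln #|L|%:R - 1).
have GE w : G w = c1 + ((1 + eta) * emp_excess w l0 + (kap * n%:R)^-1 / #|L|%:R * S w).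
  by rewrite /G /c1; ring.
have i1 : P'.-integrable setT (EFin \o cst c1) by exact: finite_measure_integrable_cst.
have i2 : P'.-integrable setT (EFin \o (fun w => (1 + eta) * emp_excess w l0)).
  exact: (integrableZl measurableT (1 + eta) (emp_excess_integrable l0)).
have i3 : P'.-integrable setT (EFin \o (fun w => (kap * n%:R)^-1 / #|L|%:R * S w)).
  exact: (integrableZl measurableT ((kap * n%:R)^-1 / #|L|%:R) iS).
have i23 : P'.-integrable setT (EFin \o (fun w =>
    (1 + eta) * emp_excess w l0 + (kap * n%:R)^-1 / #|L|%:R * S w)).
  exact: (integrableD measurableT i2 i3).
have iG : P'.-integrable setT (EFin \o G).
  by have := integrableD measurableT i1 i23; apply: eq_integrable => // w _; rewrite /= GE.
apply: (@le_trans _ _ (\int[P']_w (G w)%:E)%E).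
  apply: ae_integral_le_nonmeasurable.
  - move=> w; apply: sqnorm_ge0 => //.
    by apply: measurable_sum => l; exact: measurable_funM.
  - by have /integrableP[] := iG.
  - apply: filterS exp_weight_softmax => w wE.
    pose th := softmax (fun k => - n%:R * emp_excess w k / T).
    have th0 l : 0 < th l by exact: softmax_gt0.
    have th1 : \sum_l th l = 1 by exact: softmax_sum1.
    pose f z := \sum_l th l * alpha l z.
    have -> : aggregate alpha T (fun i => Dn i w) = f.
      by apply/funext => z; apply: eq_bigr => l _; rewrite wE.
    have clipf : clip f = (fun z => \sum_l th l * clip (alpha l) z).
      apply/funext => z; rewrite /clip /f mulr_sumr; apply: eq_bigr => l _; ring.
    have mf : measurable_fun setT f.
      by apply: measurable_sum => l; exact: measurable_funM.
    rewrite (sqnorm_mean_sq_loss gc mf); last first.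
      move=> z; rewrite clipf (le_trans (ler_norm_sum _ _ _))//.
      under eq_bigr do rewrite normrM (gtr0_norm (th0 _)).
      by apply: ler_wavg => // l; exact: nc.
    rewrite lee_fin clipf.
    apply: (le_trans (mean_sq_loss_mixture bi mc nc b0 a00 th0 th1)).
    exact: (gibbs_risk_le (fun l => risk (alpha l)) (emp_excess w) l0 T0 k0 (ltW eta0) n_gt0).
rewrite -[X in (X <= _)%E]fineK; last exact: integrable_fin_num.
rewrite -/(Rintegral _ _ _) lee_fin (_ : \int[P']_w G w =
  \int[P']_w (cst c1 w + ((1 + eta) * emp_excess w l0 + (kap * n%:R)^-1 / #|L|%:R * S w))); last first.
  by apply: eq_Rintegral => w _; exact: GE.
rewrite (RintegralD measurableT i1 i23) (RintegralD measurableT i2 i3).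
rewrite (RintegralZl _ measurableT (emp_excess_integrable l0)) (RintegralZl _ measurableT iS).
rewrite Rintegral_cst// [X in c1 * fine X](_ : _ = 1%E); last exact: probability_setT.
have e1 : 0 <= 1 + eta by rewrite addr_ge0// ltW.
have h1 := ler_wpM2l e1 (emp_excess_mean_le l0).
have LR : 0 < #|L|%:R :> R by rewrite ltr0n.
have q0 : 0 <= (kap * n%:R)^-1 / #|L|%:R.
  by rewrite ltW// divr_gt0// invr_gt0 mulr_gt0.
have h2 := ler_wpM2l q0 SL.
(* The mean of [S] is at most the number of elements, so its term is at most (kap n)^-1, exactly
   what the -1 in [c1] takes away. *)
rewrite divfK ?lt0r_neq0// in h2.
have -> : (1 + eta) ^+ 2 * risk (alpha l0) +
       ((1 + eta) * T + kap^-1) * ln #|L|%:R / n%:R =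
  c1 + ((1 + eta) * ((1 + eta) * risk (alpha l0)) + (kap * n%:R)^-1).
  by rewrite /c1; field; rewrite !lt0r_neq0.
by rewrite mulr1 lerD2l lerD.
Qed.

End oracle.

Theorem theorem4 (R : realType) (b a0 T eps : R)
    (b_gt0 : 0 < b) (T_gt0 : 0 < T) (eps_gt0 : 0 < eps) :
  exists c : R,
  forall (d : nat) (disp : measure_display) (Omega : measurableType disp)
    (P : probability Omega R) (F : R -> set (set Omega))
    (alpha0 : R * d.-tuple R -> R) (X : {mfun Omega >-> d.-tuple R})
    (N : Omega -> counting_path R) (Y : R -> Omega -> R)
    (model : counting_model P F alpha0 X N Y)
    (alpha0_norm : supnorm alpha0 = a0%:E)
    (g : R * d.-tuple R -> R) (g_cond : cond_mean P X Y g)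
    (Lambda : finType) (Lambda_gt0 : (0 < #|Lambda|)%N)
    (alpha : Lambda -> R * d.-tuple R -> R)
    (alpha_meas : forall l, measurable_fun setT (alpha l))
    (alpha_norm : forall l, (supnorm (alpha l) <= b%:E)%E)
    (n : nat) (n_gt0 : (0 < n)%N)
    (disp' : measure_display) (Omega' : measurableType disp')
    (P' : probability Omega' R) (Dn : 'I_n -> Omega' -> observation R d)
    (Dn_iid : iid_copies P P' (observe X N Y) Dn),
  (\int[P']_w sqnorm P X g (aggregate alpha T (fun i => Dn i w) \- alpha0)%R
   <= (1 + eps)%:E *
        ereal_inf [set sqnorm P X g (alpha l \- alpha0)%R | l in [set: Lambda]]
      + (c * ln #|Lambda|%:R / n%:R)%:E)%E.
Proof.
(* As eta <= 1, (1 + eta)^2 <= 1 + 3 eta <= 1 + eps. *)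
pose eta := Num.min eps 1 / 3.
have [eta_gt0 eta_eps eta_1] : [/\ 0 < eta, 3 * eta <= eps & 3 * eta <= 1].
  have eta3 : 3 * eta = Num.min eps 1 by rewrite /eta; field.
  rewrite eta3; split; first by rewrite divr_gt0// lt_min eps_gt0 ltr01.
    by rewrite ge_min lexx.
  by rewrite ge_min lexx orbT.
have eta01 : 0 < eta <= 1 by rewrite eta_gt0; lra.
have eta2 : (1 + eta) ^+ 2 <= 1 + eps by nra.
(* The first term is the price of the temperature, the second that of the entropy. [laplace_rate]
   involves [a0], [b] and [eta] alone, so the constant is fixed before the dimension, the dictionary
   and n. *)
exists ((1 + eta) * T + (laplace_rate a0 b eta)^-1).
move=> d disp Omega P F alpha0 X N Y model alpha0_norm g g_cond Lambda Lambda_gt0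
  alpha alpha_meas alpha_norm n n_gt0 disp' Omega' P' Dn Dn_iid.
have b_ge0 := ltW b_gt0.
pose risk l := mean_sq_loss P X (clip_exposure Y) (clip alpha0) (clip (alpha l)).
have riskE l : sqnorm P X g (alpha l \- alpha0)%R = (risk l)%:E.
  exact: (sqnorm_mean_sq_loss model alpha0_norm b_ge0 g_cond (alpha_meas l)
    (clip_norm b_ge0 (alpha_norm l))).
have risk_ge0 l : 0 <= risk l.
  have /andP[] // := mean_sq_loss_itv (bounded_intensity_model model alpha0_norm)
    (clip_measurable (alpha_meas l)) (clip_norm b_ge0 (alpha_norm l)) b_ge0
    (intensity_norm_ge0 alpha0_norm).
have /card_gt0P[l0 _] := Lambda_gt0.
have [ls _ ls_min] := @arg_minP _ R Lambda l0 xpredT risk isT.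
apply: (le_trans (aggregate_risk_le model alpha0_norm b_ge0 Lambda_gt0 alpha_meas
  alpha_norm n_gt0 Dn_iid T_gt0 eta01 ls g_cond)).
rewrite EFinD leeD2r// (@le_trans _ _ ((1 + eps)%:E * (risk ls)%:E)%E)//.
  by rewrite -EFinM lee_fin ler_wpM2r// risk_ge0.
apply: lee_wpmul2l; first by rewrite lee_fin addr_ge0// ltW.
by apply/ereal_infP => _ [l _ <-]; rewrite riskE lee_fin ls_min.
Qed.
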